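(* The following problem is NP-hard: given rational samples $\{(\mathbf{x}_i,y_i)\}_{i\in[m]}$ with $\mathbf{x}_i\in\mathbb{R}^n$, $y_i\in\mathbb{R}$, and coefficients $\alpha_1,\alpha_2\in\{\pm1\}$, determine whether there exist $\mathbf{w}^1,\mathbf{w}^2\in\mathbb{R}^n$ and $b_1,b_2\in\mathbb{R}$ such that $$\alpha_1[\langle\mathbf{w}^1,\mathbf{x}_i\rangle+b_1]_++\alpha_2[\langle\mathbf{w}^2,\mathbf{x}_i\rangle+b_2]_+=y_i\quad\text{for all }i\in[m],$$ i.e. whether the training error of a depth-2 network with two ReLUs can be made $0$.
   Context: $[z]_+:=\max(0,z)$. A depth-2 network with two ReLU units computes $\mathbf{z}\mapsto\sum_{j=1}^2\alpha_j[\langle\mathbf{w}^j,\mathbf{z}\rangle+b_j]_+$. *)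

(* Defs.v *)
From Stdlib Require Import Reals QArith List Arith PArith NArith ZArith.
Local Open Scope nat_scope.
Import ListNotations.

(* A machine model: deterministic single-tape Turing machines over   *)
(* the tape alphabet {blank, 0, 1} = option bool, with finitely many *)
(* states 0 .. tm_Q - 1.                                              *)

Inductive move := MLeft | MRight | MStay.
Definition sym := option bool.

Record TM := {
  tm_Q : nat;
  tm_delta : nat -> sym -> (nat * sym * move);
  tm_start : nat;
  tm_halt : nat;
  tm_delta_ok : forall (st : nat) (s : sym), st < tm_Q -> fst (fst (tm_delta st s)) < tm_Q;
  tm_start_ok : tm_start < tm_Q;
  tm_halt_ok : tm_halt < tm_Q
}.

(* configuration: state, tape left of head (nearest cell first),
   scanned symbol, tape right of head; all other cells are blank *)
Record cfg := mkCfg { c_st : nat; c_left : list sym; c_cur : sym; c_right : list sym }.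

Definition pop (l : list sym) : sym * list sym :=
  match l with nil => (None, nil) | a :: l' => (a, l') end.

Definition step (M : TM) (c : cfg) : cfg :=
  if Nat.eqb (c_st c) (tm_halt M) then c else
  match tm_delta M (c_st c) (c_cur c) with
  | (q', s, MStay) => mkCfg q' (c_left c) s (c_right c)
  | (q', s, MLeft) => let (a, l') := pop (c_left c) in mkCfg q' l' a (s :: c_right c)
  | (q', s, MRight) => let (a, r') := pop (c_right c) in mkCfg q' (s :: c_left c) a r'
  end.

Fixpoint run (M : TM) (t : nat) (c : cfg) : cfg :=
  match t with 0 => c | S t' => run M t' (step M c) end.

Definition init (M : TM) (x : list bool) : cfg :=
  match map Some x with
  | nil => mkCfg (tm_start M) nil None nil
  | a :: r => mkCfg (tm_start M) nil a r
  end.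

Fixpoint read_out (l : list sym) : list bool :=
  match l with Some b :: l' => b :: read_out l' | _ => nil end.

Definition output (c : cfg) : list bool := read_out (c_cur c :: c_right c).

Definition halts_with (M : TM) (x : list bool) (t : nat) (y : list bool) : Prop :=
  c_st (run M t (init M x)) = tm_halt M /\ output (run M t (init M x)) = y.

Definition language := list bool -> Prop.

Definition poly_computable (f : list bool -> list bool) : Prop :=
  exists (M : TM) (c k : nat), forall x : list bool,
    exists t, t <= c * (length x + 1) ^ k /\ halts_with M x t (f x).

(* self-delimiting encoding of a bit string *)
Definition enc_bits (x : list bool) : list bool :=
  flat_map (fun b => [true; b]) x ++ [false].

Definition in_NP (L : language) : Prop :=
  exists (V : TM) (c k : nat), forall x : list bool,
    L x <-> exists w : list bool, length w <= c * (length x + 1) ^ k /\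
      exists t, t <= c * (length x + length w + 1) ^ k /\
                halts_with V (enc_bits x ++ w) t [true].

Definition poly_reducible (L1 L2 : language) : Prop :=
  exists f, poly_computable f /\ forall x, L1 x <-> L2 (f x).

Definition NP_hard (L : language) : Prop :=
  forall L' : language, in_NP L' -> poly_reducible L' L.

Fixpoint pos_bits (p : positive) : list bool :=
  match p with
  | xH => [true]
  | xO p' => false :: pos_bits p'
  | xI p' => true :: pos_bits p'
  end.

Definition enc_nat (n : nat) : list bool :=
  enc_bits (match N.of_nat n with N0 => nil | Npos p => pos_bits p end).

Definition enc_Z (z : Z) : list bool :=
  match z with
  | Z0 => enc_bits nil
  | Zpos p => enc_bits (true :: pos_bits p)
  | Zneg p => enc_bits (false :: pos_bits p)
  end.

Definition enc_Q (q : Q) : list bool := enc_Z (Qnum q) ++ enc_Z (Zpos (Qden q)).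

Definition enc_list {A : Type} (e : A -> list bool) (l : list A) : list bool :=
  flat_map (fun a => true :: e a) l ++ [false].

(* an instance: dimension n, samples x_i (as lists of length n), labels y_i,
   output coefficients alpha_1, alpha_2 in {+1,-1} (true = +1, false = -1) *)
Record instance := mkInst {
  inst_n : nat;
  inst_x : list (list Q);
  inst_y : list Q;
  inst_a1 : bool;
  inst_a2 : bool
}.

Definition enc_inst (I : instance) : list bool :=
  enc_nat (inst_n I) ++ enc_list (enc_list enc_Q) (inst_x I)
  ++ enc_list enc_Q (inst_y I) ++ [inst_a1 I; inst_a2 I].

Definition inst_wf (I : instance) : Prop :=
  Forall (fun x => length x = inst_n I) (inst_x I) /\
  length (inst_x I) = length (inst_y I).

Definition relu (z : R) : R := Rmax 0 z.

Definition sgn (b : bool) : R := if b then 1%R else (-1)%R.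

Definition dot (w : list R) (x : list Q) : R :=
  fold_right Rplus 0%R (map (fun p => (fst p * Q2R (snd p))%R) (combine w x)).

Definition net2 (a1 a2 : bool) (w1 w2 : list R) (b1 b2 : R) (x : list Q) : R :=
  (sgn a1 * relu (dot w1 x + b1) + sgn a2 * relu (dot w2 x + b2))%R.

Definition yes_instance (I : instance) : Prop :=
  exists (w1 w2 : list R) (b1 b2 : R),
    length w1 = inst_n I /\ length w2 = inst_n I /\
    Forall2 (fun x y => net2 (inst_a1 I) (inst_a2 I) w1 w2 b1 b2 x = Q2R y)
            (inst_x I) (inst_y I).

Definition TwoReLU_fit : language :=
  fun s => exists I, inst_wf I /\ s = enc_inst I /\ yes_instance I.

(* Main.v *)
(* Take both output coefficients to be +1. If the zero vector has label 0, every unit vector has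
   label 1 and the indicator vectors of the hyperedges of a hypergraph have label 0, then the two
   units can fit the samples iff the hypergraph is 2-colourable: colour a vertex by whether the
   first unit is active there; a monochromatic edge would activate a unit at its indicator vector,
   and conversely weights 1 and -(number of vertices) turn a colouring into a fit. A CNF formula is
   2-colourability of the edges {v, not v} and C + {false} for its clauses C.

   The formula is the computation tableau of the verifier, written as one sequence of cells in which
   the cell one row below is determined by three consecutive cells. It needs no uniqueness clauses:
   all clauses except those guessing the witness propagate truth forwards. As the time bound depends
   on the length of the witness, a monotone variable "the deadline has passed" is triggered at a
   position depending on the first blank of the guessed witness.

   The reduction is computed by a program over finitely many stacks, compiled to a Turing machine
   which keeps the output stack on the right half of the tape and interleaves the others on the
   left half. *)

Require Import Defs.
From Stdlib Require Import Reals QArith List.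
From Stdlib Require Import ZArith NArith Lia Lra FunctionalExtensionality.
Import ListNotations.
Local Open Scope nat_scope.

(** * Turing machines on a tape indexed by the integers *)

(** The verifier may also halt with [[true]] after its allowance, and the allowance differs between
    witness lengths; acceptance must therefore be tested at a row depending on the guessed length,
    which is what forces the deadline variable. An assignment may make several contents of one cell
    true. This does no harm: truth of the intended content is carried along by implications, and the
    acceptance checks are purely negative clauses, so extra true variables cannot help to satisfy
    them. Laying the rows end to end makes every window meet its successor at the same distance, so
    all transition samples have one shape: four fixed blocks separated by runs of zero blocks. Such
    vectors can be printed with unary counters alone. The price is windows that straddle two rows;
    the padding keeps every cell near a row boundary blank, and three blanks produce a blank. The
    only number depending on the input that has to be printed in binary is the dimension, hence the
    binary counter. *)

Definition tape := Z -> sym.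

Definition tupd (f : tape) (h : Z) (s : sym) : tape :=
  fun i => if Z.eqb i h then s else f i.

Definition dz (mv : move) : Z :=
  match mv with MLeft => (-1)%Z | MRight => 1%Z | MStay => 0%Z end.

Definition zcfg (St : Type) := (St * Z * tape)%type.

Definition zstep {St} (nxt : St -> sym -> St * sym * move) (C : zcfg St) : zcfg St :=
  let '(q, h, f) := C in
  let '(q', s, mv) := nxt q (f h) in (q', (h + dz mv)%Z, tupd f h s).

Fixpoint zrun {St} (nxt : St -> sym -> St * sym * move) (t : nat) (C : zcfg St) : zcfg St :=
  match t with 0 => C | S t' => zrun nxt t' (zstep nxt C) end.

Lemma zrun_add {St} (nxt : St -> sym -> St * sym * move) a b C :
  zrun nxt (a + b) C = zrun nxt b (zrun nxt a C).
Proof. revert C; induction a as [|a IH]; intros C; simpl; auto. Qed.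

Lemma zrun_S {St} (nxt : St -> sym -> St * sym * move) t C :
  zrun nxt (S t) C = zstep nxt (zrun nxt t C).
Proof. replace (S t) with (t + 1) by lia. now rewrite zrun_add. Qed.

Lemma tupd_same f h : tupd f h (f h) = f.
Proof.
  extensionality i; unfold tupd. destruct (Z.eqb_spec i h); congruence.
Qed.

(** The halting state becomes a fixed point of the transition function, so [zrun] is plain iteration
    without a halting test. *)
Definition nxt_of (M : TM) (q : nat) (s : sym) : nat * sym * move :=
  if Nat.eqb q (tm_halt M) then (q, s, MStay) else tm_delta M q s.

(** The default [None] of [nth] reads as blank whatever lies beyond the stored lists, so stored
    trailing blanks make no difference. *)
Definition rep (c : cfg) (C : zcfg nat) : Prop :=
  let '(q, h, f) := C in
  c_st c = q /\ c_cur c = f h /\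
  (forall j, nth j (c_left c) None = f (h - 1 - Z.of_nat j)%Z) /\
  (forall j, nth j (c_right c) None = f (h + 1 + Z.of_nat j)%Z).

Lemma nth_pop l j : nth j (snd (pop l)) None = nth (S j) l None.
Proof. destruct l; simpl; auto. destruct j; auto. Qed.

Lemma fst_pop l : fst (pop l) = nth 0 l None.
Proof. destruct l; auto. Qed.

Lemma tupd_eq f h s : tupd f h s h = s.
Proof. unfold tupd. now rewrite Z.eqb_refl. Qed.

Lemma tupd_neq f h s i : i <> h -> tupd f h s i = f i.
Proof. unfold tupd. intros H. destruct (Z.eqb_spec i h); congruence. Qed.

Lemma rep_step M c C : rep c C -> rep (step M c) (zstep (nxt_of M) C).
Proof.
  destruct C as [[q h] f]. intros (Hq & Hc & Hl & Hr).
  unfold zstep, nxt_of, step. rewrite Hq, Hc.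
  destruct (Nat.eqb q (tm_halt M)).
  - rewrite tupd_same. simpl. rewrite Z.add_0_r. repeat split; auto.
  - destruct (tm_delta M q (f h)) as [[q' s] mv].
    destruct mv; simpl.
    + destruct (pop (c_left c)) as [a l'] eqn:E.
      pose proof (fst_pop (c_left c)) as E1. rewrite E in E1. simpl in E1.
      repeat split; simpl.
      * rewrite tupd_neq by lia. rewrite E1, Hl. f_equal; lia.
      * intros j. pose proof (nth_pop (c_left c) j) as E2. rewrite E in E2. simpl in E2.
        rewrite E2, Hl, tupd_neq by lia. f_equal; lia.
      * intros [|j]; simpl.
        -- replace (h + -1 + 1 + 0)%Z with h by lia. now rewrite tupd_eq.
        -- rewrite Hr, tupd_neq by lia. f_equal; lia.
    + destruct (pop (c_right c)) as [a l'] eqn:E.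
      pose proof (fst_pop (c_right c)) as E1. rewrite E in E1. simpl in E1.
      repeat split; simpl.
      * rewrite tupd_neq by lia. rewrite E1, Hr. f_equal; lia.
      * intros [|j]; simpl.
        -- replace (h + 1 - 1 - 0)%Z with h by lia. now rewrite tupd_eq.
        -- rewrite Hl, tupd_neq by lia. f_equal; lia.
      * intros j. pose proof (nth_pop (c_right c) j) as E2. rewrite E in E2. simpl in E2.
        rewrite E2, Hr, tupd_neq by lia. f_equal; lia.
    + repeat split; simpl.
      * rewrite Z.add_0_r. now rewrite tupd_eq.
      * intros j. rewrite Hl, tupd_neq by lia. f_equal; lia.
      * intros j. rewrite Hr, tupd_neq by lia. f_equal; lia.
Qed.

Lemma rep_run M t c C : rep c C -> rep (run M t c) (zrun (nxt_of M) t C).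
Proof.
  revert c C; induction t as [|t IH]; intros c C H; simpl; auto.
  apply IH, rep_step, H.
Qed.

Definition list_tape (x : list bool) : tape :=
  fun i => if (i <? 0)%Z then None else nth (Z.to_nat i) (map Some x) None.

Lemma nth_nil_None j : nth j (@nil sym) None = None.
Proof. destruct j; auto. Qed.

Lemma rep_init M x : rep (init M x) (tm_start M, 0%Z, list_tape x).
Proof.
  unfold init, list_tape. destruct x as [|b x]; cbn [map].
  - repeat split; auto; intros [|j]; simpl;
      match goal with |- context [if ?b then _ else _] => destruct b | _ => idtac end; auto;
      match goal with |- context [nth ?i nil _] => destruct i end; auto.
  - repeat split; cbn [c_left c_right]; intros j.
    + rewrite nth_nil_None. destruct (Z.ltb_spec (0 - 1 - Z.of_nat j) 0); auto; lia.
    + destruct (Z.ltb_spec (0 + 1 + Z.of_nat j) 0); try lia.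
      replace (Z.to_nat (0 + 1 + Z.of_nat j)) with (S j) by lia. auto.
Qed.

(** Reading stops at the first blank, so the blank behind the last symbol of [y] is what fixes its
    length. *)
Lemma rep_output c q h f y : rep c (q, h, f) ->
  output c = y <->
  (forall j, j < length y -> f (h + Z.of_nat j)%Z = Some (nth j y false)) /\
  f (h + Z.of_nat (length y))%Z = None.
Proof.
  intros (_ & Hc & _ & Hr).
  assert (H : forall j, nth j (c_cur c :: c_right c) None = f (h + Z.of_nat j)%Z).
  { intros [|j]; simpl.
    - rewrite Hc. f_equal; lia.
    - rewrite Hr. f_equal; lia. }
  unfold output. clear Hc Hr. revert H. generalize (c_cur c :: c_right c). revert h.
  induction y as [|b y IH]; intros h l Hl.
  - simpl. rewrite Z.add_0_r. pose proof (Hl 0) as H0. simpl in H0. rewrite Z.add_0_r in H0.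
    rewrite <- H0. destruct l as [|[b|] l]; simpl; split; auto; try discriminate.
    + intros _; split; auto; intros; lia.
    + intros [_ ?]; discriminate.
    + intros _; split; auto; intros; lia.
  - destruct l as [|[b'|] l]; simpl.
    + split; try discriminate. intros [H _].
      specialize (H 0 ltac:(lia)). rewrite <- (Hl 0) in H. discriminate.
    + specialize (IH (h + 1)%Z l).
      assert (E : forall j, nth j l None = f (h + 1 + Z.of_nat j)%Z).
      { intros j. pose proof (Hl (S j)) as H. simpl in H. rewrite H. f_equal; lia. }
      specialize (IH E). pose proof (Hl 0) as H0. simpl in H0.
      split.
      * intros Ey. injection Ey as -> Ey. apply IH in Ey. destruct Ey as [E1 E2]. split.
        -- intros [|j] Hj; auto. rewrite <- (E1 j) by lia. f_equal; lia.
        -- rewrite <- E2. f_equal; lia.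
      * intros [E1 E2]. f_equal.
        -- specialize (E1 0 ltac:(lia)). simpl in E1. rewrite <- H0 in E1. now injection E1.
        -- apply IH. split.
           ++ intros j Hj. specialize (E1 (S j) ltac:(lia)). simpl in E1. rewrite <- E1. f_equal; lia.
           ++ rewrite <- E2. f_equal; lia.
    + split; try discriminate. intros [H _].
      specialize (H 0 ltac:(lia)). rewrite <- (Hl 0) in H. discriminate.
Qed.

Lemma zrun_nxt_of_halt M t q h f : q = tm_halt M ->
  zrun (nxt_of M) t (q, h, f) = (q, h, f).
Proof.
  intros ->. induction t as [|t IH]; auto. simpl zrun.
  unfold zstep, nxt_of at 2. rewrite Nat.eqb_refl, tupd_same. simpl dz. now rewrite Z.add_0_r.
Qed.

(** * Machines with an abstract finite state set *)

Section FiniteStates.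
Variable St : Type.
Variable St_dec : forall a b : St, {a = b} + {a <> b}.
Variable nxt : St -> sym -> St * sym * move.
Variable sts : list St.
Variables start halt : St.
Hypothesis start_in : In start sts.
Hypothesis halt_in : In halt sts.
Hypothesis closed : forall q s, In q sts -> In (fst (fst (nxt q s))) sts.
Hypothesis halt_fix : forall s, nxt halt s = (halt, s, MStay).

Fixpoint index (q : St) (l : list St) : nat :=
  match l with nil => 0 | a :: l' => if St_dec a q then 0 else S (index q l') end.

Lemma index_lt q l : In q l -> index q l < length l.
Proof.
  induction l as [|a l IH]; simpl; [tauto|]. intros H.
  destruct (St_dec a q); [lia|]. destruct H; [congruence|]. apply IH in H; lia.
Qed.

Lemma nth_index q l d : In q l -> nth (index q l) l d = q.
Proof.
  induction l as [|a l IH]; simpl; [tauto|]. intros H.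
  destruct (St_dec a q); auto. destruct H; [congruence|]. auto.
Qed.

Definition fin_delta (i : nat) (s : sym) : nat * sym * move :=
  let '(q', s', mv) := nxt (nth i sts start) s in (index q' sts, s', mv).

Lemma fin_delta_ok i s : i < length sts -> fst (fst (fin_delta i s)) < length sts.
Proof.
  intros Hi. unfold fin_delta.
  pose proof (closed (nth i sts start) s (nth_In _ _ Hi)) as H.
  destruct (nxt _ s) as [[q' s'] mv]. simpl in *. now apply index_lt.
Qed.

Definition fin_TM : TM :=
  {| tm_Q := length sts; tm_delta := fin_delta;
     tm_start := index start sts; tm_halt := index halt sts;
     tm_delta_ok := fin_delta_ok;
     tm_start_ok := index_lt _ _ start_in; tm_halt_ok := index_lt _ _ halt_in |}.

(** The simulation is exact, step for step: [index] is injective on [sts], so the machine rests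
    exactly when the abstract state is [halt], and there [halt_fix] makes the abstract step rest
    too. *)
Lemma fin_TM_run t q h f : In q sts ->
  let '(q', h', f') := zrun nxt t (q, h, f) in
  In q' sts /\ zrun (nxt_of fin_TM) t (index q sts, h, f) = (index q' sts, h', f').
Proof.
  revert q h f; induction t as [|t IH]; intros q h f Hq; [simpl; auto|].
  cbn [zrun].
  assert (E : zstep (nxt_of fin_TM) (index q sts, h, f) =
    let '(q', h', f') := zstep nxt (q, h, f) in (index q' sts, h', f')).
  { unfold zstep, nxt_of. simpl tm_halt. destruct (Nat.eqb_spec (index q sts) (index halt sts)) as [E|E].
    - assert (q = halt) as ->.
      { rewrite <- (nth_index q sts start Hq), E. now apply nth_index. }
      now rewrite halt_fix.
    - simpl. unfold fin_delta. rewrite nth_index by auto.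
      now destruct (nxt q (f h)) as [[q' s'] mv]. }
  rewrite E. pose proof (closed q (f h) Hq) as Hc. unfold zstep at 1 2.
  unfold zstep in E. destruct (nxt q (f h)) as [[q' s'] mv]. simpl in Hc.
  apply IH, Hc.
Qed.

Lemma fin_TM_halts x y t f' :
  zrun nxt t (start, 0%Z, list_tape x) = (halt, 0%Z, f') ->
  (forall j, j < length y -> f' (Z.of_nat j) = Some (nth j y false)) ->
  f' (Z.of_nat (length y)) = None ->
  halts_with fin_TM x t y.
Proof.
  intros H H1 H2. pose proof (fin_TM_run t start 0%Z (list_tape x) start_in) as HR.
  rewrite H in HR. destruct HR as [_ HR].
  pose proof (rep_run fin_TM t _ _ (rep_init fin_TM x)) as Hrep. simpl tm_start in Hrep.
  rewrite HR in Hrep. split.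
  - apply Hrep.
  - apply (rep_output _ _ _ _ y Hrep). split; simpl; auto.
Qed.

End FiniteStates.

(** * A structured language of stack programs *)

(** Numbers are kept in unary except in [RBin]. [RX]: input bits; [RS]: base of powers; [RA], [RB]:
    accumulators; [RM]: witness bound; [RR], [RK], [RD]: rows, padding, standard gap; [RCnt]:
    windows; [RN]: cells; [RP], [RG]: position and gap of the current sample; [RRem]: cells still to
    print; [RY], [RY2]: labels; the [RT] registers are scratch. *)
Inductive reg :=
  ROut | RX | RS | RA | RB | RM | RR | RK | RD | RCnt | RN | RBin | RP | RG
| RY | RY2 | RRem | RT1 | RT2 | RT3.

Definition regs : list reg :=
  [ROut; RX; RS; RA; RB; RM; RR; RK; RD; RCnt; RN; RBin; RP; RG; RY; RY2; RRem; RT1; RT2; RT3].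

Definition rn (r : reg) : nat :=
  match r with
  | ROut => 0 | RX => 1 | RS => 2 | RA => 3 | RB => 4 | RM => 5 | RR => 6 | RK => 7
  | RD => 8 | RCnt => 9 | RN => 10 | RBin => 11 | RP => 12 | RG => 13 | RY => 14
  | RY2 => 15 | RRem => 16 | RT1 => 17 | RT2 => 18 | RT3 => 19
  end.

Lemma rn_inj r r' : rn r = rn r' -> r = r'.
Proof. destruct r, r'; simpl; intros H; try reflexivity; discriminate. Qed.

Definition reg_dec (a b : reg) : {a = b} + {a <> b}.
Proof. decide equality. Defined.

Inductive stmt :=
| Skip
| Push (r : reg) (b : bool)
| Pop (r : reg)
| Seq (s1 s2 : stmt)
| If (r : reg) (s_empty s_false s_true : stmt)
| Loop (r : reg) (body : stmt).

Definition store := reg -> list bool.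

Definition upd (st : store) (r : reg) (v : list bool) : store :=
  fun r' => if Nat.eqb (rn r) (rn r') then v else st r'.

(* The body of a loop runs before the pop, so it can still read the top of [r]. *)
Inductive exec : stmt -> store -> store -> nat -> Prop :=
| exec_skip st : exec Skip st st 1
| exec_push r b st : exec (Push r b) st (upd st r (b :: st r)) 1
| exec_pop r st : exec (Pop r) st (upd st r (tl (st r))) 1
| exec_seq s1 s2 st0 st1 st2 t1 t2 :
    exec s1 st0 st1 t1 -> exec s2 st1 st2 t2 -> exec (Seq s1 s2) st0 st2 (1 + t1 + t2)
| exec_if r a b c st st' t :
    exec (match st r with nil => a | false :: _ => b | true :: _ => c end) st st' t ->
    exec (If r a b c) st st' (1 + t)
| exec_loop_nil r s st : st r = nil -> exec (Loop r s) st st 1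
| exec_loop_cons r s st st1 st2 t1 t2 :
    st r <> nil -> exec s st st1 t1 ->
    exec (Loop r s) (upd st1 r (tl (st1 r))) st2 t2 ->
    exec (Loop r s) st st2 (2 + t1 + t2).

Definition size (st : store) : nat := list_sum (map (fun r => length (st r)) regs).

Lemma length_le_size st r : length (st r) <= size st.
Proof. unfold size, upd. destruct r; simpl; lia. Qed.

Lemma size_upd_push st r b : size (upd st r (b :: st r)) = size st + 1.
Proof. unfold size, upd. destruct r; simpl; lia. Qed.

Lemma size_upd_pop st r : size (upd st r (tl (st r))) <= size st.
Proof.
  assert (H : length (tl (st r)) <= length (st r)) by (destruct (st r); simpl; lia).
  unfold size, upd. destruct r; simpl in *; lia.
Qed.

(** Each counted step pushes at most one symbol. This bounds the height of every stack, and with it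
    the length of every walk of the compiled machine. *)
Lemma exec_size s st st' t : exec s st st' t -> size st' <= size st + t.
Proof.
  induction 1; try lia.
  - rewrite size_upd_push; lia.
  - pose proof (size_upd_pop st r); lia.
  - pose proof (size_upd_pop st1 r); lia.
Qed.

(** * Compilation of stack programs to Turing machines *)

(* The top of [ROut] is the rightmost nonblank cell of the right half-tape; the j-th cell from the
   bottom of another register [r] is cell [-((j + 1) * 19 + rn r)]. Cells with [j = -1] stay
   blank, so a walk towards cell 0 can detect the bottom of the stack. *)
Definition pos (r : reg) (j : Z) : Z :=
  match r with ROut => j | _ => (- ((j + 1) * 19 + Z.of_nat (rn r)))%Z end.

Definition off (r : reg) : nat := match r with ROut => 1 | _ => rn r end.
Definition str (r : reg) : nat := match r with ROut => 1 | _ => 19 end.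
Definition outward (r : reg) : move := match r with ROut => MRight | _ => MLeft end.
Definition inward (r : reg) : move := match r with ROut => MLeft | _ => MRight end.

Lemma pos_bottom r : pos r (-1) = (- Z.of_nat (off r))%Z.
Proof. destruct r; reflexivity. Qed.

Lemma pos_out r j : (pos r j + Z.of_nat (str r) * dz (outward r))%Z = pos r (j + 1).
Proof. unfold pos, str, outward, dz. destruct r; simpl Z.of_nat; lia. Qed.

Lemma pos_in r j : (pos r j + Z.of_nat (str r) * dz (inward r))%Z = pos r (j - 1).
Proof. unfold pos, str, inward, dz. destruct r; simpl Z.of_nat; lia. Qed.

(** One index has to be nonnegative because the cells below the bottoms of [ROut] and [RX] coincide:
    both are cell -1. Apart from that, [rn r] lies between 1 and 19 and is determined modulo 19. *)
Lemma pos_inj r j r' j' : (0 <= j)%Z -> (-1 <= j')%Z -> pos r j = pos r' j' -> r = r' /\ j = j'.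
Proof.
  intros Hj Hj' H.
  assert (E : rn r = rn r' /\ j = j').
  { unfold pos in H.
    assert (B : forall r, r <> ROut -> 1 <= rn r <= 19)
      by (intros []; simpl; try congruence; lia).
    destruct (reg_dec r ROut) as [->|N]; destruct (reg_dec r' ROut) as [->|N'].
    - auto.
    - specialize (B _ N'). destruct r'; try congruence; cbn [rn] in *; lia.
    - specialize (B _ N). destruct r; try congruence; cbn [rn] in *; lia.
    - pose proof (B _ N). pose proof (B _ N').
      assert (H' : ((j + 1) * 19 + Z.of_nat (rn r) = (j' + 1) * 19 + Z.of_nat (rn r'))%Z)
        by (destruct r; destruct r'; try congruence; lia).
      lia. }
  destruct E. split; auto using rn_inj.
Qed.

(** The range includes [j = -1], which records that the sentinel below each stack is blank. *)
Definition repr (st : store) (f : tape) : Prop :=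
  forall r j, (-1 <= j)%Z -> f (pos r j) = list_tape (rev (st r)) j.

Lemma list_tape_in l j : j < length l -> list_tape l (Z.of_nat j) = Some (nth j l false).
Proof.
  intros H. unfold list_tape. destruct (Z.ltb_spec (Z.of_nat j) 0); try lia.
  rewrite Nat2Z.id. rewrite nth_indep with (d' := Some false) by (rewrite length_map; auto).
  now rewrite map_nth.
Qed.

Lemma list_tape_out l j : (j < 0 \/ Z.of_nat (length l) <= j)%Z -> list_tape l j = None.
Proof.
  intros H. unfold list_tape. destruct (Z.ltb_spec j 0); auto.
  apply nth_overflow. rewrite length_map. lia.
Qed.

Lemma repr_push st f r b : repr st f ->
  repr (upd st r (b :: st r)) (tupd f (pos r (Z.of_nat (length (st r)))) (Some b)).
Proof.
  intros H r' j Hj. unfold upd.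
  destruct (Z.eq_dec (pos r (Z.of_nat (length (st r)))) (pos r' j)) as [E|E].
  - rewrite <- E, tupd_eq. apply pos_inj in E; try lia. destruct E as [<- <-].
    rewrite Nat.eqb_refl. simpl rev. rewrite list_tape_in by (rewrite length_app, length_rev; simpl; lia).
    rewrite app_nth2; rewrite length_rev; auto. now rewrite Nat.sub_diag.
  - rewrite tupd_neq by auto. rewrite H by auto. destruct (Nat.eqb_spec (rn r) (rn r')) as [Er|]; auto.
    apply rn_inj in Er. subst r'. simpl rev.
    destruct (Z.ltb_spec j 0) as [?|Hj0]; [rewrite !list_tape_out by lia; auto|].
    destruct (Z.lt_ge_cases j (Z.of_nat (length (st r)))) as [L|L].
    + replace j with (Z.of_nat (Z.to_nat j)) by lia.
      rewrite !list_tape_in by (rewrite ?length_app, length_rev; simpl; lia).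
      rewrite app_nth1; auto. rewrite length_rev; lia.
    + assert (j <> Z.of_nat (length (st r))) by congruence.
      rewrite !list_tape_out; auto; right; rewrite ?length_app, length_rev; simpl; lia.
Qed.

Lemma repr_pop st f r b l : repr st f -> st r = b :: l ->
  repr (upd st r l) (tupd f (pos r (Z.of_nat (length l))) None).
Proof.
  intros H Hr r' j Hj. unfold upd.
  destruct (Z.eq_dec (pos r (Z.of_nat (length l))) (pos r' j)) as [E|E].
  - rewrite <- E, tupd_eq. apply pos_inj in E; try lia. destruct E as [<- <-].
    rewrite Nat.eqb_refl. symmetry; apply list_tape_out. rewrite length_rev; lia.
  - rewrite tupd_neq by auto. rewrite H by auto. destruct (Nat.eqb_spec (rn r) (rn r')) as [Er|]; auto.
    apply rn_inj in Er. subst r'. rewrite Hr. simpl rev.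
    destruct (Z.ltb_spec j 0) as [?|Hj0]; [rewrite !list_tape_out by lia; auto|].
    destruct (Z.lt_ge_cases j (Z.of_nat (length l))) as [L|L].
    + replace j with (Z.of_nat (Z.to_nat j)) by lia.
      rewrite !list_tape_in by (rewrite ?length_app, length_rev; simpl; lia).
      rewrite app_nth1; auto. rewrite length_rev; lia.
    + assert (j <> Z.of_nat (length l)) by congruence.
      rewrite !list_tape_out; auto; right; rewrite ?length_app, length_rev; simpl; lia.
Qed.

(* [PTo]: walking from cell 0 to the bottom of the stack; [POut]: towards its first free cell;
   [PAct]: back to the top symbol; [PIn]: to the bottom; [PHome]: to cell 0. The argument counts
   the single steps left. *)
Inductive phase :=
| PStart
| PTo (n : nat)
| POut (n : nat)
| PAct (n : nat)
| PIn (r : reg) (n : nat)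
| PHome (n : nat).

Definition cst := (list stmt * phase)%type.

Definition cst_dec (a b : cst) : {a = b} + {a <> b}.
Proof.
  repeat decide equality; apply Bool.bool_dec.
Defined.

Definition reg_of (i : stmt) : reg :=
  match i with Push r _ | Pop r | If r _ _ _ | Loop r _ => r | _ => ROut end.

(** A nonempty loop unfolds into its body, an ordinary [Pop] and itself. Tests write the scanned
    symbol back, whereas the blank returned for [Pop] erases the top. *)
Definition act (i : stmt) (K : list stmt) (s : sym) : sym * list stmt :=
  match i with
  | If _ a b c => (s, match s with None => a | Some false => b | Some true => c end :: K)
  | Loop r body => (s, match s with None => K | Some _ => body :: Pop r :: i :: K end)
  | Seq _ _ => (None, i :: K)
  | _ => (None, K)
  end.

Definition cnxt (q : cst) (s : sym) : cst * sym * move :=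
  let (K, ph) := q in
  match ph with
  | PIn r 0 => ((K, match s with None => PHome (off r) | Some _ => PIn r (str r) end), s, MStay)
  | PIn r (S n) => ((K, PIn r n), s, inward r)
  | PHome 0 => ((K, PStart), s, MStay)
  | PHome (S n) => ((K, PHome n), s, MRight)
  | _ =>
    match K with
    | nil => (q, s, MStay)
    | i :: K' =>
      let r := reg_of i in
      match ph with
      | PTo 0 => ((K, POut (str r)), s, MStay)
      | PTo (S n) => ((K, PTo n), s, MLeft)
      | POut 0 =>
          match s, i with
          | Some _, _ => ((K, POut (str r)), s, MStay)
          | None, Push r b => ((K', PIn r (str r)), Some b, MStay)
          | None, _ => ((K, PAct (str r)), s, MStay)
          end
      | POut (S n) => ((K, POut n), s, outward r)
      | PAct 0 =>
          let (s', K'') := act i K' s in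
          ((K'', match s with None => PHome (off r) | Some _ => PIn r (str r) end), s', MStay)
      | PAct (S n) => ((K, PAct n), s, inward r)
      | _ =>
          match i with
          | Skip => ((K', PStart), s, MStay)
          | Seq a b => ((a :: b :: K', PStart), s, MStay)
          | _ => ((K, PTo (off r)), s, MStay)
          end
      end
    end
  end.

Definition reach (C C' : zcfg cst) (t : nat) : Prop :=
  exists t', t' <= t /\ zrun cnxt t' C = C'.

Lemma reach_trans C1 C2 C3 a b : reach C1 C2 a -> reach C2 C3 b -> reach C1 C3 (a + b).
Proof.
  intros (t1 & H1 & E1) (t2 & H2 & E2). exists (t1 + t2). split; [lia|].
  now rewrite zrun_add, E1, E2.
Qed.

Lemma reach_le C C' a b : a <= b -> reach C C' a -> reach C C' b.
Proof. intros H (t & Ht & E). exists t. split; auto; lia. Qed.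

Lemma reach_refl C : reach C C 0.
Proof. exists 0; auto. Qed.

Lemma reach_step q h f q' s' mv : cnxt q (f h) = (q', s', mv) ->
  reach (q, h, f) (q', (h + dz mv)%Z, tupd f h s') 1.
Proof. intros E. exists 1. split; auto. simpl. now rewrite E. Qed.

Lemma reach_stay q h f q' : cnxt q (f h) = (q', f h, MStay) -> reach (q, h, f) (q', h, f) 1.
Proof.
  intros E. apply reach_step in E. now rewrite tupd_same, Z.add_0_r in E.
Qed.

Lemma reach_walk (ph : nat -> cst) mv : (forall n s, cnxt (ph (S n)) s = (ph n, s, mv)) ->
  forall n h f, reach (ph n, h, f) (ph 0, (h + Z.of_nat n * dz mv)%Z, f) n.
Proof.
  intros Hph. induction n as [|n IH]; intros h f.
  - simpl. rewrite Z.add_0_r. apply reach_refl.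
  - apply (reach_trans _ (ph n, (h + dz mv)%Z, f) _ 1 n).
    + pose proof (reach_step (ph (S n)) h f _ _ _ (Hph n (f h))) as H.
      now rewrite tupd_same in H.
    + replace (h + Z.of_nat (S n) * dz mv)%Z with (h + dz mv + Z.of_nat n * dz mv)%Z by lia. apply IH.
Qed.

Definition is_op (i : stmt) : Prop :=
  match i with Skip | Seq _ _ => False | _ => True end.

Lemma reach_to i K f : is_op i ->
  reach (i :: K, PStart, 0%Z, f) (i :: K, POut (str (reg_of i)), pos (reg_of i) (-1), f) 30.
Proof.
  intros Hi. set (r := reg_of i).
  apply reach_le with (1 + (off r + 1)); [destruct r; simpl; lia|].
  eapply reach_trans; [apply reach_stay with (q' := (i :: K, PTo (off r)))|].
  { destruct i; simpl in *; tauto || reflexivity. }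
  eapply reach_trans.
  { apply (reach_walk (fun n => (i :: K, PTo n)) MLeft). intros n s. now destruct i. }
  rewrite pos_bottom. simpl dz. replace (0 + _)%Z with (- Z.of_nat (off r))%Z by lia.
  apply reach_stay. now destruct i.
Qed.

(** Induction on the number [n] of symbols still ahead of the head; when [n] is the whole height,
    the walk starts at the sentinel. *)
Lemma reach_out i K st f : repr st f -> forall n, n <= length (st (reg_of i)) ->
  reach (i :: K, POut (str (reg_of i)), pos (reg_of i) (Z.of_nat (length (st (reg_of i)) - n) - 1), f)
        (i :: K, POut 0, pos (reg_of i) (Z.of_nat (length (st (reg_of i)))), f) (20 * (n + 1)).
Proof.
  intros Hf. set (r := reg_of i).
  assert (Hs : str r <= 19) by (destruct r; simpl; lia).
  assert (W : forall h, reach (i :: K, POut (str r), h, f)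
     (i :: K, POut 0, (h + Z.of_nat (str r) * dz (outward r))%Z, f) (str r)).
  { intros h. apply (reach_walk (fun n => (i :: K, POut n)) (outward r)).
    intros n s. now destruct i. }
  induction n as [|n IH]; intros Hn.
  - apply reach_le with (str r); [lia|]. rewrite Nat.sub_0_r.
    replace (pos r (Z.of_nat (length (st r)))) with
      (pos r (Z.of_nat (length (st r)) - 1) + Z.of_nat (str r) * dz (outward r))%Z; [apply W|].
    rewrite pos_out. f_equal; lia.
  - apply reach_le with (str r + (1 + 20 * (n + 1))); [lia|].
    eapply reach_trans; [apply W|]. rewrite pos_out.
    eapply reach_trans; [|apply IH; lia].
    replace (Z.of_nat (length (st r) - S n) - 1 + 1)%Z with (Z.of_nat (length (st r) - n) - 1)%Z by lia.
    apply reach_stay. rewrite Hf by lia.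
    replace (Z.of_nat (length (st r) - n) - 1)%Z with (Z.of_nat (length (st r) - S n)) by lia.
    rewrite list_tape_in by (rewrite length_rev; lia). now destruct i.
Qed.

Lemma reach_in r K st f : repr st f -> forall n, n <= length (st r) ->
  reach (K, PIn r (str r), pos r (Z.of_nat n), f) (K, PStart, 0%Z, f) (20 * (n + 1) + 30).
Proof.
  intros Hf.
  assert (Hs : str r <= 19) by (destruct r; simpl; lia).
  assert (Ho : off r <= 19) by (destruct r; simpl; lia).
  assert (W : forall h, reach (K, PIn r (str r), h, f)
     (K, PIn r 0, (h + Z.of_nat (str r) * dz (inward r))%Z, f) (str r)).
  { intros h. apply (reach_walk (fun n => (K, PIn r n)) (inward r)). reflexivity. }
  induction n as [|n IH]; intros Hn.
  - apply reach_le with (str r + (1 + (off r + 1))); [lia|].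
    eapply reach_trans; [apply W|]. rewrite pos_in. simpl (_ - 1)%Z.
    eapply reach_trans.
    { apply reach_stay with (q' := (K, PHome (off r))). rewrite Hf by lia.
      now rewrite list_tape_out by lia. }
    eapply reach_trans.
    { apply (reach_walk (fun n => (K, PHome n)) MRight). reflexivity. }
    rewrite pos_bottom. simpl dz. replace (_ + _)%Z with 0%Z by lia.
    now apply reach_stay.
  - apply reach_le with (str r + (1 + (20 * (n + 1) + 30))); [lia|].
    eapply reach_trans; [apply W|]. rewrite pos_in.
    eapply reach_trans; [|apply IH; lia].
    replace (Z.of_nat (S n) - 1)%Z with (Z.of_nat n) by lia.
    apply reach_stay. rewrite Hf by lia.
    now rewrite list_tape_in by (rewrite length_rev; lia).
Qed.

Lemma reach_first_free i K st f : repr st f -> is_op i ->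
  reach (i :: K, PStart, 0%Z, f)
        (i :: K, POut 0, pos (reg_of i) (Z.of_nat (length (st (reg_of i)))), f)
        (20 * (length (st (reg_of i)) + 1) + 30).
Proof.
  intros Hf Hi. eapply reach_le; [|eapply reach_trans; [apply reach_to; auto|]].
  2: { pose proof (reach_out i K st f Hf _ (le_n _)) as H.
       rewrite Nat.sub_diag in H. exact H. }
  lia.
Qed.

Lemma reach_push r b K st f : repr st f -> exists f',
  repr (upd st r (b :: st r)) f' /\
  reach (Push r b :: K, PStart, 0%Z, f) (K, PStart, 0%Z, f') (200 * (length (st r) + 1)).
Proof.
  intros Hf. exists (tupd f (pos r (Z.of_nat (length (st r)))) (Some b)).
  pose proof (repr_push st f r b Hf) as Hf'. split; auto.
  eapply reach_le; [|eapply reach_trans; [apply (reach_first_free (Push r b) K st f Hf I)|]].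
  2: { eapply reach_trans.
       - apply reach_step with (q' := (K, PIn r (str r))). simpl reg_of.
         rewrite Hf, list_tape_out by (rewrite ?length_rev; lia). reflexivity.
       - simpl dz. rewrite Z.add_0_r. simpl reg_of. apply (reach_in _ _ _ _ Hf').
         unfold upd. rewrite Nat.eqb_refl. simpl. lia. }
  simpl reg_of. lia.
Qed.

Lemma reach_top i K st f : repr st f -> is_op i -> (forall r b, i <> Push r b) ->
  reach (i :: K, PStart, 0%Z, f)
        (i :: K, PAct 0, pos (reg_of i) (Z.of_nat (length (st (reg_of i))) - 1), f)
        (20 * (length (st (reg_of i)) + 1) + 50).
Proof.
  intros Hf Hi Hp.
  assert (Hs : str (reg_of i) <= 19) by (destruct (reg_of i); simpl; lia).
  eapply reach_le; [|eapply reach_trans; [apply (reach_first_free i K st f Hf Hi)|]].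
  2: { eapply reach_trans.
       - apply reach_stay with (q' := (i :: K, PAct (str (reg_of i)))).
         rewrite Hf, list_tape_out by (rewrite ?length_rev; lia).
         destruct i; try reflexivity; exfalso; eapply Hp; eauto.
       - rewrite <- pos_in. apply (reach_walk (fun n => (i :: K, PAct n)) (inward (reg_of i))).
         intros n s. now destruct i. }
  lia.
Qed.

(** For an empty stack the cell in question is the sentinel, so emptiness shows up as a blank. *)
Lemma top_symbol st f r : repr st f ->
  f (pos r (Z.of_nat (length (st r)) - 1)) = match st r with nil => None | b :: _ => Some b end.
Proof.
  intros Hf. rewrite Hf by lia. destruct (st r) as [|b l].
  - now rewrite list_tape_out by (simpl; lia).
  - simpl length. replace (Z.of_nat (S (length l)) - 1)%Z with (Z.of_nat (length l)) by lia.
    rewrite list_tape_in by (simpl; rewrite length_app, length_rev; simpl; lia).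
    simpl. rewrite app_nth2; rewrite length_rev; auto. now rewrite Nat.sub_diag.
Qed.

Lemma reach_home r K f : reach (K, PHome (off r), pos r (-1), f) (K, PStart, 0%Z, f) 30.
Proof.
  apply reach_le with (off r + 1); [destruct r; simpl; lia|].
  eapply reach_trans.
  { apply (reach_walk (fun n => (K, PHome n)) MRight). reflexivity. }
  rewrite pos_bottom. simpl dz. replace (_ + _)%Z with 0%Z by lia.
  now apply reach_stay.
Qed.

Lemma reach_pop r K st f : repr st f -> exists f',
  repr (upd st r (tl (st r))) f' /\
  reach (Pop r :: K, PStart, 0%Z, f) (K, PStart, 0%Z, f') (200 * (length (st r) + 1)).
Proof.
  intros Hf. pose proof (top_symbol st f r Hf) as Ht.
  pose proof (reach_top (Pop r) K st f Hf I ltac:(discriminate)) as H1. simpl reg_of in H1.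
  destruct (st r) as [|b l] eqn:E.
  - exists f. split.
    + intros r' j Hj. unfold upd. rewrite Hf by auto.
      destruct (Nat.eqb_spec (rn r) (rn r')) as [Er|]; auto. apply rn_inj in Er. subst. now rewrite E.
    + simpl length in *. eapply reach_le; [|eapply reach_trans; [apply H1|]].
      2: { eapply reach_trans.
           - apply reach_stay with (q' := (K, PHome (off r))). rewrite Ht. reflexivity.
           - apply reach_home. }
      lia.
  - exists (tupd f (pos r (Z.of_nat (length l))) None).
    pose proof (repr_pop st f r b l Hf E) as Hf'. split; auto. simpl length in *.
    replace (Z.of_nat (S (length l)) - 1)%Z with (Z.of_nat (length l)) in * by lia.
    eapply reach_le; [|eapply reach_trans; [apply H1|]].
    2: { eapply reach_trans.
         - apply reach_step with (q' := (K, PIn r (str r))). rewrite Ht. reflexivity.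
         - simpl dz. rewrite Z.add_0_r. apply (reach_in _ _ _ _ Hf').
           unfold upd. rewrite Nat.eqb_refl. lia. }
    lia.
Qed.

Lemma reach_peek i K st f : repr st f -> is_op i ->
  (forall r b, i <> Push r b) -> (forall r, i <> Pop r) ->
  reach (i :: K, PStart, 0%Z, f)
        (snd (act i K (match st (reg_of i) with nil => None | b :: _ => Some b end)), PStart, 0%Z, f)
        (200 * (length (st (reg_of i)) + 1)).
Proof.
  intros Hf Hi Hp Hp'. set (r := reg_of i).
  pose proof (top_symbol st f r Hf) as Ht.
  pose proof (reach_top i K st f Hf Hi Hp) as H1. fold r in H1.
  assert (Ha : forall s, fst (act i K s) = s).
  { intros s. destruct i; try reflexivity; simpl in Hi; try tauto; exfalso; eauto. eapply Hp; eauto. eapply Hp'; eauto. }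
  destruct (st r) as [|b l] eqn:E.
  - simpl length in *. eapply reach_le; [|eapply reach_trans; [apply H1|]].
    2: { eapply reach_trans.
         - apply reach_stay with (q' := (snd (act i K None), PHome (off r))). rewrite Ht.
           specialize (Ha None). destruct i; cbn [cnxt]; try (simpl in Hi; tauto);
           destruct (act _ K None) as [s' K'] eqn:Ea; simpl in *; subst; reflexivity.
         - apply reach_home. }
    lia.
  - simpl length in *.
    replace (Z.of_nat (S (length l)) - 1)%Z with (Z.of_nat (length l)) in * by lia.
    eapply reach_le; [|eapply reach_trans; [apply H1|]].
    2: { eapply reach_trans.
         - apply reach_stay with (q' := (snd (act i K (Some b)), PIn r (str r))). rewrite Ht.
           specialize (Ha (Some b)). destruct i; cbn [cnxt]; try (simpl in Hi; tauto);
           destruct (act _ K (Some b)) as [s' K'] eqn:Ea; simpl in *; subst; reflexivity.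
         - apply (reach_in _ _ _ _ Hf). rewrite E. simpl; lia. }
    lia.
Qed.

(** Every instruction costs a walk from cell 0 to the top of one stack and back. Size plus remaining
    time never increases, by [exec_size], so the single number [n] bounds all stacks throughout and
    a uniform price per counted step suffices. *)
Lemma exec_reach s st st' t : exec s st st' t -> forall n K f, repr st f -> size st + t <= n ->
  exists f', repr st' f' /\
    reach (s :: K, PStart, 0%Z, f) (K, PStart, 0%Z, f') (t * (200 * (n + 1))).
Proof.
  induction 1; intros n K f Hf Hn.
  - exists f. split; auto. eapply reach_le; [|apply reach_stay; reflexivity]. lia.
  - destruct (reach_push r b K st f Hf) as (f' & H1 & H2). exists f'. split; auto.
    eapply reach_le; [|apply H2]. pose proof (length_le_size st r). lia.
  - destruct (reach_pop r K st f Hf) as (f' & H1 & H2). exists f'. split; auto.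
    eapply reach_le; [|apply H2]. pose proof (length_le_size st r). lia.
  - pose proof (exec_size _ _ _ _ H) as Hsz.
    destruct (IHexec1 n (s2 :: K) f Hf ltac:(lia)) as (f1 & Hf1 & R1).
    destruct (IHexec2 n K f1 Hf1 ltac:(lia)) as (f2 & Hf2 & R2).
    exists f2. split; auto.
    eapply reach_le; [|eapply reach_trans; [apply reach_stay; reflexivity|
                        eapply reach_trans; [apply R1|apply R2]]]. lia.
  - destruct (IHexec n K f Hf ltac:(lia)) as (f1 & Hf1 & R1). exists f1. split; auto.
    pose proof (reach_peek (If r a b c) K st f Hf I ltac:(discriminate) ltac:(discriminate)) as R0.
    simpl reg_of in R0. pose proof (length_le_size st r).
    eapply reach_le; [|eapply reach_trans; [apply R0|]].
    2: { replace (snd _) with (match st r with nil => a | false :: _ => b | true :: _ => c end :: K);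
         [apply R1|]. destruct (st r) as [|[] l]; reflexivity. }
    lia.
  - exists f. split; auto.
    pose proof (reach_peek (Loop r s) K st f Hf I ltac:(discriminate) ltac:(discriminate)) as R0.
    simpl reg_of in R0. pose proof (length_le_size st r). rewrite H in *. simpl in R0.
    eapply reach_le; [|apply R0]. lia.
  - pose proof (exec_size _ _ _ _ H0) as Hsz.
    pose proof (size_upd_pop st1 r) as Hsz'.
    destruct (IHexec1 n (Pop r :: Loop r s :: K) f Hf ltac:(lia)) as (f1 & Hf1 & R1).
    destruct (reach_pop r (Loop r s :: K) st1 f1 Hf1) as (f2 & Hf2 & R2).
    destruct (IHexec2 n K f2 Hf2 ltac:(lia)) as (f3 & Hf3 & R3).
    exists f3. split; auto.
    pose proof (reach_peek (Loop r s) K st f Hf I ltac:(discriminate) ltac:(discriminate)) as R0.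
    simpl reg_of in R0. pose proof (length_le_size st r). pose proof (length_le_size st1 r).
    eapply reach_le; [|eapply reach_trans; [apply R0|]].
    2: { replace (snd _) with (s :: Pop r :: Loop r s :: K).
         - eapply reach_trans; [apply R1|]. eapply reach_trans; [apply R2|apply R3].
         - destruct (st r); [congruence|reflexivity]. }
    lia.
Qed.

(** * Finiteness of the control of the compiled machine *)

(* All continuations met while running [s :: K], up to [K] itself. *)
Fixpoint conts (s : stmt) (K : list stmt) : list (list stmt) :=
  (s :: K) ::
  match s with
  | Seq a b => conts a (b :: K) ++ conts b K
  | If _ a b c => conts a K ++ conts b K ++ conts c K
  | Loop r a => conts a (Pop r :: s :: K) ++ [Pop r :: s :: K]
  | _ => []
  end.

Lemma conts_head s K : In (s :: K) (conts s K).
Proof. destruct s; simpl; auto. Qed.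

Definition succ_conts (K : list stmt) : list (list stmt) :=
  match K with
  | nil => []
  | i :: K' =>
      match i with
      | Seq a b => [a :: b :: K']
      | If _ a b c => [a :: K'; b :: K'; c :: K']
      | Loop r a => [a :: Pop r :: i :: K'; K']
      | _ => [K']
      end
  end.

(** Without recursive calls the set stays finite: the tail [Pop r :: s :: K] behind a loop body
    leads back to [s :: K], which is already listed. A part that finishes hands over to the head of
    the next part or to [K]. *)
Lemma conts_closed s K K1 K2 : In K1 (conts s K) -> In K2 (succ_conts K1) ->
  In K2 (conts s K) \/ K2 = K.
Proof.
  revert K K1 K2; induction s; intros K K1 K2 H1 H2; cbn [conts] in *; simpl in H1;
    destruct H1 as [<-|H1]; try tauto.
  - simpl in H2. intuition.
  - simpl in H2. intuition.
  - simpl in H2. intuition.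
  - simpl in H2. destruct H2 as [<-|[]]. left. right. apply in_or_app. left. apply conts_head.
  - apply in_app_iff in H1. destruct H1 as [H1|H1].
    + destruct (IHs1 _ _ _ H1 H2) as [H| ->].
      * left; right; apply in_or_app; auto.
      * left; right; apply in_or_app; right; apply conts_head.
    + destruct (IHs2 _ _ _ H1 H2) as [H| ->]; auto. left; right; apply in_or_app; auto.
  - simpl in H2. left; right. rewrite !in_app_iff.
    destruct H2 as [<-|[<-|[<-|[]]]]; auto using conts_head.
  - rewrite !in_app_iff in H1. destruct H1 as [H1|[H1|H1]].
    + destruct (IHs1 _ _ _ H1 H2) as [H| ->]; auto. left; right; rewrite !in_app_iff; auto.
    + destruct (IHs2 _ _ _ H1 H2) as [H| ->]; auto. left; right; rewrite !in_app_iff; auto.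
    + destruct (IHs3 _ _ _ H1 H2) as [H| ->]; auto. left; right; rewrite !in_app_iff; auto.
  - simpl in H2. destruct H2 as [<-|[<-|[]]]; auto.
    left; right. apply in_or_app. left. apply conts_head.
  - apply in_app_iff in H1. destruct H1 as [H1|[<-|[]]].
    + destruct (IHs _ _ _ H1 H2) as [H| ->]; left; right; apply in_or_app; auto.
      right; simpl; auto.
    + simpl in H2. destruct H2 as [<-|[]]. left; left; auto.
Qed.

(** The bound 20 exceeds every stride and every offset, which are at most 19. *)
Definition phases : list phase :=
  PStart :: map PTo (seq 0 20) ++ map POut (seq 0 20) ++ map PAct (seq 0 20) ++
  map PHome (seq 0 20) ++ flat_map (fun r => map (PIn r) (seq 0 20)) regs.

Definition phase_ok (p : phase) : Prop :=
  match p with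
  | PStart => True
  | PTo n | POut n | PAct n | PIn _ n | PHome n => n < 20
  end.

Lemma in_phases p : In p phases <-> phase_ok p.
Proof.
  unfold phases. split.
  - intros [<-|H]; [exact I|]. rewrite !in_app_iff, !in_map_iff, in_flat_map in H.
    destruct H as [H|[H|[H|[H|H]]]];
      try (destruct H as (n & <- & H); apply in_seq in H; simpl; lia).
    destruct H as (r & _ & H). apply in_map_iff in H. destruct H as (n & <- & H).
    apply in_seq in H; simpl; lia.
  - destruct p; simpl phase_ok; intros H; [left; auto|..]; right;
      rewrite !in_app_iff, !in_map_iff, in_flat_map.
    + left. exists n. rewrite in_seq; split; auto; lia.
    + right; left. exists n. rewrite in_seq; split; auto; lia.
    + do 2 right; left. exists n. rewrite in_seq; split; auto; lia.
    + do 4 right. exists r. split; [destruct r; simpl; tauto|]. apply in_map_iff.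
      exists n. rewrite in_seq; split; auto; lia.
    + do 3 right; left. exists n. rewrite in_seq; split; auto; lia.
Qed.

Definition cstates (s : stmt) : list cst := list_prod (nil :: conts s nil) phases.

Lemma in_cstates s K p : In (K, p) (cstates s) <-> (K = nil \/ In K (conts s nil)) /\ phase_ok p.
Proof. unfold cstates. rewrite in_prod_iff, in_phases. simpl. intuition. Qed.

Lemma cstates_closed s q x : In q (cstates s) -> In (fst (fst (cnxt q x))) (cstates s).
Proof.
  destruct q as [K p]. intros H.
  assert (HK : K = nil \/ In K (conts s nil)) by (now apply in_cstates in H).
  assert (Hp : phase_ok p) by (now apply in_cstates in H).
  assert (Hs : forall r, str r < 20) by (intros []; simpl; lia).
  assert (Ho : forall r, off r < 20) by (intros []; simpl; lia).
  assert (Hc : forall K', In K' (succ_conts K) -> K' = nil \/ In K' (conts s nil)).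
  { intros K' HK'. destruct HK as [->|HK]; [destruct HK'|].
    destruct (conts_closed _ _ _ _ HK HK'); auto. }
  destruct K as [|i K]; destruct p as [|n|n|n|r n|n]; try destruct n as [|n]; cbn [cnxt]; auto;
    simpl phase_ok in Hp;
    try (apply in_cstates; simpl; split; [solve [auto]|]; simpl; solve [auto | lia | destruct x; simpl; auto]);
    destruct i; cbn [fst cnxt act];
    try (apply in_cstates; simpl; split; [solve [auto | apply Hc; simpl; auto]|]; simpl; solve [auto | lia | destruct x; simpl; auto]);
    destruct x as [[]|]; cbn [fst];
    try (apply in_cstates; simpl; split; [solve [auto | apply Hc; simpl; auto]|]; simpl; solve [auto | lia]);
    auto.
Qed.

Lemma cnxt_halt x : cnxt (nil, PStart) x = ((nil, PStart), x, MStay).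
Proof. reflexivity. Qed.

Lemma in_cstates_start s : In ([s], PStart) (cstates s).
Proof. apply in_cstates. split; simpl; auto using conts_head. Qed.

Lemma in_cstates_halt s : In (nil, PStart) (cstates s).
Proof. apply in_cstates. split; simpl; auto. Qed.

Definition compile (s : stmt) : TM :=
  fin_TM cst cst_dec cnxt (cstates s) ([s], PStart) (nil, PStart)
    (in_cstates_start s) (in_cstates_halt s) (cstates_closed s).

(** The input tape already represents [ROut] with the last input bit on top, so nothing has to be
    loaded. *)
Definition init_store (x : list bool) : store :=
  fun r => match r with ROut => rev x | _ => nil end.

Lemma repr_init x : repr (init_store x) (list_tape x).
Proof.
  intros r j Hj. destruct r; simpl init_store; try (rewrite rev_involutive; reflexivity);
    rewrite !list_tape_out; auto; simpl length; try lia; unfold pos; simpl; lia.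
Qed.

Lemma size_init x : size (init_store x) = length x.
Proof. unfold size; simpl. rewrite length_rev. lia. Qed.

Lemma compile_halts s x st t : exec s (init_store x) st t ->
  exists t', t' <= t * (200 * (length x + t + 1)) /\
    halts_with (compile s) x t' (rev (st ROut)).
Proof.
  intros H. destruct (exec_reach _ _ _ _ H (length x + t) nil _ (repr_init x)) as (f' & Hf' & t' & Ht' & R).
  { rewrite size_init. lia. }
  exists t'. split; auto. eapply (fin_TM_halts _ _ _ _ _ _ _ _ _ cnxt_halt); [exact R|..].
  - intros j Hj. rewrite <- list_tape_in by auto. apply (Hf' ROut). lia.
  - etransitivity; [apply (Hf' ROut (Z.of_nat (length (rev (st ROut))))); lia|].
    apply list_tape_out. lia.
Qed.

(** * Fitting two ReLUs is 2-colouring a hypergraph *)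

Definition b2q (b : bool) : Q := if b then 1%Q else 0%Q.

Lemma Q2R_b2q b : Q2R (b2q b) = if b then 1%R else 0%R.
Proof. destruct b; unfold Q2R; simpl; lra. Qed.

Section Colouring.
Local Open Scope R_scope.
Variable V : Type.
Variable V_dec : forall a b : V, {a = b} + {a <> b}.
Variable vs : list V.
Hypothesis vs_nodup : NoDup vs.

Definition wsum (w : V -> R) (E : V -> bool) (l : list V) : R :=
  fold_right Rplus 0 (map (fun v => if E v then w v else 0) l).

Lemma dot_wsum w E l :
  dot (map w l) (map (fun v => b2q (E v)) l) = wsum w E l.
Proof.
  unfold dot, wsum. induction l as [|v l IH]; simpl; auto.
  rewrite IH, Q2R_b2q. destruct (E v); lra.
Qed.

Lemma weights_of_list (l : list V) (w : list R) : NoDup l -> length w = length l ->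
  exists wf, w = map wf l.
Proof.
  intros Hl. revert w; induction Hl as [|v l Hv Hl IH]; intros [|r w] Hw; simpl in *; try discriminate.
  - now exists (fun _ => 0).
  - destruct (IH w) as [wf ->]; [congruence|].
    exists (fun u => if V_dec u v then r else wf u).
    destruct (V_dec v v) as [_|N]; [|congruence]. f_equal.
    apply map_ext_in. intros u Hu. destruct (V_dec u v); congruence.
Qed.

Definition hinst (ss : list ((V -> bool) * bool)) : instance :=
  mkInst (length vs) (map (fun s => map (fun v => b2q (fst s v)) vs) ss)
    (map (fun s => b2q (snd s)) ss) true true.

Lemma hinst_wf ss : inst_wf (hinst ss).
Proof.
  split; simpl.
  - apply Forall_forall. intros x Hx. apply in_map_iff in Hx. destruct Hx as (s & <- & _).
    apply length_map.
  - now rewrite !length_map.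
Qed.

Lemma Forall2_map_same {A B C} (P : B -> C -> Prop) (f : A -> B) (g : A -> C) l :
  Forall2 P (map f l) (map g l) <-> forall a, In a l -> P (f a) (g a).
Proof.
  induction l as [|a l IH]; simpl.
  - split; auto; tauto.
  - split.
    + intros H; inversion H; subst. intros b [<-|Hb]; auto. now apply IH.
    + intros H. constructor; auto. apply IH; auto.
Qed.

Lemma hinst_yes ss : yes_instance (hinst ss) <->
  exists (w1 w2 : V -> R) (b1 b2 : R), forall s, In s ss ->
    relu (wsum w1 (fst s) vs + b1) + relu (wsum w2 (fst s) vs + b2) = if snd s then 1 else 0.
Proof.
  unfold yes_instance; simpl. split.
  - intros (w1 & w2 & b1 & b2 & L1 & L2 & H).
    destruct (weights_of_list vs w1 vs_nodup L1) as [f1 ->].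
    destruct (weights_of_list vs w2 vs_nodup L2) as [f2 ->].
    exists f1, f2, b1, b2. rewrite Forall2_map_same in H. intros s Hs. specialize (H s Hs).
    unfold net2 in H. rewrite !dot_wsum, Q2R_b2q in H. simpl in H. lra.
  - intros (f1 & f2 & b1 & b2 & H).
    exists (map f1 vs), (map f2 vs), b1, b2. rewrite !length_map. repeat split; auto.
    apply Forall2_map_same. intros s Hs. unfold net2. rewrite !dot_wsum, Q2R_b2q. simpl.
    specialize (H s Hs). lra.
Qed.

Lemma relu_nonneg z : 0 <= relu z.
Proof. apply Rmax_l. Qed.

Lemma relu_pos z : 0 < z -> relu z = z.
Proof. intros. apply Rmax_right; lra. Qed.

Lemma relu_neg z : z <= 0 -> relu z = 0.
Proof. intros. apply Rmax_left; lra. Qed.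

Lemma wsum_empty w E l : (forall v, In v l -> E v = false) -> wsum w E l = 0.
Proof.
  intros H. unfold wsum. induction l as [|v l IH]; simpl; auto.
  rewrite H by (simpl; auto). rewrite IH; [lra|]. intros; apply H; simpl; auto.
Qed.

Lemma wsum_single w E l v : NoDup l -> In v l -> (forall u, In u l -> E u = true <-> u = v) ->
  wsum w E l = w v.
Proof.
  intros Hl. induction Hl as [|u l Hu Hl IH]; intros Hv H; [destruct Hv|].
  unfold wsum; simpl. change (fold_right Rplus 0 _) with (wsum w E l).
  destruct (V_dec u v) as [->|N].
  - rewrite (proj2 (H v (or_introl eq_refl)) eq_refl).
    rewrite wsum_empty; [lra|]. intros u' Hu'. destruct (E u') eqn:Eu; auto.
    apply H in Eu; [congruence|simpl; auto].
  - destruct Hv as [->|Hv]; [congruence|].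
    destruct (E u) eqn:Eu; [apply H in Eu; [congruence|simpl; auto]|].
    rewrite IH; auto; [lra|]. intros; apply H; simpl; auto.
Qed.

(** As [b <= 0], every selected weight exceeds [- b] and is therefore positive; one of them alone
    outweighs the bias. *)
Lemma wsum_mono_pos w E l b : b <= 0 ->
  (forall v, In v l -> E v = true -> 0 < w v + b) ->
  (exists v, In v l /\ E v = true) -> 0 < wsum w E l + b.
Proof.
  intros Hb Hw [v [Hv Ev]].
  assert (G : forall l', (forall u, In u l' -> E u = true -> 0 < w u + b) -> 0 <= wsum w E l').
  { induction l' as [|u l' IH]; intros Hl'; unfold wsum; simpl; [lra|].
    change (fold_right Rplus 0 _) with (wsum w E l').
    specialize (IH (fun u Hu => Hl' u (or_intror Hu))).
    destruct (E u) eqn:Eu; [|lra]. specialize (Hl' u (or_introl eq_refl) Eu). lra. }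
  induction l as [|u l IH]; [destruct Hv|].
  unfold wsum; simpl. change (fold_right Rplus 0 _) with (wsum w E l).
  specialize (G l (fun u' Hu => Hw u' (or_intror Hu))).
  destruct Hv as [->|Hv].
  - rewrite Ev. specialize (Hw v (or_introl eq_refl) Ev). lra.
  - assert (0 < wsum w E l + b) by (apply IH; auto; intros; apply Hw; simpl; auto).
    destruct (E u) eqn:Eu; [|lra]. specialize (Hw u (or_introl eq_refl) Eu). lra.
Qed.

(** One weight [- n] outweighs the at most [n] weights 1. *)
Lemma wsum_mixed_neg (c : V -> bool) E l n : INR (length l) <= n ->
  (exists v, In v l /\ E v = true /\ c v = false) ->
  wsum (fun v => if c v then 1 else - n) E l <= 0.
Proof.
  intros Hn [v [Hv [Ev Cv]]].
  assert (G : forall l', wsum (fun v => if c v then 1 else - n) E l' <= INR (length l')).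
  { induction l' as [|u l' IH]; unfold wsum; simpl length; [simpl; lra|].
    rewrite S_INR. simpl. change (fold_right Rplus 0 _) with (wsum (fun v => if c v then 1 else - n) E l').
    pose proof (pos_INR (length l)). destruct (E u), (c u); lra. }
  apply in_split in Hv. destruct Hv as (l1 & l2 & ->).
  assert (A : forall l1 l2, wsum (fun v => if c v then 1 else - n) E (l1 ++ l2) =
     wsum (fun v => if c v then 1 else - n) E l1 + wsum (fun v => if c v then 1 else - n) E l2).
  { intros m1 m2. unfold wsum. rewrite map_app. induction (map _ m1); simpl; [lra|].
    rewrite IHl. lra. }
  rewrite A. unfold wsum at 2. simpl. change (fold_right Rplus 0 _) with (wsum (fun v => if c v then 1 else - n) E l2).
  rewrite Ev, Cv. rewrite length_app in Hn. simpl in Hn. rewrite plus_INR, S_INR in Hn.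
  pose proof (G l1). pose proof (G l2). lra.
Qed.

Variable ss : list ((V -> bool) * bool).

Definition is_single (E : V -> bool) (v : V) : Prop :=
  forall u, In u vs -> E u = true <-> u = v.

Hypothesis ss_zero : exists E, In (E, false) ss /\ forall v, In v vs -> E v = false.
Hypothesis ss_single : forall v, In v vs -> exists E, In (E, true) ss /\ is_single E v.
Hypothesis ss_true : forall E, In (E, true) ss -> exists v, In v vs /\ is_single E v.

Definition bicoloured (c : V -> bool) (E : V -> bool) : Prop :=
  (exists v, In v vs /\ E v = true /\ c v = true) /\
  (exists v, In v vs /\ E v = true /\ c v = false).

Lemma hinst_yes_colouring : yes_instance (hinst ss) <->
  exists c : V -> bool, forall E, In (E, false) ss ->
    (forall v, In v vs -> E v = false) \/ bicoloured c E.
Proof.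
  rewrite hinst_yes. split.
  - intros (w1 & w2 & b1 & b2 & H).
    (* the colour of [v] tells whether the first unit is active at the sample [v] *)
    exists (fun v => if Rlt_dec 0 (w1 v + b1) then true else false).
    (* At the zero sample both units see only their bias, and two nonnegative outputs sum to 0. *)
    assert (Hb : b1 <= 0 /\ b2 <= 0).
    { destruct ss_zero as (E & HE & H0). specialize (H _ HE). simpl in H.
      rewrite !wsum_empty in H by auto.
      pose proof (relu_nonneg (0 + b1)). pose proof (relu_nonneg (0 + b2)).
      split; apply Rnot_lt_le; intros Hp.
      - rewrite (relu_pos (0 + b1)) in H; lra.
      - rewrite (relu_pos (0 + b2)) in H; lra. }
    (* The unit vector of [v] has label 1, so some unit must be active there. *)
    assert (H2 : forall v, In v vs -> ~ 0 < w1 v + b1 -> 0 < w2 v + b2).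
    { intros v Hv Hn. destruct (ss_single v Hv) as (E & HE & HS). specialize (H _ HE). simpl in H.
      rewrite !(wsum_single _ _ _ v) in H by auto.
      rewrite (relu_neg (w1 v + b1)) in H by lra.
      destruct (Rlt_dec 0 (w2 v + b2)); auto. rewrite relu_neg in H; lra. }
    intros E HE. specialize (H _ HE). simpl in H.
    pose proof (relu_nonneg (wsum w1 E vs + b1)) as P1.
    pose proof (relu_nonneg (wsum w2 E vs + b2)) as P2.
    destruct (existsb E vs) eqn:Ex.
    + right. apply existsb_exists in Ex. destruct Ex as (v0 & Hv0 & Ev0). split.
      * destruct (existsb (fun v => andb (E v) (if Rlt_dec 0 (w1 v + b1) then true else false)) vs) eqn:E1.
        -- apply existsb_exists in E1. destruct E1 as (v & Hv & E1).
           apply andb_prop in E1. exists v; tauto.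
        (* If no vertex of the edge activates the first unit, each activates the second; as the bias
           is nonpositive, so does the whole edge, against its label 0. *)
        -- exfalso. assert (0 < wsum w2 E vs + b2).
           { apply wsum_mono_pos; [tauto| |eauto]. intros v Hv Ev. apply H2; auto. intros Hp.
             assert (existsb (fun v => andb (E v) (if Rlt_dec 0 (w1 v + b1) then true else false)) vs = true).
             { apply existsb_exists. exists v. split; auto. rewrite Ev. destruct (Rlt_dec 0 (w1 v + b1)); auto. }
             congruence. }
           rewrite (relu_pos (wsum w2 E vs + b2)) in H; lra.
      * destruct (existsb (fun v => andb (E v) (if Rlt_dec 0 (w1 v + b1) then false else true)) vs) eqn:E1.
        -- apply existsb_exists in E1. destruct E1 as (v & Hv & E1).
           apply andb_prop in E1. exists v. destruct (Rlt_dec 0 (w1 v + b1)); intuition discriminate.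
        -- exfalso. assert (0 < wsum w1 E vs + b1).
           { apply wsum_mono_pos; [tauto| |eauto]. intros v Hv Ev.
             destruct (Rlt_dec 0 (w1 v + b1)) as [|N]; auto.
             assert (existsb (fun v => andb (E v) (if Rlt_dec 0 (w1 v + b1) then false else true)) vs = true).
             { apply existsb_exists. exists v. split; auto. rewrite Ev. destruct (Rlt_dec 0 (w1 v + b1)); auto. }
             congruence. }
           rewrite (relu_pos (wsum w1 E vs + b1)) in H; lra.
    + left. intros v Hv. destruct (E v) eqn:Ev; auto.
      assert (existsb E vs = true) by (apply existsb_exists; eauto). congruence.
  - intros (c & Hc).
    set (n := INR (length vs)).
    assert (Hn : 0 <= n) by apply pos_INR.
    (* With zero biases exactly one unit outputs 1 on a unit vector, and on a bicoloured edge each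
       sum contains a term [- n]. *)
    exists (fun v => if c v then 1 else - n), (fun v => if negb (c v) then 1 else - n), 0, 0.
    intros [E l] HE. simpl. rewrite !Rplus_0_r. destruct l.
    + destruct (ss_true _ HE) as (v & Hv & HS).
      rewrite !(wsum_single _ _ _ v) by auto.
      destruct (c v); simpl; rewrite (relu_pos 1), (relu_neg (- n)) by lra; lra.
    + destruct (Hc _ HE) as [H0|[H1 H2]].
      * rewrite !wsum_empty by auto. rewrite !relu_neg by lra. lra.
      * rewrite !relu_neg; [lra| |].
        -- apply wsum_mixed_neg with (c := fun v => negb (c v)); [apply Rle_refl|].
           destruct H1 as (v & Hv & Ev & Cv). exists v. now rewrite Cv.
        -- apply wsum_mixed_neg; [apply Rle_refl|]. auto.
Qed.

End Colouring.

(** * Satisfiability as 2-colourability *)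

Definition cell := (option nat * sym)%type.

(* [Some a]: the cell has content [a]; [None]: the deadline of the computation has passed. *)
Definition cvar := option cell.
Definition lit := (cvar * bool)%type.

Definition cell_dec (a b : cell) : {a = b} + {a <> b}.
Proof. repeat decide equality. Defined.
Definition lit_dec (a b : lit) : {a = b} + {a <> b}.
Proof. repeat decide equality. Defined.

(* Samples are hyperedges located at a position [p] with a gap [g]: the [i]-th set of literals sits
   at cell [p + i] for [i < 3], and at cell [p + 3 + g] for [i = 3]. *)
Inductive desc :=
| DZero
| DFalse
| DSingle (far : bool) (l : lit)
| DCompl (far : bool) (v : cvar)
| DClause (b0 b1 b2 b3 : list lit).

Definition label (d : desc) : bool :=
  match d with DFalse | DSingle _ _ => true | _ => false end.

Definition has_false (d : desc) : bool :=
  match d with DFalse | DClause _ _ _ _ => true | _ => false end.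

Definition blk (d : desc) (i : nat) : list lit :=
  match d, i with
  | DSingle false l, 0 | DSingle true l, 3 => [l]
  | DCompl false v, 0 | DCompl true v, 3 => [(v, true); (v, false)]
  | DClause b _ _ _, 0 | DClause _ b _ _, 1 | DClause _ _ b _, 2 | DClause _ _ _ b, 3 => b
  | _, _ => []
  end.

Definition mem (l : lit) (L : list lit) : bool := if in_dec lit_dec l L then true else false.

Lemma mem_In l L : mem l L = true <-> In l L.
Proof. unfold mem. destruct (in_dec lit_dec l L); intuition discriminate. Qed.

Definition sample := (nat * nat * desc)%type.

Definition opos (p g i : nat) : nat := p + match i with 3 => 3 + g | _ => i end.

Definition blks (s : sample) (p' : nat) : list lit :=
  let '(p, g, d) := s in
  if Nat.eqb p' p then blk d 0 else if Nat.eqb p' (p + 1) then blk d 1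
  else if Nat.eqb p' (p + 2) then blk d 2 else if Nat.eqb p' (p + 3 + g) then blk d 3 else [].

Lemma blks_opos p g d p' l : In l (blks (p, g, d) p') <->
  exists i, i < 4 /\ p' = opos p g i /\ In l (blk d i).
Proof.
  unfold blks, opos.
  destruct (Nat.eqb_spec p' p) as [E0|E0].
  { split; [exists 0; repeat split; auto; lia|]. intros (i & Hi & E & H).
    destruct i as [|[|[|[|i]]]]; try lia; auto. }
  destruct (Nat.eqb_spec p' (p + 1)) as [E1|E1].
  { split; [exists 1; repeat split; auto; lia|]. intros (i & Hi & E & H).
    destruct i as [|[|[|[|i]]]]; try lia; auto. }
  destruct (Nat.eqb_spec p' (p + 2)) as [E2|E2].
  { split; [exists 2; repeat split; auto; lia|]. intros (i & Hi & E & H).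
    destruct i as [|[|[|[|i]]]]; try lia; auto. }
  destruct (Nat.eqb_spec p' (p + 3 + g)) as [E3|E3].
  { split; [exists 3; repeat split; auto; lia|]. intros (i & Hi & E & H).
    destruct i as [|[|[|[|i]]]]; try lia; auto. }
  split; [intros []|]. intros (i & Hi & E & H).
  destruct i as [|[|[|[|i]]]]; try lia.
Qed.

(* [None] is the vertex whose colour stands for "false". *)
Definition vertex := option (nat * lit).

Definition vertex_dec (a b : vertex) : {a = b} + {a <> b}.
Proof. decide equality. decide equality; auto using lit_dec, Nat.eq_dec. Defined.

Definition edge (s : sample) (v : vertex) : bool :=
  match v with
  | None => has_false (snd s)
  | Some (p', l) => mem l (blks s p')
  end.

Definition sat (S : nat -> cvar -> bool) (s : sample) : Prop :=
  let '(p, g, d) := s in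
  exists i l, i < 4 /\ In l (blk d i) /\ S (opos p g i) (fst l) = snd l.

Section Vertices.
Variable cvs : list cvar.
Hypothesis cvs_nodup : NoDup cvs.

Definition lits : list lit := flat_map (fun v => [(v, true); (v, false)]) cvs.

Lemma in_lits l : In l lits <-> In (fst l) cvs.
Proof.
  unfold lits. rewrite in_flat_map. destruct l as [v b]; simpl. split.
  - intros (u & Hu & [E|[E|[]]]); injection E as -> _; auto.
  - intros H. exists v. split; auto. destruct b; simpl; auto.
Qed.

Lemma NoDup_flat_map {A B} (f : A -> list B) l : NoDup l -> (forall a, In a l -> NoDup (f a)) ->
  (forall a a' b, In b (f a) -> In b (f a') -> a = a') -> NoDup (flat_map f l).
Proof.
  intros Hl Hf Hd. induction Hl as [|a l Ha Hl IH]; simpl; [constructor|].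
  apply NoDup_app.
  - apply Hf; simpl; auto.
  - apply IH. intros; apply Hf; simpl; auto.
  - intros b Hb Hb'. apply in_flat_map in Hb'. destruct Hb' as (a' & Ha' & Hb').
    rewrite (Hd _ _ _ Hb Hb') in Ha. auto.
Qed.

Lemma lits_nodup : NoDup lits.
Proof.
  apply NoDup_flat_map; auto.
  - intros v _. constructor; [intros [E|[]]; discriminate|]. constructor; auto. constructor.
  - intros v v' l [<-|[<-|[]]] [E|[E|[]]]; congruence.
Qed.

Variable N : nat.

Definition verts : list vertex :=
  None :: flat_map (fun p => map (fun l => Some (p, l)) lits) (seq 0 N).

Lemma in_verts p l : In (Some (p, l)) verts <-> p < N /\ In (fst l) cvs.
Proof.
  unfold verts. rewrite <- in_lits. simpl. rewrite in_flat_map. split.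
  - intros [E|(q & Hq & H)]; [discriminate|]. apply in_map_iff in H. destruct H as (l' & E & H).
    injection E as -> ->. apply in_seq in Hq. split; auto; lia.
  - intros [Hp Hl]. right. exists p. split; [apply in_seq; lia|]. apply in_map_iff; eauto.
Qed.

Lemma verts_nodup : NoDup verts.
Proof.
  constructor.
  - intros H. apply in_flat_map in H. destruct H as (p & _ & H). apply in_map_iff in H.
    destruct H as (l & E & _). discriminate.
  - apply NoDup_flat_map.
    + apply seq_NoDup.
    + intros p _. apply NoDup_map_NoDup_ForallPairs; [|apply lits_nodup].
      intros l l' _ _ E; now injection E.
    + intros p p' v H H'. apply in_map_iff in H. apply in_map_iff in H'.
      destruct H as (l & <- & _). destruct H' as (l' & E & _). congruence.
Qed.

Variable ss : list sample.

Definition sinst : instance :=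
  hinst vertex verts (map (fun s => (edge s, label (snd s))) ss).

Hypothesis ss_wf : forall p g d, In (p, g, d) ss ->
  p + 3 + g < N /\ forall i l, In l (blk d i) -> In (fst l) cvs.
Hypothesis ss_zero : exists p g, In (p, g, DZero) ss.
Hypothesis ss_false : exists p g, In (p, g, DFalse) ss.
Hypothesis ss_single : forall p v b, p < N -> In v cvs ->
  exists q g far, In (q, g, DSingle far (v, b)) ss /\ p = opos q g (if far then 3 else 0).
Hypothesis ss_compl : forall p v, p < N -> In v cvs ->
  exists q g far, In (q, g, DCompl far v) ss /\ p = opos q g (if far then 3 else 0).

Lemma edge_single q g far l p l' :
  edge (q, g, DSingle far l) (Some (p, l')) = true <->
  p = opos q g (if far then 3 else 0) /\ l' = l.
Proof.
  unfold edge. rewrite mem_In, blks_opos. split.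
  - intros (i & Hi & E & H). destruct far, i as [|[|[|[|i]]]]; simpl in H; try tauto;
      destruct H as [<-|[]]; auto.
  - intros [E ->]. exists (if far then 3 else 0). destruct far; simpl in *; repeat split; auto; lia.
Qed.

Lemma edge_compl q g far v p l :
  edge (q, g, DCompl far v) (Some (p, l)) = true <->
  p = opos q g (if far then 3 else 0) /\ fst l = v.
Proof.
  unfold edge. rewrite mem_In, blks_opos. split.
  - intros (i & Hi & E & H). destruct far, i as [|[|[|[|i]]]]; simpl in H; try tauto;
      destruct H as [<-|[<-|[]]]; auto.
  - intros [E <-]. exists (if far then 3 else 0).
    destruct far, l as [v []]; simpl in *; repeat split; auto; lia.
Qed.

Lemma opos_lt p g d i : In (p, g, d) ss -> i < 4 -> opos p g i < N.
Proof.
  intros H Hi. apply ss_wf in H. unfold opos. destruct i as [|[|[|[|i]]]]; lia.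
Qed.

(** A literal counts as true when its colour differs from that of the vertex [None]. A clause edge
    contains [None], so it is bicoloured iff one of its literals is true; the complement edges give
    the two literals of a variable opposite colours. *)
Lemma sinst_yes : yes_instance sinst <->
  exists S : nat -> cvar -> bool,
    forall p g b0 b1 b2 b3, In (p, g, DClause b0 b1 b2 b3) ss -> sat S (p, g, DClause b0 b1 b2 b3).
Proof.
  unfold sinst. rewrite hinst_yes_colouring; auto using vertex_dec, verts_nodup.
  2: { destruct ss_zero as (p & g & H). exists (edge (p, g, DZero)). split.
       - apply in_map_iff. exists (p, g, DZero). auto.
       - intros [[p' l]|] _; auto. simpl.
         destruct (Nat.eqb p' p), (Nat.eqb p' (p + 1)), (Nat.eqb p' (p + 2)), (Nat.eqb p' (p + 3 + g)); reflexivity. }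
  2: { intros [[p [v b]]|] Hv.
       - apply in_verts in Hv. destruct Hv as [Hp Hv].
         destruct (ss_single p v b Hp Hv) as (q & g & far & H & E).
         exists (edge (q, g, DSingle far (v, b))). split.
         + apply in_map_iff. eexists; split; [|exact H]. reflexivity.
         + intros [[p' l]|] _.
           * rewrite edge_single, <- E. split; [intros [-> ->]; auto|intros E'; injection E' as -> ->; auto].
           * simpl. split; discriminate.
       - destruct ss_false as (p & g & H). exists (edge (p, g, DFalse)). split.
         + apply in_map_iff. eexists; split; [|exact H]. reflexivity.
         + intros [[p' l]|] _; simpl; [|tauto]. split; [|discriminate].
           rewrite mem_In. fold (blks (p, g, DFalse) p'). intros HH.
           change (In l (blks (p, g, DFalse) p')) in HH. apply blks_opos in HH.
           destruct HH as (i & _ & _ & []). }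
  2: { intros E HE. apply in_map_iff in HE. destruct HE as ([[p g] d] & EE & H).
       injection EE as <- El. destruct d; try discriminate.
       - exists None. split; [left; auto|]. intros [[p' l]|] _; [|simpl; tauto].
         split; [|discriminate]. simpl. rewrite mem_In. intros HH.
         change (In l (blks (p, g, DFalse) p')) in HH. apply blks_opos in HH.
         destruct HH as (i & _ & _ & []).
       - exists (Some (opos p g (if far then 3 else 0), l)). split.
         + apply in_verts. split.
           * apply (opos_lt _ _ _ _ H). destruct far; lia.
           * apply (proj2 (ss_wf _ _ _ H) (if far then 3 else 0)). destruct far; simpl; auto.
         + intros [[p' l']|] _.
           * rewrite edge_single. split; [intros [-> ->]; auto|intros E'; injection E' as -> ->; auto].
           * simpl. split; discriminate. }
  split.
  - intros (c & Hc). exists (fun p v => xorb (c (Some (p, (v, true)))) (c None)).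
    intros p g b0 b1 b2 b3 Hs. set (d := DClause b0 b1 b2 b3) in *.
    destruct (Hc (edge (p, g, d))) as [H|H].
    { apply in_map_iff. exists (p, g, d); auto. }
    { specialize (H None (or_introl eq_refl)). discriminate. }
    (* Of two vertices with different colours, one differs from [None] in colour, and that one is a
       literal. *)
    assert (Hd : exists p' l, In l (blks (p, g, d) p') /\ c (Some (p', l)) <> c None).
    { destruct H as [(v1 & _ & E1 & C1) (v2 & _ & E2 & C2)].
      destruct v1 as [[p1 l1]|], v2 as [[p2 l2]|]; try congruence.
      - destruct (c None) eqn:Cn.
        + exists p2, l2. split; [now apply mem_In|congruence].
        + exists p1, l1. split; [now apply mem_In|congruence].
      - exists p1, l1. split; [now apply mem_In|congruence].
      - exists p2, l2. split; [now apply mem_In|congruence]. }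
    destruct Hd as (p' & [v b] & Hl & Hcol). apply blks_opos in Hl.
    destruct Hl as (i & Hi & -> & Hl). exists i, (v, b). repeat split; auto. cbn [fst snd].
    assert (Hp : opos p g i < N) by (apply (opos_lt _ _ _ _ Hs Hi)).
    assert (Hv : In v cvs) by (apply (proj2 (ss_wf _ _ _ Hs) _ _ Hl)).
    destruct b.
    + destruct (xorb _ _) eqn:X; auto. apply Bool.xorb_eq in X. contradiction.
    (* The assignment was read off the positive literal only; for a negative literal the complement
       edge transfers the colour. *)
    + destruct (ss_compl _ _ Hp Hv) as (q & g' & far & Hq & E).
      destruct (Hc (edge (q, g', DCompl far v))) as [H'|[H1 H2]].
      { apply in_map_iff. eexists; split; [|exact Hq]. reflexivity. }
      { specialize (H' (Some (opos p g i, (v, true)))).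
        assert (edge (q, g', DCompl far v) (Some (opos p g i, (v, true))) = true)
          by (now apply edge_compl).
        rewrite H' in H0; [discriminate|]. apply in_verts; auto. }
      assert (Hne : c (Some (opos p g i, (v, true))) <> c (Some (opos p g i, (v, false)))).
      { intros Heq. destruct H1 as ([[p1 [v1 c1]]|] & _ & E1 & C1); [|discriminate].
        destruct H2 as ([[p2 [v2 c2]]|] & _ & E2 & C2); [|discriminate].
        apply edge_compl in E1, E2. rewrite <- E in E1, E2. simpl in *.
        destruct E1 as [-> ->], E2 as [-> ->]. unfold lit in *. destruct c1, c2; congruence. }
      assert (X : forall a1 a2 a : bool, a2 <> a -> a1 <> a2 -> xorb a1 a = false)
        by (intros [] [] []; simpl; congruence).
      exact (X _ _ _ Hcol Hne).
  - intros (S & HS).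
    exists (fun v => match v with None => false | Some (p, (v, b)) => Bool.eqb (S p v) b end).
    intros E HE. apply in_map_iff in HE. destruct HE as ([[p g] d] & EE & H).
    injection EE as <- El. destruct d; try discriminate.
    + left. intros [[p' l]|] _; auto. simpl.
      destruct (Nat.eqb p' p), (Nat.eqb p' (p + 1)), (Nat.eqb p' (p + 2)), (Nat.eqb p' (p + 3 + g)); reflexivity.
    + right. set (q := opos p g (if far then 3 else 0)).
      assert (Hq : q < N) by (apply (opos_lt _ _ _ _ H); destruct far; lia).
      assert (Hv : In v cvs).
      { apply (proj2 (ss_wf _ _ _ H) (if far then 3 else 0) (v, true)). destruct far; simpl; auto. }
      split.
      * exists (Some (q, (v, S q v))). rewrite in_verts, edge_compl. simpl.
        rewrite Bool.eqb_reflx. auto.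
      * exists (Some (q, (v, negb (S q v)))). rewrite in_verts, edge_compl. simpl.
        destruct (S q v); auto.
    + right. specialize (HS _ _ _ _ _ _ H). destruct HS as (i & [v b] & Hi & Hl & Hsat).
      split.
      * exists (Some (opos p g i, (v, b))). split; [|split].
        -- apply in_verts. split; [apply (opos_lt _ _ _ _ H Hi)|apply (proj2 (ss_wf _ _ _ H) _ _ Hl)].
        -- apply mem_In, blks_opos. eauto.
        -- simpl in Hsat. rewrite Hsat. apply Bool.eqb_reflx.
      * exists None. split; [left; auto|]. auto.
Qed.

End Vertices.

(** * The computation tableau of a verifier *)

Lemma sat_clause S p g b0 b1 b2 b3 :
  let holds q L := fold_right (fun l P => S q (fst l) = snd l \/ P) False L in
  sat S (p, g, DClause b0 b1 b2 b3) <->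
  holds p b0 \/ holds (p + 1) b1 \/ holds (p + 2) b2 \/ holds (p + 3 + g) b3.
Proof.
  intros holds.
  assert (H : forall q L, holds q L <-> exists l, In l L /\ S q (fst l) = snd l).
  { intros q L. unfold holds. induction L as [|a L IH]; simpl.
    - split; [tauto|]. intros (l & [] & _).
    - rewrite IH. split.
      + intros [E|(l & Hl & E)]; eauto.
      + intros (l & [<-|Hl] & E); eauto. }
  rewrite !H. unfold sat. split.
  - intros (i & l & Hi & Hl & E). unfold opos in E.
    destruct i as [|[|[|[|i]]]]; try lia; simpl in Hl.
    + left. exists l. rewrite Nat.add_0_r in E. auto.
    + right; left; eauto.
    + do 2 right; left; eauto.
    + do 3 right. exists l. rewrite <- Nat.add_assoc. auto.
  - intros [(l & Hl & E)|[(l & Hl & E)|[(l & Hl & E)|(l & Hl & E)]]].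
    + exists 0, l. unfold opos. rewrite Nat.add_0_r. repeat split; auto; lia.
    + exists 1, l. repeat split; auto; lia.
    + exists 2, l. repeat split; auto; lia.
    + exists 3, l. unfold opos. rewrite Nat.add_assoc. repeat split; auto; lia.
Qed.

Section Tableau.
Variable V : TM.
Variables c k : nat.
Variable x : list bool.

(* The extra state [tm_Q V] starts one cell to the left of the input and moves right into the
   start state, so the input cells of the first row carry no head. *)
Definition pnxt (q : nat) (s : sym) : nat * sym * move :=
  if Nat.eqb q (tm_Q V) then (tm_start V, s, MRight) else nxt_of V q s.

(** The state in which a head scanning [a] leaves it in direction [d], if it does. *)
Definition arrive (d : move) (a : cell) : option nat :=
  match fst a with
  | None => None
  | Some q =>
      match pnxt q (snd a), d with
      | (q', _, MLeft), MLeft | (q', _, MRight), MRight | (q', _, MStay), MStay => Some q'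
      | _, _ => None
      end
  end.

Definition local (a b d : cell) : cell :=
  match fst b with
  | Some q => (arrive MStay b, snd (fst (pnxt q (snd b))))
  | None => (match arrive MRight a with Some q => Some q | None => arrive MLeft d end, snd b)
  end.

Definition zcell (C : zcfg nat) (i : Z) : cell :=
  let '(q, h, f) := C in (if Z.eqb i h then Some q else None, f i).

Ltac zdec :=
  repeat match goal with |- context [Z.eqb ?a ?b] => destruct (Z.eqb_spec a b); try lia end; auto.

Lemma zcell_local C i :
  zcell (zstep pnxt C) i = local (zcell C (i - 1)) (zcell C i) (zcell C (i + 1)).
Proof.
  destruct C as [[q h] f]. unfold zstep. destruct (pnxt q (f h)) as [[q' s] mv] eqn:E.
  unfold zcell, local, arrive; simpl fst; simpl snd.
  destruct (Z.eqb_spec i h) as [->|N]; simpl fst.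
  - rewrite E, tupd_eq. simpl. destruct mv; simpl; zdec.
  - rewrite tupd_neq by auto.
    destruct (Z.eqb_spec (i - 1) h) as [<-|N1]; simpl.
    + rewrite E. destruct (Z.eqb_spec (i + 1) (i - 1)); try lia.
      destruct mv; simpl; zdec.
    + destruct (Z.eqb_spec (i + 1) h) as [<-|N2]; simpl.
      * rewrite E. destruct mv; simpl; zdec.
      * destruct mv; simpl; zdec.
Qed.

Lemma pnxt_le q s : q <= tm_Q V -> fst (fst (pnxt q s)) < tm_Q V.
Proof.
  intros H. unfold pnxt, nxt_of. destruct (Nat.eqb_spec q (tm_Q V)).
  - apply tm_start_ok.
  - destruct (Nat.eqb_spec q (tm_halt V)); simpl; [lia|]. apply tm_delta_ok. lia.
Qed.

Definition alph : list cell :=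
  list_prod (None :: map Some (seq 0 (tm_Q V + 1))) [None; Some true; Some false].

Lemma in_alph a : In a alph <-> match fst a with None => True | Some q => q <= tm_Q V end.
Proof.
  destruct a as [o s]. unfold alph. etransitivity; [apply in_prod_iff|]. simpl fst.
  assert (Hs : In s [None; Some true; Some false]) by (destruct s as [[]|]; simpl; auto).
  destruct o as [q|]; simpl; [|tauto]. rewrite in_map_iff. split.
  - intros [[E|(q' & E & H)] _]; [discriminate|]. injection E as ->. apply in_seq in H. lia.
  - intros H. split; auto. right. exists q. split; auto. apply in_seq. lia.
Qed.

Definition cvs : list cvar := None :: map Some alph.

Lemma cvs_nodup : NoDup cvs.
Proof.
  constructor.
  - intros H. apply in_map_iff in H. destruct H as (a & E & _). discriminate.
  - apply NoDup_map_NoDup_ForallPairs; [intros a b _ _ E; now injection E|].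
    unfold alph. rewrite list_prod_as_flat_map. apply NoDup_flat_map.
    + constructor.
      * intros H. apply in_map_iff in H. destruct H as (a & E & _). discriminate.
      * apply NoDup_map_NoDup_ForallPairs; [intros a b _ _ E; now injection E|]. apply seq_NoDup.
    + intros o _. repeat constructor; simpl; intuition discriminate.
    + intros o o' a H H'. apply in_map_iff in H, H'.
      destruct H as (s & <- & _), H' as (s' & E & _). congruence.
Qed.

Lemma in_cvs v : In v cvs <-> match v with None => True | Some a => In a alph end.
Proof.
  unfold cvs. cbn [In]. rewrite in_map_iff. destruct v as [a|]; split; auto.
  - intros [E|(b & E & H)]; [discriminate|]. now injection E as ->.
  - intros H. right. eauto.
Qed.

Lemma local_alph a b d : In a alph -> In b alph -> In d alph -> In (local a b d) alph.
Proof.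
  assert (A : forall mv a, In a alph -> match arrive mv a with None => True | Some q => q <= tm_Q V end).
  { intros mv [[q|] s] H; unfold arrive; simpl; auto. apply in_alph in H. simpl in H.
    pose proof (pnxt_le q s H) as H1. destruct (pnxt q s) as [[q' s'] mv']. simpl in H1.
    destruct mv', mv; auto; lia. }
  intros Ha Hb Hd. apply in_alph. unfold local. destruct (fst b).
  - apply (A MStay _ Hb).
  - pose proof (A MRight _ Ha). pose proof (A MLeft _ Hd). simpl.
    destruct (arrive MRight a); auto.
Qed.

Definition bl : cell := (None, None).
Definition bitcell (b : bool) : cell := (None, Some b).

(** A scanned cell incompatible with acceptance. Output exactly [[true]] also requires a blank to
    the right of the head; the last clauses of [uniform] check this. *)
Definition bad (a : cell) : bool :=
  match a with
  | (Some q, Some true) => negb (Nat.eqb q (tm_halt V))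
  | (Some q, _) => true
  | _ => false
  end.

Definition unit (a : cell) : desc := DClause [(Some a, true)] [] [] [].

Definition transitions : list desc :=
  flat_map (fun a => flat_map (fun b => map (fun d =>
    DClause [(Some a, false)] [(Some b, false)] [(Some d, false)] [(Some (local a b d), true)])
    alph) alph) alph.

(** This list depends on [V] only, so the reduction can contain it as straight-line code and repeat
    it at each window position. *)
Definition uniform : list desc :=
  flat_map (fun l => [DSingle false l; DSingle true l]) (lits cvs) ++
  flat_map (fun v => [DCompl false v; DCompl true v]) cvs ++
  transitions ++
  [DClause [(None, false)] [(None, true)] [] []] ++
  map (fun a => DClause [(None, false); (Some a, false)] [] [] []) (filter bad alph) ++
  map (fun b => DClause [(None, false); (Some (Some (tm_halt V), Some true), false)]
                  [(Some b, false)] [] [])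
    (filter (fun b => match snd b with None => false | Some _ => true end) alph).

Definition guess : list desc :=
  [DClause [(Some bl, true); (Some (bitcell true), true); (Some (bitcell false), true)] [] [] [];
   DClause [(Some bl, false)] [(Some bl, true)] [] []].

(* Located at the [l]-th guess cell with the gap of [l]: if the witness has length at most [l], the
   deadline passes after the time allowed for length [l]. *)
Definition trigger : desc := DClause [(Some bl, false)] [] [] [(None, true)].

Local Notation nx := (length x).
(** The time allowed with a witness of length [l]. *)
Definition pw (l : nat) : nat := c * (nx + 1 + l) ^ k.
Definition wlen : nat := c * (nx + 1) ^ k.
(** At least [pw wlen + 2] rows are wanted, so that every inspected row [pw l + 1] is present. The
    other summands make [lpad] exceed the input and guess area as well, so one padding length serves
    both sides. *)
Definition nrows : nat := pw wlen + wlen + 2 * (nx + 1).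
Definition lpad : nat := nrows + 3.
Definition gap0 : nat := 4 * lpad.
(** The fourth block of a sample at [p] sits at [p + 3 + gap0], which is the cell below the middle
    [p + 1] of the window exactly for this row length. *)
Definition width : nat := gap0 + 2.
Definition nwin : nat := nrows * width.
(** The last window, at [nwin - 1], reaches the cell [nwin + width]. *)
Definition ncells : nat := nwin + width + 1.
Definition gpos (l : nat) : nat := lpad + 2 * nx + 2 + l.
(** The summand [lpad] carries the trigger to column [gpos l + lpad + 3] of row [pw l], right of any
    place the head can have reached there. The first head inspected is thus that of row [pw l + 1],
    which shows the verifier after [pw l] steps because of the extra initial step. *)
Definition gap (l : nat) : nat := pw l * width + lpad.

Fixpoint units (p : nat) (cs : list cell) : list sample :=
  match cs with
  | nil => nil
  | a :: cs' => (p, gap0, unit a) :: units (p + 1) cs'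
  end.

Lemma in_units p cs s : In s (units p cs) <->
  exists j, j < length cs /\ s = (p + j, gap0, unit (nth j cs bl)).
Proof.
  revert p; induction cs as [|a cs IH]; intros p; simpl.
  - split; [tauto|]. intros (j & Hj & _); lia.
  - rewrite IH. split.
    + intros [<-|(j & Hj & ->)].
      * exists 0. rewrite Nat.add_0_r. split; auto; lia.
      * exists (S j). split; [lia|]. f_equal. f_equal. lia.
    + intros ([|j] & Hj & ->).
      * left. now rewrite Nat.add_0_r.
      * right. exists j. split; [lia|]. f_equal. f_equal. lia.
Qed.

(** The last run of blanks deliberately overshoots the first row: windows determine only the cells
    from [width + 1] on, so cell [width], the first of the second row, needs a unit clause too. *)
Definition samples : list sample :=
  [(0, gap0, DZero); (0, gap0, DFalse)] ++
  units 0 (repeat bl lpad) ++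
  units lpad [(Some (tm_Q V), None)] ++
  units (lpad + 1) (map bitcell (enc_bits x)) ++
  flat_map (fun l => map (fun d => (gpos l, gap0, d)) guess ++ [(gpos l, gap l, trigger)]) (seq 0 wlen) ++
  [(gpos wlen, gap wlen, trigger)] ++
  units (gpos wlen) (repeat bl (3 * lpad + 2)) ++
  flat_map (fun p => map (fun d => (p, gap0, d)) uniform) (seq 0 nwin).

Lemma length_enc_bits y : length (enc_bits y) = 2 * length y + 1.
Proof.
  unfold enc_bits. rewrite length_app. simpl. induction y as [|b y IH]; simpl in *; lia.
Qed.

Lemma pw_le l : l <= wlen -> pw l <= pw wlen.
Proof.
  intros H. unfold pw. apply Nat.mul_le_mono_l, Nat.pow_le_mono_l. lia.
Qed.

Lemma in_uniform d : In d uniform <->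
  (exists far l, In (fst l) cvs /\ d = DSingle far l) \/
  (exists far v, In v cvs /\ d = DCompl far v) \/
  (exists a b e, In a alph /\ In b alph /\ In e alph /\
     d = DClause [(Some a, false)] [(Some b, false)] [(Some e, false)] [(Some (local a b e), true)]) \/
  d = DClause [(None, false)] [(None, true)] [] [] \/
  (exists a, In a alph /\ bad a = true /\ d = DClause [(None, false); (Some a, false)] [] [] []) \/
  (exists b, In b alph /\ snd b <> None /\
     d = DClause [(None, false); (Some (Some (tm_halt V), Some true), false)] [(Some b, false)] [] []).
Proof.
  unfold uniform. rewrite !in_app_iff, !in_flat_map, !in_map_iff. split.
  - intros [(l & Hl & H)|[(v & Hv & H)|[H|[H|[(a & H & Ha)|(a & H & Ha)]]]]].
    + left. apply in_lits in Hl. destruct H as [<-|[<-|[]]]; eauto.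
    + right; left. destruct H as [<-|[<-|[]]]; eauto.
    + do 2 right; left. unfold transitions in H. apply in_flat_map in H. destruct H as (a & Ha & H).
      apply in_flat_map in H. destruct H as (b & Hb & H). apply in_map_iff in H.
      destruct H as (e & <- & He). exists a, b, e. auto.
    + do 3 right; left. destruct H as [<-|[]]; auto.
    + do 4 right; left. apply filter_In in Ha. exists a. destruct Ha. auto.
    + do 5 right. apply filter_In in Ha. exists a. destruct Ha as [Ha1 Ha2]. repeat split; auto.
      destruct a as [o [s|]]; simpl in *; discriminate.
  - intros [(far & l & Hl & ->)|[(far & v & Hv & ->)|[(a & b & e & Ha & Hb & He & ->)|[->|[(a & Ha & Hb & ->)|(b & Ha & Hb & ->)]]]]].
    + left. exists l. rewrite in_lits. split; auto. destruct far; simpl; auto.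
    + right; left. exists v. split; auto. destruct far; simpl; auto.
    + do 2 right; left. unfold transitions. apply in_flat_map. exists a. split; auto.
      apply in_flat_map. exists b. split; auto. apply in_map_iff. eauto.
    + do 3 right; left. simpl; auto.
    + do 4 right; left. exists a. rewrite filter_In; auto.
    + do 5 right. exists b. rewrite filter_In. repeat split; auto.
      destruct b as [o [s|]]; simpl in *; congruence.
Qed.

Lemma in_samples s : In s samples <->
  s = (0, gap0, DZero) \/ s = (0, gap0, DFalse) \/
  (exists p, p < lpad /\ s = (p, gap0, unit bl)) \/
  s = (lpad, gap0, unit (Some (tm_Q V), None)) \/
  (exists j, j < 2 * nx + 1 /\ s = (lpad + 1 + j, gap0, unit (bitcell (nth j (enc_bits x) false)))) \/
  (exists l d, l < wlen /\ In d guess /\ s = (gpos l, gap0, d)) \/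
  (exists l, l <= wlen /\ s = (gpos l, gap l, trigger)) \/
  (exists j, j < 3 * lpad + 2 /\ s = (gpos wlen + j, gap0, unit bl)) \/
  (exists p d, p < nwin /\ In d uniform /\ s = (p, gap0, d)).
Proof.
  unfold samples. rewrite !in_app_iff, !in_units, !in_flat_map. split.
  - intros [[<-|[<-|[]]]|[(j & Hj & ->)|[(j & Hj & ->)|[(j & Hj & ->)|[(l & Hl & H)|[[<-|[]]|[(j & Hj & ->)|(p & Hp & H)]]]]]]].
    + auto.
    + auto.
    + rewrite repeat_length in Hj. do 2 right; left. exists j. split; auto.
      now rewrite nth_repeat_lt by auto.
    + simpl in Hj. destruct j; [|lia]. rewrite Nat.add_0_r. do 3 right; left; auto.
    + rewrite length_map, length_enc_bits in Hj. do 4 right; left. exists j. split; auto.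
      rewrite nth_indep with (d' := bitcell false) by (rewrite length_map, length_enc_bits; auto).
      now rewrite map_nth.
    + apply in_seq in Hl. apply in_app_iff in H. destruct H as [H|[<-|[]]].
      * apply in_map_iff in H. destruct H as (d & <- & H). do 5 right; left.
        exists l, d. repeat split; auto; lia.
      * do 6 right; left. exists l. split; auto; lia.
    + do 6 right; left. exists wlen. split; auto.
    + rewrite repeat_length in Hj. do 7 right; left. exists j. split; auto.
      now rewrite nth_repeat_lt by auto.
    + apply in_seq in Hp. apply in_map_iff in H. destruct H as (d & <- & H).
      do 8 right. exists p, d. repeat split; auto; lia.
  - intros [->|[->|[(p & Hp & ->)|[->|[(j & Hj & ->)|[(l & d & Hl & Hd & ->)|[(l & Hl & ->)|[(j & Hj & ->)|(p & d & Hp & Hd & ->)]]]]]]]].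
    + left; simpl; auto.
    + left; simpl; auto.
    + right; left. exists p. rewrite repeat_length, nth_repeat_lt by auto. auto.
    + do 2 right; left. exists 0. rewrite Nat.add_0_r. simpl; auto.
    + do 3 right; left. exists j. rewrite length_map, length_enc_bits. split; auto.
      rewrite nth_indep with (d' := bitcell false) by (rewrite length_map, length_enc_bits; auto).
      now rewrite map_nth.
    + do 4 right; left. exists l. rewrite in_seq. split; [lia|]. apply in_app_iff. left.
      apply in_map_iff; eauto.
    + destruct (Nat.eq_dec l wlen) as [->|Nl].
      * do 5 right; left. simpl; auto.
      * do 4 right; left. exists l. rewrite in_seq. split; [lia|]. apply in_app_iff. right; simpl; auto.
    + do 6 right; left. exists j. rewrite repeat_length, nth_repeat_lt by auto. auto.
    + do 7 right. exists p. rewrite in_seq. split; [lia|]. apply in_map_iff; eauto.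
Qed.

Lemma width_pos : 0 < width.
Proof. unfold width; lia. Qed.

Lemma ncells_eq : ncells = (nrows + 1) * width + 1.
Proof. unfold ncells, nwin. lia. Qed.

Lemma nrows_ge : pw wlen + wlen + 2 * nx + 2 <= nrows.
Proof. unfold nrows. lia. Qed.

(** Row [pw l + 1] lies entirely behind the deadline triggered at guess cell [l]. *)
Lemma gap_le l : l <= wlen -> gpos l + 3 + gap l <= (pw l + 1) * width.
Proof.
  intros H. pose proof nrows_ge. unfold gap, gpos, width, gap0, lpad in *. lia.
Qed.

Lemma mul_width_le a b : a <= b -> a * width <= b * width.
Proof. apply Nat.mul_le_mono_r. Qed.

Lemma samples_bound p g d : In (p, g, d) samples -> p + 3 + g < ncells.
Proof.
  intros H. apply in_samples in H. rewrite ncells_eq. pose proof nrows_ge as Hn.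
  pose proof (mul_width_le 2 nrows ltac:(lia)) as H2.
  assert (HW : width = 4 * lpad + 2) by reflexivity.
  assert (HL : lpad = nrows + 3) by reflexivity.
  destruct H as [E|[E|[(p' & Hp & E)|[E|[(j & Hj & E)|[(l & d' & Hl & Hd & E)|[(l & Hl & E)|[(j & Hj & E)|(p' & d' & Hp & Hd & E)]]]]]]]];
    injection E as -> -> ->; try (unfold gap0, gpos; lia).
  - pose proof (gap_le l Hl). pose proof (pw_le l Hl).
    pose proof (mul_width_le (pw l + 1) nrows ltac:(lia)). lia.
  - unfold nwin, gap0 in *. lia.
Qed.

Lemma samples_lits p g d : In (p, g, d) samples ->
  forall i l, In l (blk d i) -> In (fst l) cvs.
Proof.
  assert (Hbl : In (Some bl) cvs) by (apply in_cvs, in_alph; simpl; auto).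
  assert (Hbit : forall b, In (Some (bitcell b)) cvs) by (intros; apply in_cvs, in_alph; simpl; auto).
  assert (Hnone : In None cvs) by (apply in_cvs; auto).
  assert (Hun : forall a, In (Some a) cvs -> forall i l, In l (blk (unit a) i) -> In (fst l) cvs).
  { intros a Ha [|[|[|[|i]]]] l; simpl; try tauto. intros [<-|[]]; auto. }
  intros H i l Hl. apply in_samples in H.
  destruct H as [E|[E|[(p' & Hp & E)|[E|[(j & Hj & E)|[(l' & d' & Hl' & Hd & E)|[(l' & Hl' & E)|[(j & Hj & E)|(p' & d' & Hp & Hd & E)]]]]]]]];
    injection E as -> -> ->; try (eapply Hun; [|exact Hl]; auto; fail).
  - destruct i as [|[|[|[|i]]]]; simpl in Hl; tauto.
  - destruct i as [|[|[|[|i]]]]; simpl in Hl; tauto.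
  - eapply Hun; [|exact Hl]. apply in_cvs, in_alph. apply le_n.
  - destruct Hd as [<-|[<-|[]]]; destruct i as [|[|[|[|i]]]]; simpl in Hl; intuition; subst; simpl fst; auto.
  - destruct i as [|[|[|[|i]]]]; simpl in Hl; intuition; subst; simpl fst; auto.
  - apply in_uniform in Hd.
    destruct Hd as [(far & l' & Hl' & ->)|[(far & v & Hv & ->)|[(a & b & e & Ha & Hb & He & ->)|[->|[(a & Ha & Hb & ->)|(b & Ha & Hb & ->)]]]]].
    + destruct far, i as [|[|[|[|i]]]]; simpl in Hl; intuition; subst; simpl fst; auto.
    + destruct far, i as [|[|[|[|i]]]]; simpl in Hl; intuition; subst; simpl fst; auto.
    + pose proof (local_alph _ _ _ Ha Hb He).
      destruct i as [|[|[|[|i]]]]; simpl in Hl; destruct Hl as [<-|[]] || destruct Hl;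
        apply in_cvs; auto.
    + destruct i as [|[|[|[|i]]]]; simpl in Hl; intuition; subst; simpl fst; auto.
    + destruct i as [|[|[|[|i]]]]; simpl in Hl; intuition; subst; simpl fst; auto. apply in_cvs; auto.
    + assert (In (Some (Some (tm_halt V), Some true)) cvs).
      { apply in_cvs, in_alph. simpl. pose proof (tm_halt_ok V). lia. }
      destruct i as [|[|[|[|i]]]]; simpl in Hl; intuition; subst; simpl fst; auto. apply in_cvs; auto.
Qed.

(** No window starts at the cells from [nwin] on; they are met as the fourth block of the window
    [width + 1] cells earlier. This is the purpose of the [far] versions of the singletons and
    complements. *)
Lemma uniform_covers p (mk : bool -> desc) : (forall far, In (mk far) uniform) -> p < ncells ->
  exists q g far, In (q, g, mk far) samples /\ p = opos q g (if far then 3 else 0).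
Proof.
  intros Hmk Hp. destruct (Nat.lt_ge_cases p nwin) as [L|L].
  - exists p, gap0, false. split; [|unfold opos; lia]. apply in_samples. do 8 right. eauto.
  - exists (p - (width + 1)), gap0, true. pose proof nrows_ge.
    pose proof (mul_width_le 2 nrows ltac:(lia)) as H2.
    unfold ncells in Hp. split.
    + apply in_samples. do 8 right. exists (p - (width + 1)), (mk true). repeat split; auto.
      unfold nwin, width in *. lia.
    + unfold opos. unfold nwin, width in *. lia.
Qed.

Lemma samples_yes : yes_instance (sinst cvs ncells samples) <->
  exists S : nat -> cvar -> bool, forall p g b0 b1 b2 b3,
    In (p, g, DClause b0 b1 b2 b3) samples -> sat S (p, g, DClause b0 b1 b2 b3).
Proof.
  apply sinst_yes.
  - apply cvs_nodup.
  - intros p g d H. split; [apply (samples_bound _ _ _ H)|apply (samples_lits _ _ _ H)].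
  - exists 0, gap0. apply in_samples. auto.
  - exists 0, gap0. apply in_samples. auto.
  - intros p v b Hp Hv. apply (uniform_covers p (fun far => DSingle far (v, b))); auto.
    intros far. apply in_uniform. left. exists far, (v, b). auto.
  - intros p v Hp Hv. apply (uniform_covers p (fun far => DCompl far v)); auto.
    intros far. apply in_uniform. right; left. eauto.
Qed.

Lemma lpad_ge : pw wlen + wlen + 2 * nx + 5 <= lpad.
Proof. unfold lpad. pose proof nrows_ge. lia. Qed.

(** * The intended tableau of a given witness *)

Section Run.
Variable w : list bool.
Hypothesis w_len : length w <= wlen.

Definition conf (t : nat) : zcfg nat :=
  zrun pnxt t (tm_Q V, (-1)%Z, list_tape (enc_bits x ++ w)).

(** Column [lpad] is tape cell -1, where the extra state starts. *)
Definition col (j : nat) : Z := (Z.of_nat j - Z.of_nat lpad - 1)%Z.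

(* Consecutive rows of the tableau are laid out one after the other. *)
Definition vc (p : nat) : cell := zcell (conf (p / width)) (col (p mod width)).

Lemma vc_at r j : j < width -> vc (r * width + j) = zcell (conf r) (col j).
Proof.
  intros H. unfold vc.
  replace ((r * width + j) / width) with r.
  - replace ((r * width + j) mod width) with j; auto.
    symmetry. rewrite Nat.add_comm, Nat.Div0.mod_add. now apply Nat.mod_small.
  - apply Nat.div_unique with j; auto. lia.
Qed.

Lemma conf_inv t : let '(q, h, f) := conf t in
  q <= tm_Q V /\ (- 1 - Z.of_nat t <= h <= Z.of_nat t - 1)%Z /\
  (forall i, (i < - 1 - Z.of_nat t \/ Z.of_nat t < i)%Z -> f i = list_tape (enc_bits x ++ w) i).
Proof.
  induction t as [|t IH].
  - simpl. repeat split; auto; lia.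
  - unfold conf in *. rewrite zrun_S. destruct (zrun pnxt t _) as [[q h] f].
    destruct IH as (Hq & Hh & Hf). unfold zstep. pose proof (pnxt_le q (f h) Hq) as Hq'.
    destruct (pnxt q (f h)) as [[q' s] mv]. simpl in Hq'. split; [lia|]. split.
    + destruct mv; simpl dz; lia.
    + intros i Hi. rewrite tupd_neq by lia. apply Hf. lia.
Qed.

(** The first step merely enters the start state; this is the shift by one between row numbers and
    verifier time. *)
Lemma conf_S t : conf (S t) = zrun (nxt_of V) t (tm_start V, 0%Z, list_tape (enc_bits x ++ w)).
Proof.
  unfold conf. simpl. unfold pnxt at 2. rewrite Nat.eqb_refl. simpl dz. simpl (-1 + 1)%Z.
  replace (tupd _ _ _) with (list_tape (enc_bits x ++ w)) by (symmetry; apply tupd_same).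
  generalize (list_tape (enc_bits x ++ w)) as f. generalize 0%Z as h.
  pose proof (tm_start_ok V) as Hq. revert Hq. generalize (tm_start V) as q.
  induction t as [|t IH]; intros q Hq h f; simpl; auto.
  replace (pnxt q (f h)) with (nxt_of V q (f h)).
  - pose proof (pnxt_le q (f h) ltac:(lia)) as H. unfold pnxt in H.
    destruct (Nat.eqb_spec q (tm_Q V)); [lia|].
    destruct (nxt_of V q (f h)) as [[q' s] mv]. apply IH. exact H.
  - unfold pnxt. destruct (Nat.eqb_spec q (tm_Q V)); auto; lia.
Qed.

Lemma list_tape_length_bound i : (Z.of_nat (2 * nx + 1 + wlen) <= i)%Z \/ (i < 0)%Z ->
  list_tape (enc_bits x ++ w) i = None.
Proof.
  intros H. apply list_tape_out. rewrite length_app, length_enc_bits. lia.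
Qed.

(** The head moves at most one cell per row, so everything outside a cone around the input and
    witness is blank. Row [nrows + 1] is included because the last window of row [nrows - 1] reaches
    its first cell. *)
Lemma vc_blank r j : r <= nrows + 1 -> j < width ->
  j + r < lpad \/ lpad + 2 * nx + 2 + wlen + r <= j -> vc (r * width + j) = bl.
Proof.
  intros Hr Hj H. rewrite vc_at by auto. pose proof (conf_inv r) as HI.
  destruct (conf r) as [[q h] f]. destruct HI as (_ & Hh & Hf). unfold zcell, col.
  destruct (Z.eqb_spec (Z.of_nat j - Z.of_nat lpad - 1) h); [lia|].
  unfold bl. f_equal. rewrite Hf by lia. apply list_tape_length_bound. lia.
Qed.

(** Inside a row this is [zcell_local]. Windows starting in the last two columns straddle two rows;
    the padding makes all their cells and their result blank, in accordance with
    [local bl bl bl = bl]. *)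
Lemma vc_step p : p < nwin -> vc (p + 3 + gap0) = local (vc p) (vc (p + 1)) (vc (p + 2)).
Proof.
  intros Hp. pose proof width_pos as W0. pose proof nrows_ge as Hn.
  assert (HL : lpad = nrows + 3) by reflexivity.
  assert (HW : width = 4 * lpad + 2) by reflexivity.
  assert (Hg : gap0 = 4 * lpad) by reflexivity.
  assert (Hlocal : local bl bl bl = bl) by reflexivity.
  set (r := p / width). set (j := p mod width).
  assert (Ep : p = r * width + j) by (unfold r, j; rewrite (Nat.mul_comm _ width); apply Nat.div_mod; lia).
  assert (Hj : j < width) by (apply Nat.mod_upper_bound; lia).
  assert (Hr : r < nrows) by (apply Nat.Div0.div_lt_upper_bound; unfold nwin in Hp; lia).
  rewrite Ep at 1 2 3 4. clearbody r j.
  destruct (Nat.lt_ge_cases j (width - 2)) as [L|L].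
  - replace (r * width + j + 3 + gap0) with (S r * width + (j + 1)) by lia.
    replace (r * width + j + 1) with (r * width + (j + 1)) by lia.
    replace (r * width + j + 2) with (r * width + (j + 2)) by lia.
    rewrite !vc_at by lia. unfold conf. rewrite zrun_S, zcell_local.
    f_equal; f_equal; unfold col; lia.
  - destruct (Nat.eq_dec j (width - 2)) as [E|E].
    + replace (r * width + j + 3 + gap0) with (S r * width + (width - 1)) by lia.
      replace (r * width + j + 1) with (r * width + (width - 1)) by lia.
      replace (r * width + j + 2) with (S r * width + 0) by lia.
      rewrite !vc_blank by lia. auto.
    + replace (r * width + j + 3 + gap0) with (S (S r) * width + 0) by lia.
      replace (r * width + j + 1) with (S r * width + 0) by lia.
      replace (r * width + j + 2) with (S r * width + 1) by lia.
      rewrite !vc_blank by lia. auto.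
Qed.

Lemma vc_first p : p < width ->
  vc p = (if Nat.eqb p lpad then Some (tm_Q V) else None,
          list_tape (enc_bits x ++ w) (Z.of_nat p - Z.of_nat lpad - 1)%Z).
Proof.
  intros H. pose proof (vc_at 0 p H) as E. simpl in E. rewrite E. unfold col.
  destruct (Nat.eqb_spec p lpad), (Z.eqb_spec (Z.of_nat p - Z.of_nat lpad - 1) (-1)); auto; lia.
Qed.

Lemma vc_lpad p : p < lpad -> vc p = bl.
Proof.
  intros H. rewrite vc_first by (unfold width, gap0; lia).
  destruct (Nat.eqb_spec p lpad); [lia|]. unfold bl. f_equal. apply list_tape_out. lia.
Qed.

Lemma vc_pre : vc lpad = (Some (tm_Q V), None).
Proof.
  rewrite vc_first by (unfold width, gap0; lia). rewrite Nat.eqb_refl. f_equal.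
  apply list_tape_out. lia.
Qed.

Lemma vc_input j : j < 2 * nx + 1 -> vc (lpad + 1 + j) = bitcell (nth j (enc_bits x) false).
Proof.
  intros H. pose proof lpad_ge. rewrite vc_first by (unfold width, gap0; lia).
  destruct (Nat.eqb_spec (lpad + 1 + j) lpad); [lia|]. unfold bitcell. f_equal.
  replace (Z.of_nat (lpad + 1 + j) - Z.of_nat lpad - 1)%Z with (Z.of_nat j) by lia.
  rewrite list_tape_in by (rewrite length_app, length_enc_bits; lia).
  now rewrite app_nth1 by (rewrite length_enc_bits; lia).
Qed.

Lemma vc_guess j : j <= wlen ->
  vc (gpos j) = if Nat.ltb j (length w) then bitcell (nth j w false) else bl.
Proof.
  intros H. pose proof lpad_ge. unfold gpos. rewrite vc_first by (unfold width, gap0; lia).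
  destruct (Nat.eqb_spec (lpad + 2 * nx + 2 + j) lpad); [lia|].
  replace (Z.of_nat (lpad + 2 * nx + 2 + j) - Z.of_nat lpad - 1)%Z with (Z.of_nat (2 * nx + 1 + j)) by lia.
  destruct (Nat.ltb_spec j (length w)).
  - unfold bitcell. f_equal. rewrite list_tape_in by (rewrite length_app, length_enc_bits; lia).
    rewrite app_nth2 by (rewrite length_enc_bits; lia). rewrite length_enc_bits.
    do 2 f_equal. lia.
  - unfold bl. f_equal. apply list_tape_out. rewrite length_app, length_enc_bits. lia.
Qed.

Lemma vc_right j : j < 3 * lpad + 2 -> vc (gpos wlen + j) = bl.
Proof.
  intros H. pose proof lpad_ge. assert (HW : width = 4 * lpad + 2) by reflexivity. unfold gpos.
  destruct (Nat.lt_ge_cases (lpad + 2 * nx + 2 + wlen + j) width).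
  - change (lpad + 2 * nx + 2 + wlen + j) with (0 * width + (lpad + 2 * nx + 2 + wlen + j)).
    apply vc_blank; lia.
  - replace (lpad + 2 * nx + 2 + wlen + j)
      with (1 * width + (lpad + 2 * nx + 2 + wlen + j - width)) by lia.
    apply vc_blank; lia.
Qed.

Lemma vc_in_alph p : In (vc p) alph.
Proof.
  apply in_alph. unfold vc. pose proof (conf_inv (p / width)) as H.
  destruct (conf (p / width)) as [[q h] f]. simpl. destruct (Z.eqb _ h); tauto.
Qed.

Lemma head_position r : r < nrows -> exists j, j + 1 < width /\ j <= lpad + r /\
  let '(q, h, f) := conf r in
  vc (r * width + j) = (Some q, f h) /\ vc (r * width + j + 1) = (None, f (h + 1)%Z) /\
  forall j', j' < width -> j' <> j -> fst (vc (r * width + j')) = None.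
Proof.
  intros Hr. pose proof (conf_inv r) as HI.
  pose proof (vc_at r) as HA.
  assert (HL : lpad = nrows + 3) by reflexivity.
  assert (HW : width = 4 * lpad + 2) by reflexivity.
  destruct (conf r) as [[q h] f]. destruct HI as (_ & Hh & _).
  exists (Z.to_nat (h + Z.of_nat lpad + 1)). split; [lia|]. split; [lia|]. split; [|split].
  - rewrite HA by lia. unfold zcell, col.
    replace (Z.of_nat _ - Z.of_nat lpad - 1)%Z with h by lia. now rewrite Z.eqb_refl.
  - rewrite <- Nat.add_assoc, HA by lia. unfold zcell, col.
    replace (Z.of_nat _ - Z.of_nat lpad - 1)%Z with (h + 1)%Z by lia.
    destruct (Z.eqb_spec (h + 1) h); auto; lia.
  - intros j' Hj' Hne. rewrite HA by lia. unfold zcell, col.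
    destruct (Z.eqb_spec (Z.of_nat j' - Z.of_nat lpad - 1) h); auto; lia.
Qed.

Lemma halts_iff t : halts_with V (enc_bits x ++ w) t [true] <->
  let '(q, h, f) := conf (S t) in q = tm_halt V /\ f h = Some true /\ f (h + 1)%Z = None.
Proof.
  rewrite conf_S. unfold halts_with.
  pose proof (rep_run V t _ _ (rep_init V (enc_bits x ++ w))) as HR.
  destruct (zrun _ _ _) as [[q h] f]. rewrite (rep_output _ _ _ _ [true] HR).
  destruct HR as (-> & _). simpl length. simpl Z.of_nat. split.
  - intros (-> & H1 & H2). repeat split; auto.
    specialize (H1 0 ltac:(lia)). simpl in H1. now rewrite Z.add_0_r in H1.
  - intros (-> & H1 & H2). repeat split; auto. intros j Hj. destruct j; [|lia]. simpl.
    now rewrite Z.add_0_r.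
Qed.

Lemma halts_mono t t' : t <= t' -> halts_with V (enc_bits x ++ w) t [true] ->
  halts_with V (enc_bits x ++ w) t' [true].
Proof.
  rewrite !halts_iff, !conf_S. intros Ht H.
  replace t' with (t + (t' - t)) by lia. rewrite zrun_add.
  destruct (zrun _ t _) as [[q h] f]. destruct H as (-> & H). now rewrite zrun_nxt_of_halt.
Qed.

(** A head found behind the deadline is in a row beyond [pw (length w)]: in row [pw (length w)] it
    is at column [lpad + pw (length w)] at most, left of the trigger. From the next row on the
    accepting configuration is frozen. *)
Lemma deadline_cell r j a s : halts_with V (enc_bits x ++ w) (pw (length w)) [true] ->
  j < width -> r < nrows ->
  gpos (length w) + 3 + gap (length w) <= r * width + j ->
  vc (r * width + j) = (Some a, s) ->
  a = tm_halt V /\ s = Some true /\ snd (vc (r * width + j + 1)) = None.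
Proof.
  intros HH Hj Hr Hp Hv. pose proof lpad_ge as HL. pose proof (pw_le _ w_len) as Hw.
  assert (HW : width = 4 * lpad + 2) by reflexivity.
  destruct (head_position r Hr) as (j0 & Hj0 & Hj1 & HP).
  assert (Hr1 : pw (length w) < r).
  { unfold gap in Hp.
    destruct (Nat.lt_ge_cases (pw (length w)) r) as [|L]; auto. exfalso.
    destruct (Nat.eq_dec j j0) as [->|Ne].
    - pose proof (mul_width_le _ _ L). unfold gpos in Hp. lia.
    - destruct (conf r) as [[q h] f]. destruct HP as (_ & _ & HP).
      specialize (HP j Hj Ne). rewrite Hv in HP. discriminate. }
  apply (halts_mono _ (r - 1)) in HH; [|lia]. apply halts_iff in HH.
  replace (S (r - 1)) with r in HH by lia.
  destruct (conf r) as [[q h] f]. destruct HP as (P1 & P2 & P3).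
  destruct (Nat.eq_dec j j0) as [->|Ne].
  - rewrite P1 in Hv. rewrite P2. injection Hv as <- <-. tauto.
  - specialize (P3 j Hj Ne). rewrite Hv in P3. discriminate.
Qed.

End Run.

(** * Satisfying assignments and accepted witnesses *)

Lemma least_true (P : nat -> bool) m : P m = true ->
  exists l, l <= m /\ P l = true /\ forall j, j < l -> P j = false.
Proof.
  revert P; induction m as [|m IH]; intros P H.
  - exists 0. repeat split; auto; intros; lia.
  - destruct (P 0) eqn:E.
    + exists 0. repeat split; auto; intros; lia.
    + destruct (IH (fun j => P (S j)) H) as (l & Hl & H1 & H2). exists (S l). repeat split; auto; [lia|].
      intros [|j] Hj; auto. apply H2. lia.
Qed.

(** The witness ends at the first guess cell whose blank variable is true. The variables of the true
    run on this witness are then shown to be true one after another, and the negative checks behind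
    the deadline force acceptance. *)
Lemma tableau_sound (S : nat -> cvar -> bool) :
  (forall p g b0 b1 b2 b3, In (p, g, DClause b0 b1 b2 b3) samples -> sat S (p, g, DClause b0 b1 b2 b3)) ->
  exists w, length w <= wlen /\ halts_with V (enc_bits x ++ w) (pw (length w)) [true].
Proof.
  intros HS.
  assert (HU : forall p g a, In (p, g, unit a) samples -> S p (Some a) = true).
  { intros p g a H. apply HS in H. apply sat_clause in H. simpl in H. tauto. }
  assert (Hbl : forall j, j < 3 * lpad + 2 -> S (gpos wlen + j) (Some bl) = true).
  { intros j Hj. apply (HU _ gap0). apply in_samples. do 7 right; left. eauto. }
  destruct (least_true (fun l => S (gpos l) (Some bl)) wlen) as (l & Hl & Hl1 & Hl2).
  { rewrite <- (Nat.add_0_r (gpos wlen)). apply Hbl. lia. }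
  (* If both bits are true in a cell, [true] is chosen; if [true] is not, the guess clause leaves
     [false], since the blank is excluded before [l]. *)
  set (w := map (fun j => S (gpos j) (Some (bitcell true))) (seq 0 l)).
  assert (Lw : length w = l) by (unfold w; now rewrite length_map, length_seq).
  exists w. rewrite Lw. split; auto.
  assert (Hwl : length w <= wlen) by lia.
  assert (Hg1 : forall j, j < l -> S (gpos j) (Some (bitcell (nth j w false))) = true).
  { intros j Hj. unfold w. rewrite nth_indep with (d' := (fun j => S (gpos j) (Some (bitcell true))) 0)
      by (rewrite length_map, length_seq; auto).
    rewrite (map_nth (fun j => S (gpos j) (Some (bitcell true)))). rewrite seq_nth by auto. simpl.
    destruct (S (gpos j) (Some (bitcell true))) eqn:E; auto.
    assert (Hc : sat S (gpos j, gap0, hd DZero guess)).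
    { apply HS. apply in_samples. do 5 right; left. exists j, (hd DZero guess).
      repeat split; auto; [lia|]. simpl; auto. }
    apply sat_clause in Hc. cbn in Hc. unfold cell, sym in *. rewrite E, (Hl2 j Hj) in Hc. intuition discriminate. }
  assert (Hg2 : forall j, l <= j -> j <= wlen -> S (gpos j) (Some bl) = true).
  { intros j H1. induction H1 as [|j H1 IH]; intros H2; auto.
    assert (Hc : sat S (gpos j, gap0, hd DZero (tl guess))).
    { apply HS. apply in_samples. do 5 right; left. exists j, (hd DZero (tl guess)).
      repeat split; auto. simpl; auto. }
    apply sat_clause in Hc. cbn in Hc. unfold cell, sym in *. rewrite IH in Hc by lia.
    replace (gpos j + 1) with (gpos (Datatypes.S j)) in Hc by (unfold gpos; lia).
    intuition discriminate. }
  pose proof lpad_ge as HL. pose proof nrows_ge as HR.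
  assert (HLr : lpad = nrows + 3) by reflexivity.
  assert (HW : width = 4 * lpad + 2) by reflexivity.
  (* The base of the induction has to include [p = width], the largest cell that no window
     determines. *)
  assert (HV0 : forall p, p <= width -> S p (Some (vc w p)) = true).
  { intros p Hp. destruct (Nat.lt_ge_cases p lpad) as [H1|H1].
    { rewrite (vc_lpad w Hwl) by auto. apply (HU _ gap0). apply in_samples. do 2 right; left. eauto. }
    destruct (Nat.eq_dec p lpad) as [->|H2].
    { rewrite (vc_pre w Hwl). apply (HU _ gap0). apply in_samples. do 3 right; left. auto. }
    destruct (Nat.lt_ge_cases p (gpos 0)) as [H3|H3].
    { unfold gpos in H3. replace p with (lpad + 1 + (p - lpad - 1)) by lia.
      rewrite (vc_input w Hwl) by lia. apply (HU _ gap0). apply in_samples. do 4 right; left.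
      exists (p - lpad - 1). split; auto. lia. }
    destruct (Nat.lt_ge_cases p (gpos wlen)) as [H4|H4].
    { unfold gpos in H3, H4. replace p with (gpos (p - gpos 0)) by (unfold gpos; lia).
      rewrite (vc_guess w Hwl) by (unfold gpos; lia).
      destruct (Nat.ltb_spec (p - gpos 0) (length w)).
      - apply Hg1. lia.
      - apply Hg2; unfold gpos in *; lia. }
    replace p with (gpos wlen + (p - gpos wlen)) by lia.
    rewrite (vc_right w Hwl) by (unfold gpos in *; lia). apply Hbl. unfold gpos in *; lia. }
  assert (HV : forall p, p < ncells -> S p (Some (vc w p)) = true).
  { intros p. induction p as [p IH] using lt_wf_ind. intros Hp.
    destruct (Nat.le_gt_cases p width) as [L|L]; auto.
    set (q := p - (width + 1)). assert (Hq : q < nwin) by (unfold ncells in Hp; lia).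
    replace p with (q + 3 + gap0) by (unfold q, width in *; lia).
    rewrite (vc_step w Hwl) by auto.
    assert (Hc : sat S (q, gap0, DClause [(Some (vc w q), false)] [(Some (vc w (q + 1)), false)]
       [(Some (vc w (q + 2)), false)] [(Some (local (vc w q) (vc w (q + 1)) (vc w (q + 2))), true)])).
    { apply HS. apply in_samples. do 8 right. eexists _, _. repeat split; [exact Hq|].
      apply in_uniform. do 2 right; left. do 3 eexists. repeat split; apply (vc_in_alph w Hwl). }
    apply sat_clause in Hc. cbn in Hc. unfold cell, sym in *.
    rewrite !IH in Hc by (unfold q, width in *; lia). intuition discriminate. }
  assert (HT0 : S (gpos l + 3 + gap l) None = true).
  { assert (Hc : sat S (gpos l, gap l, trigger)).
    { apply HS. apply in_samples. do 6 right; left. eauto. }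
    apply sat_clause in Hc. cbn in Hc. unfold cell, sym in *. rewrite Hl1 in Hc. intuition discriminate. }
  assert (HT : forall p, gpos l + 3 + gap l <= p -> p <= nwin -> S p None = true).
  { intros p H1. induction H1 as [|p H1 IH]; intros H2; auto.
    assert (Hc : sat S (p, gap0, DClause [(None, false)] [(None, true)] [] [])).
    { apply HS. apply in_samples. do 8 right. eexists _, _. repeat split; [lia|].
      apply in_uniform. do 3 right; left. reflexivity. }
    apply sat_clause in Hc. cbn in Hc. unfold cell, sym in *. rewrite IH, Nat.add_1_r in Hc by lia.
    intuition discriminate. }
  apply (halts_iff w Hwl).
  pose proof (pw_le l Hl) as Hpw. pose proof (gap_le l Hl) as Hgap.
  (* This is the configuration after [pw l] steps of the verifier; its head cell and the right
     neighbour are true variables behind the deadline, so the checks apply to them. *)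
  destruct (head_position w Hwl (pw l + 1) ltac:(lia)) as (j & Hj1 & _ & HP).
  rewrite <- (Nat.add_1_r (pw l)).
  destruct (conf w (pw l + 1)) as [[q h] f]. destruct HP as (P1 & P2 & _).
  set (p := (pw l + 1) * width + j) in *.
  assert (Hpn : p + 1 < nwin).
  { pose proof (mul_width_le (pw l + 2) nrows ltac:(lia)). unfold p, nwin. lia. }
  pose proof (HT p ltac:(lia) ltac:(lia)) as Hh.
  pose proof (HV p ltac:(unfold ncells; lia)) as Hv. pose proof (vc_in_alph w Hwl p) as Ha.
  pose proof (HV (p + 1) ltac:(unfold ncells; lia)) as Hv'. pose proof (vc_in_alph w Hwl (p + 1)) as Ha'.
  rewrite P1 in Hv, Ha. rewrite P2 in Hv', Ha'.
  assert (Hnb : bad (Some q, f h) = false).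
  { destruct (bad (Some q, f h)) eqn:E; auto.
    assert (Hc : sat S (p, gap0, DClause [(None, false); (Some (Some q, f h), false)] [] [] [])).
    { apply HS. apply in_samples. do 8 right. eexists _, _. repeat split; [lia|].
      apply in_uniform. do 4 right; left. eauto. }
    apply sat_clause in Hc. cbn in Hc. unfold cell, sym in *. rewrite Hh, Hv in Hc. intuition discriminate. }
  simpl in Hnb. destruct (f h) as [[]|] eqn:Ef; try discriminate.
  destruct (Nat.eqb_spec q (tm_halt V)) as [->|]; [|discriminate]. repeat split; auto.
  destruct (f (h + 1)%Z) eqn:Ef'; auto.
  assert (Hc : sat S (p, gap0, DClause [(None, false); (Some (Some (tm_halt V), Some true), false)]
    [(Some (None, Some b), false)] [] [])).
  { apply HS. apply in_samples. do 8 right. eexists _, _. repeat split; [lia|].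
    apply in_uniform. do 5 right. exists (None, Some b). repeat split; auto. discriminate. }
  apply sat_clause in Hc. cbn in Hc. unfold cell, sym in *. rewrite Hh, Hv, Hv' in Hc. intuition discriminate.
Qed.

(** Cell variables take their values from the run on [w], and the deadline variable is true from the
    trigger of guess cell [length w] on. *)
Lemma tableau_complete w : length w <= wlen ->
  halts_with V (enc_bits x ++ w) (pw (length w)) [true] ->
  exists S : nat -> cvar -> bool, forall p g b0 b1 b2 b3,
    In (p, g, DClause b0 b1 b2 b3) samples -> sat S (p, g, DClause b0 b1 b2 b3).
Proof.
  intros Hw HH. set (T0 := gpos (length w) + 3 + gap (length w)).
  set (S := fun p (v : cvar) => match v with
    | None => Nat.leb T0 p
    | Some a => if cell_dec a (vc w p) then true else false end).
  assert (Strue : forall p a, vc w p = a -> S p (Some a) = true).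
  { intros p a <-. simpl. destruct (cell_dec _ _); congruence. }
  assert (Sfalse : forall p a, vc w p = a \/ S p (Some a) = false).
  { intros p a. simpl. destruct (cell_dec _ _); auto. }
  assert (HU : forall p g a, vc w p = a -> sat S (p, g, unit a)).
  { intros p g a E. apply sat_clause. simpl fold_right. left; left. apply Strue, E. }
  assert (HLr : lpad = nrows + 3) by reflexivity.
  assert (HW : width = 4 * lpad + 2) by reflexivity.
  (* Abstracting the clause under an equation lets the case analysis run over arbitrary descriptions
     and discard those that are not clauses. *)
  exists S. intros p g b0 b1 b2 b3. generalize (eq_refl (DClause b0 b1 b2 b3)).
  generalize (DClause b0 b1 b2 b3) at 1 3 4. intros d0 Ed H. apply in_samples in H.
  destruct H as [E|[E|[(p' & Hp & E)|[E|[(j & Hj & E)|[(l & d & Hl & Hd & E)|[(l & Hl & E)|[(j & Hj & E)|(p' & d & Hp & Hd & E)]]]]]]]];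
    injection E as -> -> ->; try discriminate.
  - apply HU, (vc_lpad w Hw); auto.
  - apply HU, (vc_pre w Hw).
  - apply HU, (vc_input w Hw); auto.
  - destruct Hd as [<-|[<-|[]]]; apply sat_clause; cbn [fold_right fst snd].
    + left. pose proof (vc_guess w Hw l ltac:(lia)) as E.
      destruct (Nat.ltb l (length w)).
      * destruct (nth l w false); [right; left|right; right; left]; apply Strue, E.
      * left. apply Strue, E.
    + destruct (Sfalse (gpos l) bl) as [E|E]; [|auto]. right; left; left. apply Strue.
      replace (gpos l + 1) with (gpos (l + 1)) by (unfold gpos; lia).
      rewrite (vc_guess w Hw) in E |- * by lia.
      destruct (Nat.ltb_spec l (length w)); [discriminate|].
      destruct (Nat.ltb_spec (l + 1) (length w)); auto; lia.
  - apply sat_clause. cbn [fold_right fst snd]. destruct (Sfalse (gpos l) bl) as [E|E]; [|auto].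
    do 3 right; left. apply Nat.leb_le.
    rewrite (vc_guess w Hw) in E by auto. destruct (Nat.ltb_spec l (length w)) as [|L]; [discriminate|].
    (* Every blank guess cell fires its trigger, but those further right do so no earlier than [T0],
       because [pw] is monotone. *)
    assert (Hpl : pw (length w) <= pw l).
    { unfold pw. apply Nat.mul_le_mono_l, Nat.pow_le_mono_l. lia. }
    unfold T0, gap. pose proof (mul_width_le _ _ Hpl). unfold gpos. lia.
  - apply HU, (vc_right w Hw); auto.
  - apply in_uniform in Hd.
    destruct Hd as [(far & l & Hl & ->)|[(far & v & Hv & ->)|[(a & b & e & Ha & Hb & He & ->)|[->|[(a & Ha & Hb & ->)|(b & Ha & Hb & ->)]]]]];
      try discriminate; apply sat_clause; cbn [fold_right fst snd].
    + destruct (Sfalse p' a) as [<-|E]; [|auto].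
      destruct (Sfalse (p' + 1) b) as [<-|E]; [|auto].
      destruct (Sfalse (p' + 2) e) as [<-|E]; [|auto].
      do 3 right; left. apply Strue. apply (vc_step w Hw); auto.
    + destruct (S p' None) eqn:E; [|auto]. right; left; left. simpl in *.
      apply Nat.leb_le in E. apply Nat.leb_le. lia.
    + destruct (S p' None) eqn:E; [|auto]. left; right; left.
      destruct (Sfalse p' a) as [Ev|]; auto. exfalso.
      apply Nat.leb_le in E. destruct a as [[q|] s]; [|discriminate].
      set (r := p' / width). set (j := p' mod width).
      assert (Ep : p' = r * width + j)
        by (unfold r, j; rewrite (Nat.mul_comm _ width); apply Nat.div_mod; lia).
      assert (Hj : j < width) by (apply Nat.mod_upper_bound; lia).
      assert (Hr : r < nrows) by (apply Nat.Div0.div_lt_upper_bound; unfold nwin in Hp; lia).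
      rewrite Ep in Ev, E. destruct (deadline_cell w Hw _ _ _ _ HH Hj Hr E Ev) as (-> & -> & _).
      simpl in Hb. rewrite Nat.eqb_refl in Hb. discriminate.
    + destruct (S p' None) eqn:E; [|auto].
      destruct (Sfalse p' (Some (tm_halt V), Some true)) as [Ev|]; auto. right; left; left.
      destruct (Sfalse (p' + 1) b) as [Ev'|]; auto. exfalso.
      apply Nat.leb_le in E.
      set (r := p' / width). set (j := p' mod width).
      assert (Ep : p' = r * width + j)
        by (unfold r, j; rewrite (Nat.mul_comm _ width); apply Nat.div_mod; lia).
      assert (Hj : j < width) by (apply Nat.mod_upper_bound; lia).
      assert (Hr : r < nrows) by (apply Nat.Div0.div_lt_upper_bound; unfold nwin in Hp; lia).
      rewrite Ep in Ev, E, Ev'. destruct (deadline_cell w Hw _ _ _ _ HH Hj Hr E Ev) as (_ & _ & Hn).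
      rewrite Ev' in Hn. auto.
Qed.

Lemma tableau_yes : yes_instance (sinst cvs ncells samples) <->
  exists w, length w <= c * (nx + 1) ^ k /\
    exists t, t <= c * (nx + length w + 1) ^ k /\ halts_with V (enc_bits x ++ w) t [true].
Proof.
  assert (E : forall l, pw l = c * (nx + l + 1) ^ k) by (intros l; unfold pw; do 2 f_equal; lia).
  rewrite samples_yes. split.
  - intros (S & HS). destruct (tableau_sound S HS) as (w & Hw & H). exists w. split; auto.
    exists (pw (length w)). rewrite E at 1. auto.
  - intros (w & Hw & t & Ht & H). apply (tableau_complete w Hw).
    apply (halts_mono w Hw t); auto. now rewrite E.
Qed.

End Tableau.

(** * Derived program constructs *)

(** An upper bound in place of the exact cost, so that estimates can be rounded up while programs
    are composed. *)
Definition Ex (s : stmt) (st st' : store) (t : nat) : Prop :=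
  exists t', t' <= t /\ exec s st st' t'.

Lemma Ex_conv s st st1 st2 t1 t2 : Ex s st st1 t1 -> st1 = st2 -> t1 <= t2 -> Ex s st st2 t2.
Proof. intros (t & Ht & H) <- Hle. exists t. split; auto; lia. Qed.

Lemma Ex_skip st : Ex Skip st st 1.
Proof. exists 1. split; auto. constructor. Qed.

Lemma Ex_push r b st : Ex (Push r b) st (upd st r (b :: st r)) 1.
Proof. exists 1. split; auto. constructor. Qed.

Lemma Ex_pop r st : Ex (Pop r) st (upd st r (tl (st r))) 1.
Proof. exists 1. split; auto. constructor. Qed.

Lemma Ex_seq s1 s2 st0 st1 st2 t1 t2 :
  Ex s1 st0 st1 t1 -> Ex s2 st1 st2 t2 -> Ex (Seq s1 s2) st0 st2 (t1 + t2 + 1).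
Proof.
  intros (a & Ha & H1) (b & Hb & H2). exists (1 + a + b). split; [lia|]. econstructor; eauto.
Qed.

Lemma Ex_if r a b c st st' t :
  Ex (match st r with nil => a | false :: _ => b | true :: _ => c end) st st' t ->
  Ex (If r a b c) st st' (t + 1).
Proof. intros (u & Hu & H). exists (1 + u). split; [lia|]. now constructor. Qed.

Lemma Ex_loop_nil r s st : st r = nil -> Ex (Loop r s) st st 1.
Proof. intros H. exists 1. split; auto. now constructor. Qed.

Lemma Ex_loop_cons r s st st1 st2 t1 t2 :
  st r <> nil -> Ex s st st1 t1 -> Ex (Loop r s) (upd st1 r (tl (st1 r))) st2 t2 ->
  Ex (Loop r s) st st2 (t1 + t2 + 2).
Proof.
  intros Hr (a & Ha & H1) (b & Hb & H2). exists (2 + a + b). split; [lia|].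
  econstructor; eauto.
Qed.

(** Here [st j] is the store before round [j] and [st' j] the one between its body and its pop. *)
Lemma Ex_loop r s (st st' : nat -> store) n t :
  (forall j, j < n -> st j r <> nil /\ Ex s (st j) (st' j) t /\
     upd (st' j) r (tl (st' j r)) = st (S j)) ->
  st n r = nil -> Ex (Loop r s) (st 0) (st n) (n * (t + 2) + 1).
Proof.
  revert st st'; induction n as [|n IH]; intros st st' H Hn.
  - now apply Ex_loop_nil.
  - destruct (H 0 ltac:(lia)) as (H1 & H2 & H3).
    eapply Ex_conv.
    + eapply Ex_loop_cons; [exact H1|exact H2|]. rewrite H3.
      apply (IH (fun j => st (S j)) (fun j => st' (S j))); auto.
      intros j Hj. apply H. lia.
    + reflexivity.
    + lia.
Qed.

Lemma upd_eq st r v r' : rn r = rn r' -> upd st r v r' = v.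
Proof. intros H. unfold upd. now rewrite H, Nat.eqb_refl. Qed.

Lemma upd_neq st r v r' : rn r <> rn r' -> upd st r v r' = st r'.
Proof. intros H. unfold upd. destruct (Nat.eqb_spec (rn r) (rn r')); congruence. Qed.

Lemma upd_same st r v : v = st r -> upd st r v = st.
Proof.
  intros ->. extensionality r'. unfold upd. destruct (Nat.eqb_spec (rn r) (rn r')) as [E|]; auto.
  now rewrite (rn_inj _ _ E).
Qed.

Lemma upd_upd st r v v' : upd (upd st r v) r v' = upd st r v'.
Proof. extensionality r'. unfold upd. destruct (Nat.eqb _ _); auto. Qed.

Ltac upd_cases :=
  let z := fresh "z" in
  extensionality z; unfold upd;
  repeat match goal with |- context [Nat.eqb ?a ?b] => destruct (Nat.eqb_spec a b) end;
  repeat match goal with H : rn ?a = rn z |- _ =>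
    apply rn_inj in H; subst z end; auto; try congruence; try lia.

Ltac st_eq :=
  let z := fresh "z" in
  extensionality z; destruct z; unfold upd; cbn [rn Nat.eqb]; try reflexivity; auto.

Definition ones (n : nat) : list bool := repeat true n.

Lemma ones_add a b : ones a ++ ones b = ones (a + b).
Proof. unfold ones. now rewrite repeat_app. Qed.

Lemma ones_S n : ones (S n) = true :: ones n.
Proof. reflexivity. Qed.

Lemma ones_nonnil n : 0 < n -> ones n <> nil.
Proof. destruct n; [lia|discriminate]. Qed.

Lemma tl_ones n : tl (ones n) = ones (n - 1).
Proof. destruct n; simpl; auto. now rewrite Nat.sub_0_r. Qed.

(* Repeats [body] as often as the length of [r], which is rebuilt from [t] afterwards. *)
Definition For (r t : reg) (body : stmt) : stmt :=
  Seq (Loop r (Seq body (Push t true))) (Loop t (Push r true)).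

(** The family [st] describes the stores with the counter intact. During the loop the counter is
    split into remaining rounds in [r] and finished rounds in [t], which is what the hypothesis on
    [body] writes over [st j]. *)
Lemma Ex_for r t body (st : nat -> store) n tb : rn r <> rn t ->
  (forall j, j <= n -> st j r = ones n /\ st j t = nil) ->
  (forall j, j < n -> Ex body (upd (upd (st j) r (ones (n - j))) t (ones j))
                              (upd (upd (st (j + 1)) r (ones (n - j))) t (ones j)) tb) ->
  Ex (For r t body) (st 0) (st n) (n * (tb + 7) + 3).
Proof.
  intros Hrt Hst Hb. unfold For.
  set (L := fun j => upd (upd (st j) r (ones (n - j))) t (ones j)).
  set (B := fun j => upd (upd (st n) r (ones j)) t (ones (n - j))).
  assert (E0 : L 0 = st 0).
  { unfold L. destruct (Hst 0 ltac:(lia)) as [H1 H2]. rewrite Nat.sub_0_r.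
    rewrite upd_same; [rewrite upd_same|]; auto. rewrite upd_neq by auto. now rewrite H2. }
  assert (E1 : L n = B 0) by (unfold L, B; now rewrite Nat.sub_diag, Nat.sub_0_r).
  assert (E2 : B n = st n).
  { unfold B. destruct (Hst n ltac:(lia)) as [H1 H2]. rewrite Nat.sub_diag.
    rewrite upd_same; [rewrite upd_same|]; auto. rewrite upd_neq by auto. now rewrite H2. }
  eapply Ex_conv.
  - eapply Ex_seq.
    + rewrite <- E0.
      apply (Ex_loop r _ L (fun j => upd (upd (st (j + 1)) r (ones (n - j))) t (ones (S j))) n).
      * intros j Hj. split; [|split].
        -- unfold L. rewrite upd_neq by auto. rewrite upd_eq by auto. apply ones_nonnil; lia.
        -- eapply Ex_seq; [apply Hb; auto|].
           eapply Ex_conv; [apply Ex_push| |apply le_n]. rewrite upd_upd. f_equal.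
           rewrite upd_eq by auto. reflexivity.
        -- unfold L. rewrite upd_neq by auto. rewrite upd_eq by auto. rewrite tl_ones.
           replace (n - j - 1) with (n - S j) by lia. rewrite Nat.add_1_r. upd_cases.
      * unfold L. rewrite upd_neq by auto. rewrite upd_eq by auto. now rewrite Nat.sub_diag.
    + rewrite E1.
      apply (Ex_loop t _ B (fun j => upd (upd (st n) r (ones (S j))) t (ones (n - j))) n).
      * intros j Hj. split; [|split].
        -- unfold B. rewrite upd_eq by auto. apply ones_nonnil; lia.
        -- eapply Ex_conv; [apply Ex_push| |apply le_n]. unfold B. rewrite upd_neq by auto.
           rewrite upd_eq by auto. rewrite <- ones_S. upd_cases.
        -- unfold B. rewrite upd_eq by auto. rewrite tl_ones, upd_upd.
           now replace (n - j - 1) with (n - S j) by lia.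
      * unfold B. rewrite upd_eq by auto. now rewrite Nat.sub_diag.
  - exact E2.
  - lia.
Qed.

Lemma Ex_for_from r t body (st : nat -> store) n tb st0 st1 tt : rn r <> rn t ->
  st0 = st 0 -> st n = st1 -> n * (tb + 7) + 3 <= tt ->
  (forall j, j <= n -> st j r = ones n /\ st j t = nil) ->
  (forall j, j < n -> Ex body (upd (upd (st j) r (ones (n - j))) t (ones j))
                              (upd (upd (st (j + 1)) r (ones (n - j))) t (ones j)) tb) ->
  Ex (For r t body) st0 st1 tt.
Proof. intros H -> E Ht H1 H2. eapply Ex_conv; [apply Ex_for; eauto|auto|auto]. Qed.

Lemma Ex_add r t d st n : rn r <> rn t -> rn r <> rn d -> rn t <> rn d ->
  st r = ones n -> st t = nil ->
  Ex (For r t (Push d true)) st (upd st d (ones n ++ st d)) (n * 8 + 3).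
Proof.
  intros H1 H2 H3 Hr Ht.
  apply (Ex_for_from r t _ (fun j => upd st d (ones j ++ st d)) n 1); auto.
  - now rewrite upd_same.
  - intros j Hj. rewrite !upd_neq by auto. auto.
  - intros j Hj. eapply Ex_conv; [apply Ex_push| |apply le_n].
    rewrite !(upd_neq _ _ _ d) by auto. rewrite upd_eq by auto.
    rewrite app_comm_cons, <- ones_S, Nat.add_1_r. upd_cases.
Qed.

Lemma Ex_loop_from r s (st st' : nat -> store) n t st0 st1 tt :
  st0 = st 0 -> st n = st1 -> n * (t + 2) + 1 <= tt ->
  (forall j, j < n -> st j r <> nil /\ Ex s (st j) (st' j) t /\
     upd (st' j) r (tl (st' j r)) = st (S j)) ->
  st n r = nil -> Ex (Loop r s) st0 st1 tt.
Proof. intros -> E Ht H1 H2. eapply Ex_conv; [apply (Ex_loop r s st st'); eauto|auto|auto]. Qed.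

Fixpoint ntimes (n : nat) (s : stmt) : stmt :=
  match n with 0 => Skip | S n' => Seq s (ntimes n' s) end.

Lemma Ex_ntimes s (st : nat -> store) n t :
  (forall j, j < n -> Ex s (st j) (st (S j)) t) -> Ex (ntimes n s) (st 0) (st n) (n * (t + 1) + 1).
Proof.
  revert st; induction n as [|n IH]; intros st H; simpl ntimes.
  - apply Ex_skip.
  - eapply Ex_conv.
    + eapply Ex_seq; [apply H; lia|].
      apply (IH (fun j => st (S j))). intros j Hj. apply H. lia.
    + reflexivity.
    + lia.
Qed.

Lemma Ex_pushes r n st : Ex (ntimes n (Push r true)) st (upd st r (ones n ++ st r)) (n * 2 + 1).
Proof.
  eapply Ex_conv.
  - pose proof (Ex_ntimes (Push r true) (fun j => upd st r (ones j ++ st r)) n 1) as H.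
    cbv beta in H. rewrite upd_same in H by reflexivity. apply H.
    intros j Hj. eapply Ex_conv; [apply Ex_push| |apply le_n].
    rewrite upd_upd, upd_eq by auto. reflexivity.
  - reflexivity.
  - lia.
Qed.

Lemma tl_skipn {A} j (l : list A) : tl (skipn j l) = skipn (S j) l.
Proof.
  revert l; induction j as [|j IH]; intros [|a l]; auto. simpl skipn. rewrite IH. reflexivity.
Qed.

Lemma Ex_pops r n st : Ex (ntimes n (Pop r)) st (upd st r (skipn n (st r))) (n * 2 + 1).
Proof.
  eapply Ex_conv.
  - pose proof (Ex_ntimes (Pop r) (fun j => upd st r (skipn j (st r))) n 1) as H.
    cbv beta in H. rewrite upd_same in H by reflexivity. apply H.
    intros j Hj. eapply Ex_conv; [apply Ex_pop| |apply le_n].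
    rewrite upd_upd, upd_eq by auto. f_equal.
    apply tl_skipn.
  - reflexivity.
  - lia.
Qed.

Lemma skipn_ones a b : skipn a (ones b) = ones (b - a).
Proof. revert b; induction a as [|a IH]; intros [|b]; simpl; auto. Qed.

Lemma Ex_clear r st : Ex (Loop r Skip) st (upd st r nil) (length (st r) * 3 + 1).
Proof.
  eapply Ex_loop_from with (st := fun j => upd st r (skipn j (st r)))
    (st' := fun j => upd st r (skipn j (st r))) (n := length (st r)) (t := 1).
  - rewrite upd_same; auto.
  - now rewrite skipn_all.
  - lia.
  - intros j Hj. rewrite upd_eq by auto. split; [|split].
    + intros E. apply (f_equal (@length bool)) in E. rewrite length_skipn in E. simpl in E. lia.
    + apply Ex_skip.
    + rewrite upd_upd. f_equal. apply tl_skipn.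
  - rewrite upd_eq by auto. now rewrite skipn_all.
Qed.

Lemma Ex_transfer r d st n : rn r <> rn d -> st r = ones n ->
  Ex (Loop r (Push d true)) st (upd (upd st r nil) d (ones n ++ st d)) (n * 3 + 1).
Proof.
  intros Hrd Hr.
  eapply Ex_loop_from with (st := fun j => upd (upd st r (ones (n - j))) d (ones j ++ st d))
    (st' := fun j => upd (upd st r (ones (n - j))) d (ones (S j) ++ st d)) (n := n) (t := 1).
  - rewrite Nat.sub_0_r, <- Hr. simpl app. rewrite upd_same; [rewrite upd_same|]; auto.
    now rewrite upd_neq.
  - now rewrite Nat.sub_diag.
  - lia.
  - intros j Hj. split; [|split].
    + rewrite upd_neq by auto. rewrite upd_eq by auto. apply ones_nonnil. lia.
    + eapply Ex_conv; [apply Ex_push| |apply le_n]. rewrite upd_upd, upd_eq by auto. reflexivity.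
    + rewrite upd_neq by auto. rewrite upd_eq by auto. rewrite tl_ones.
      replace (n - j - 1) with (n - S j) by lia. upd_cases.
  - rewrite upd_neq by auto. rewrite upd_eq by auto. now rewrite Nat.sub_diag.
Qed.

Definition Move (r d : reg) : stmt := Loop r (If r Skip (Push d false) (Push d true)).

Lemma Ex_move r d l st : rn r <> rn d -> st r = l ->
  Ex (Move r d) st (upd (upd st r nil) d (rev l ++ st d)) (length l * 4 + 1).
Proof.
  intros Hrd. revert st. induction l as [|b l IH]; intros st Hr.
  - eapply Ex_conv; [apply Ex_loop_nil; auto| |simpl; lia]. simpl.
    rewrite upd_same; [rewrite upd_same|]; auto. now rewrite upd_neq.
  - eapply Ex_conv.
    + eapply Ex_loop_cons.
      * rewrite Hr. discriminate.
      * apply Ex_if. rewrite Hr.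
        assert (H : Ex (if b then Push d true else Push d false) st (upd st d (b :: st d)) 1)
          by (destruct b; apply Ex_push).
        destruct b; exact H.
      * apply IH. rewrite upd_eq by auto. rewrite upd_neq by auto. now rewrite Hr.
    + rewrite (upd_neq (upd st d (b :: st d)) r _ d) by auto. rewrite (upd_eq st d _ d) by auto.
      simpl rev. rewrite <- app_assoc. simpl. upd_cases.
    + simpl length. lia.
Qed.

Definition emit (l : list bool) : stmt := fold_right (fun b s => Seq (Push ROut b) s) Skip l.

Definition outs (st : store) (l : list bool) : store := upd st ROut (rev l ++ st ROut).

Lemma outs_app st a b : outs (outs st a) b = outs st (a ++ b).
Proof.
  unfold outs. rewrite upd_upd, upd_eq by auto. now rewrite rev_app_distr, app_assoc.
Qed.

Lemma outs_nil st : outs st nil = st.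
Proof. unfold outs. now rewrite upd_same. Qed.

Lemma Ex_emit l st : Ex (emit l) st (outs st l) (length l * 2 + 1).
Proof.
  revert st. induction l as [|b l IH]; intros st; simpl emit.
  - rewrite outs_nil. apply Ex_skip.
  - eapply Ex_conv.
    + eapply Ex_seq; [apply Ex_push|apply IH].
    + change (upd st ROut (b :: st ROut)) with (outs st [b]). now rewrite outs_app.
    + simpl length. lia.
Qed.

(** * Binary increment *)

Fixpoint addc (cy : bool) (l : list bool) : list bool * bool :=
  match l with
  | nil => (nil, cy)
  | b :: l' => let (o, cy') := addc (andb cy b) l' in (xorb b cy :: o, cy')
  end.

Definition incl_bits (l : list bool) : list bool :=
  let (o, cy) := addc true l in if cy then o ++ [true] else o.

Lemma addc_false l : addc false l = (l, false).
Proof. induction l as [|b l IH]; simpl; auto. rewrite IH. now destruct b. Qed.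

Lemma incl_pos_bits p : incl_bits (pos_bits p) = pos_bits (Pos.succ p).
Proof.
  unfold incl_bits. induction p as [p IH|p IH|]; simpl; auto.
  - destruct (addc true (pos_bits p)) as [o cy]. rewrite <- IH. now destruct cy.
  - now rewrite addc_false.
Qed.

Definition nbits (n : nat) : list bool :=
  match N.of_nat n with N0 => nil | Npos p => pos_bits p end.

Lemma nbits_S n : nbits (S n) = incl_bits (nbits n).
Proof.
  unfold nbits. rewrite Nat2N.inj_succ. destruct (N.of_nat n) as [|p]; simpl; auto.
  now rewrite incl_pos_bits.
Qed.

Lemma length_addc cy l : length (fst (addc cy l)) = length l.
Proof.
  revert cy; induction l as [|b l IH]; intros cy; simpl; auto.
  specialize (IH (andb cy b)). destruct (addc (andb cy b) l). simpl in *. lia.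
Qed.

(** This crude bound suffices: the numbers counted are themselves polynomial in the input length. *)
Lemma length_nbits n : length (nbits n) <= n.
Proof.
  induction n as [|n IH]; auto. rewrite nbits_S. unfold incl_bits.
  pose proof (length_addc true (nbits n)) as H. destruct (addc true (nbits n)) as [o cy].
  simpl in H. destruct cy; rewrite ?length_app; simpl; lia.
Qed.

(* [RA] holds the carry. *)
Definition carry_loop : stmt :=
  Loop RBin (If RBin Skip
    (If RA (Push RT2 false) Skip (Seq (Pop RA) (Push RT2 true)))
    (If RA (Push RT2 true) Skip (Push RT2 false))).

(** The sum bits pile up on [RT2] with the most significant one on top, so a final carry is pushed
    there, and [Move] restores the order with the least significant bit on top. *)
Definition inc : stmt :=
  Seq (Push RA true) (Seq carry_loop
    (Seq (If RA Skip Skip (Seq (Pop RA) (Push RT2 true))) (Move RT2 RBin))).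

Definition flag (b : bool) : list bool := if b then [true] else nil.

Lemma Ex_carry_loop l cy acc st : st RBin = l -> st RA = flag cy -> st RT2 = acc ->
  Ex carry_loop st
    (upd (upd (upd st RBin nil) RA (flag (snd (addc cy l)))) RT2 (rev (fst (addc cy l)) ++ acc))
    (length l * 8 + 1).
Proof.
  revert cy acc st. induction l as [|b l IH]; intros cy acc st H1 H2 H3.
  - eapply Ex_conv; [apply Ex_loop_nil; auto| |simpl; lia]. simpl. st_eq.
  - set (st1 := upd (upd st RA (flag (andb cy b))) RT2 (xorb b cy :: acc)).
    assert (HB : Ex (If RBin Skip
       (If RA (Push RT2 false) Skip (Seq (Pop RA) (Push RT2 true)))
       (If RA (Push RT2 true) Skip (Push RT2 false))) st st1 5).
    { apply (Ex_if _ _ _ _ _ _ 4). rewrite H1.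
      assert (HF : forall s, Ex (Push RT2 s) st (upd st RT2 (s :: acc)) 1)
        by (intros; rewrite <- H3; apply Ex_push).
      destruct b; apply (Ex_if _ _ _ _ _ _ 3); rewrite H2; destruct cy; simpl flag.
      - eapply Ex_conv; [apply HF| |lia]. unfold st1. st_eq.
      - eapply Ex_conv; [apply HF| |lia]. unfold st1. st_eq.
      - eapply Ex_conv; [eapply Ex_seq; [apply Ex_pop|apply Ex_push]| |lia].
        unfold st1. st_eq; simpl; rewrite ?H2, ?H3; auto.
      - eapply Ex_conv; [apply HF| |lia]. unfold st1. st_eq. }
    eapply Ex_conv.
    + eapply Ex_loop_cons; [rewrite H1; discriminate|exact HB|].
      apply (IH (andb cy b) (xorb b cy :: acc)); unfold st1, upd; simpl; auto.
      now rewrite H1.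
    + simpl addc. destruct (addc (andb cy b) l) as [o cy']. simpl. rewrite <- app_assoc.
      unfold st1. st_eq.
    + simpl length. lia.
Qed.

Lemma Ex_inc l st : st RBin = l -> st RA = nil -> st RT2 = nil ->
  Ex inc st (upd st RBin (incl_bits l)) (length l * 12 + 20).
Proof.
  intros H1 H2 H3. unfold inc.
  pose proof (length_addc true l) as HL. unfold incl_bits.
  assert (HC : Ex carry_loop (upd st RA [true])
    (upd (upd (upd st RBin nil) RA (flag (snd (addc true l)))) RT2 (rev (fst (addc true l))))
    (length l * 8 + 1)).
  { eapply Ex_conv; [apply (Ex_carry_loop l true nil); unfold upd; simpl; auto| |auto].
    rewrite app_nil_r. st_eq. }
  destruct (addc true l) as [o cy]. simpl in HL, HC.
  set (res := if cy then o ++ [true] else o).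
  assert (HI : Ex (If RA Skip Skip (Seq (Pop RA) (Push RT2 true)))
    (upd (upd (upd st RBin nil) RA (flag cy)) RT2 (rev o))
    (upd (upd st RBin nil) RT2 (rev res)) 4).
  { unfold res. destruct cy.
    - eapply (Ex_conv _ _ _ _ (3 + 1)); [apply Ex_if; unfold upd at 1; simpl; eapply (Ex_seq _ _ _ _ _ 1 1); [apply Ex_pop|apply Ex_push]| |auto].
      rewrite rev_app_distr. simpl. st_eq.
    - eapply (Ex_conv _ _ _ _ (1 + 1)); [apply Ex_if; unfold upd at 1; simpl; apply Ex_skip| |auto]. st_eq. }
  assert (HR : length res <= length l + 1).
  { unfold res. destruct cy; rewrite ?length_app; simpl; lia. }
  eapply Ex_conv.
  - eapply Ex_seq.
    { eapply Ex_conv; [apply Ex_push|rewrite H2; reflexivity|apply le_n]. }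
    eapply Ex_seq; [exact HC|]. eapply Ex_seq; [exact HI|].
    apply Ex_move with (l := rev res); [discriminate|]. reflexivity.
  - rewrite rev_involutive. unfold upd at 1. simpl rn. cbn [Nat.eqb].
    unfold upd at 6. simpl. rewrite app_nil_r. st_eq.
  - rewrite length_rev. lia.
Qed.

(** * Powers in unary *)

Ltac rd := repeat ((rewrite upd_eq by reflexivity) || (rewrite upd_neq by discriminate)).

Definition mulstep : stmt :=
  Seq (Loop RA (For RS RT1 (Push RB true))) (Loop RB (Push RA true)).

(** Both [c] and [k] are constants of the verifier, so these repetitions are unrolled in the program
    text; only the base in [RS] depends on the input. *)
Definition powc (c k : nat) : stmt := Seq (ntimes c (Push RA true)) (ntimes k mulstep).

Lemma Ex_mulstep st a s : st RA = ones a -> st RS = ones s -> st RB = nil -> st RT1 = nil ->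
  Ex mulstep st (upd st RA (ones (a * s))) (a * (s * 11 + 5) + 3).
Proof.
  intros H1 H2 H3 H4. unfold mulstep. eapply Ex_conv.
  - eapply Ex_seq.
    + eapply Ex_loop_from with (st := fun j => upd (upd st RA (ones (a - j))) RB (ones (j * s)))
        (st' := fun j => upd (upd st RA (ones (a - j))) RB (ones (S j * s))) (n := a) (t := s * 8 + 3).
      * rewrite Nat.sub_0_r. simpl. st_eq.
      * reflexivity.
      * apply le_n.
      * intros j Hj. split; [|split].
        -- unfold upd; simpl. apply ones_nonnil. lia.
        -- eapply Ex_conv; [apply (Ex_add _ _ _ _ s); try discriminate; unfold upd; simpl; auto| |apply le_n].
           rd. rewrite ones_add. st_eq.
        -- rd. rewrite tl_ones. replace (a - j - 1) with (a - S j) by lia. st_eq.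
      * unfold upd; simpl. now rewrite Nat.sub_diag.
    + apply (Ex_transfer _ _ _ (a * s)); [discriminate|reflexivity].
  - rd. rewrite Nat.sub_diag, app_nil_r. st_eq.
  - lia.
Qed.

Lemma Ex_powc c k st s : 1 <= s -> st RA = nil -> st RS = ones s -> st RB = nil -> st RT1 = nil ->
  Ex (powc c k) st (upd st RA (ones (c * s ^ k)))
    (c * 2 + k * (c * s ^ k * (s * 11 + 5) + 4) + 3).
Proof.
  intros Hs H1 H2 H3 H4. unfold powc. eapply Ex_conv.
  - eapply Ex_seq; [apply Ex_pushes|]. rewrite H1, app_nil_r.
    pose proof (Ex_ntimes mulstep (fun j => upd st RA (ones (c * s ^ j))) k
      (c * s ^ k * (s * 11 + 5) + 3)) as HR. cbv beta in HR.
    rewrite Nat.pow_0_r, Nat.mul_1_r in HR. apply HR. intros j Hj.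
    eapply Ex_conv.
    + apply (Ex_mulstep _ (c * s ^ j) s); auto.
    + rewrite upd_upd. do 2 f_equal. simpl. lia.
    + apply Nat.add_le_mono_r, Nat.mul_le_mono_r, Nat.mul_le_mono_l, Nat.pow_le_mono_r; lia.
  - reflexivity.
  - lia.
Qed.

(** * Emitting a sample *)

(** The leading [true] is the continuation mark of [enc_list]. *)
Definition ebit (b : bool) : list bool := true :: enc_Q (b2q b).

Lemma length_ebit b : length (ebit b) <= 20.
Proof. destruct b; apply Nat.leb_le; reflexivity. Qed.

Section Emission.
Variable cvs : list cvar.

Definition ecode (L : list lit) : list bool := flat_map (fun l => ebit (mem l L)) (lits cvs).

Definition zcode : list bool := ecode nil.

Definition clen : nat := 20 * length (lits cvs).

Lemma length_ecode L : length (ecode L) <= clen.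
Proof.
  unfold ecode, clen. induction (lits cvs) as [|l ls IH]; [apply Nat.le_0_l|].
  cbn [flat_map]. rewrite length_app. pose proof (length_ebit (mem l L)).
  change (length (l :: ls)) with (S (length ls)). lia.
Qed.

Definition esample (N : nat) (s : sample) : list bool :=
  true :: enc_list enc_Q (map (fun v => b2q (edge s v)) (verts cvs N)).

Lemma flat_map_map {A B C} (f : A -> B) (g : B -> list C) l :
  flat_map g (map f l) = flat_map (fun a => g (f a)) l.
Proof. induction l; simpl; congruence. Qed.

Lemma flat_map_flat_map {A B C} (f : A -> list B) (g : B -> list C) l :
  flat_map g (flat_map f l) = flat_map (fun a => flat_map g (f a)) l.
Proof. induction l; simpl; auto. now rewrite flat_map_app, IHl. Qed.

Definition zeros (q : nat) : list bool := concat (repeat zcode q).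

Lemma zeros_S q : zeros (S q) = zeros q ++ zcode.
Proof.
  unfold zeros. replace (S q) with (q + 1) by lia. rewrite repeat_app, concat_app. simpl.
  now rewrite app_nil_r.
Qed.

Lemma zeros_blks s a q : (forall p', a <= p' -> p' < a + q -> blks s p' = nil) ->
  flat_map (fun p' => ecode (blks s p')) (seq a q) = zeros q.
Proof.
  unfold zeros. revert a; induction q as [|q IH]; intros a H; simpl; auto.
  rewrite H by lia. f_equal. apply IH. intros; apply H; lia.
Qed.

(** Outside its four blocks a sample is zero in every cell, so its code consists of runs of the
    constant word [zcode] around finitely many words fixed by [d]. *)
Lemma esample_eq N p g d : p + g + 4 <= N ->
  esample N (p, g, d) =
  true :: ebit (has_false d) ++ zeros p ++ (ecode (blk d 0) ++ ecode (blk d 1) ++ ecode (blk d 2)) ++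
  zeros g ++ ecode (blk d 3) ++ zeros (N - p - g - 4) ++ [false].
Proof.
  intros H. unfold esample, enc_list. f_equal.
  rewrite flat_map_map. unfold verts. cbn [flat_map].
  change (true :: enc_Q (b2q (edge (p, g, d) None))) with (ebit (has_false d)).
  rewrite <- app_assoc. f_equal.
  rewrite flat_map_flat_map.
  assert (E : forall q, flat_map (fun a => true :: enc_Q (b2q (edge (p, g, d) a)))
     (map (fun l => Some (q, l)) (lits cvs)) = ecode (blks (p, g, d) q)).
  { intros q. rewrite flat_map_map. reflexivity. }
  rewrite (flat_map_ext _ _ E).
  replace N with (p + (3 + (g + (1 + (N - p - g - 4))))) at 1 by lia.
  rewrite !seq_app, !flat_map_app. rewrite Nat.add_0_l.
  rewrite (zeros_blks _ 0 p), (zeros_blks _ (p + 3) g), (zeros_blks _ (p + 3 + g + 1)).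
  - cbn [seq flat_map]. rewrite !app_nil_r.
    assert (B0 : blks (p, g, d) p = blk d 0) by (unfold blks; now rewrite Nat.eqb_refl).
    assert (B1 : blks (p, g, d) (S p) = blk d 1).
    { unfold blks. rewrite Nat.add_1_r, Nat.eqb_refl. destruct (Nat.eqb_spec (S p) p); auto; lia. }
    assert (B2 : blks (p, g, d) (S (S p)) = blk d 2).
    { unfold blks. repeat match goal with |- context [Nat.eqb ?a ?b] => destruct (Nat.eqb_spec a b); try lia end; auto. }
    assert (B3 : blks (p, g, d) (p + 3 + g) = blk d 3).
    { unfold blks. repeat match goal with |- context [Nat.eqb ?a ?b] => destruct (Nat.eqb_spec a b); try lia end; auto. }
    rewrite B0, B1, B2, B3. now rewrite <- !app_assoc.
  - intros p' H1 H2. unfold blks.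
    repeat match goal with |- context [Nat.eqb ?a ?b] => destruct (Nat.eqb_spec a b); try lia end; auto.
  - intros p' H1 H2. unfold blks.
    repeat match goal with |- context [Nat.eqb ?a ?b] => destruct (Nat.eqb_spec a b); try lia end; auto.
  - intros p' H1 H2. unfold blks.
    repeat match goal with |- context [Nat.eqb ?a ?b] => destruct (Nat.eqb_spec a b); try lia end; auto.
Qed.

Definition emit_zeros (r : reg) : stmt := For r RT1 (Seq (emit zcode) (Pop RRem)).

Lemma Ex_emit_zeros r q m st : rn r <> rn RT1 -> rn r <> rn ROut -> rn r <> rn RRem ->
  st r = ones q -> st RRem = ones m -> st RT1 = nil ->
  Ex (emit_zeros r) st (upd (outs st (zeros q)) RRem (ones (m - q))) (q * (clen * 2 + 10) + 3).
Proof.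
  intros N1 N2 N3 H1 H2 H3. unfold emit_zeros.
  pose proof (length_ecode nil) as HL. change (ecode nil) with zcode in HL.
  apply (Ex_for_from r RT1 _ (fun j => upd (outs st (zeros j)) RRem (ones (m - j))) q (clen * 2 + 3)); auto.
  - rewrite Nat.sub_0_r, <- H2. change (zeros 0) with (@nil bool). rewrite outs_nil. now rewrite upd_same.
  - lia.
  - intros j Hj. unfold outs. rewrite !upd_neq by (auto; discriminate). auto.
  - intros j Hj. eapply Ex_conv.
    + eapply Ex_seq; [apply Ex_emit|apply Ex_pop].
    + unfold outs. rewrite !(upd_neq _ ROut _ RRem) by discriminate.
      rewrite !(upd_neq _ RT1 _ RRem) by discriminate. rewrite !(upd_neq _ r _ RRem) by auto.
      rewrite !(upd_eq _ RRem _ RRem) by auto. rewrite tl_ones.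
      rewrite !(upd_neq _ RT1 _ ROut) by discriminate. rewrite !(upd_neq _ r _ ROut) by auto.
      rewrite !(upd_neq _ RRem _ ROut) by discriminate. rewrite !(upd_eq _ ROut _ ROut) by auto.
      rewrite Nat.add_1_r, zeros_S, rev_app_distr, <- app_assoc.
      replace (m - j - 1) with (m - S j) by lia. upd_cases; simpl in *; congruence.
    + lia.
Qed.

(** [RRem] starts at the number of cells and loses one per printed cell, so what it holds at the end
    is the length of the last run of zeros. The words depending on [d] are hard-coded. *)
Definition emit_sample (g : reg) (d : desc) : stmt :=
  Seq (For RN RT1 (Push RRem true))
  (Seq (emit (true :: ebit (has_false d)))
  (Seq (emit_zeros RP)
  (Seq (emit (ecode (blk d 0) ++ ecode (blk d 1) ++ ecode (blk d 2)))
  (Seq (ntimes 3 (Pop RRem))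
  (Seq (emit_zeros g)
  (Seq (emit (ecode (blk d 3)))
  (Seq (Pop RRem)
  (Seq (Loop RRem (emit zcode))
  (Seq (emit [false])
  (Push RY (label d))))))))))).

Definition emits (N : nat) (st : store) (ss : list sample) : store :=
  upd (outs st (flat_map (esample N) ss)) RY (rev (map (fun s => label (snd s)) ss) ++ st RY).

Definition is_gap (g : reg) : Prop := g = RD \/ g = RG.

Lemma Ex_loop_zeros q st : st RRem = ones q ->
  Ex (Loop RRem (emit zcode)) st (upd (outs st (zeros q)) RRem nil) (q * (clen * 2 + 3) + 1).
Proof.
  intros H2. pose proof (length_ecode nil) as HL. change (ecode nil) with zcode in HL.
  eapply Ex_loop_from with (st := fun j => upd (outs st (zeros j)) RRem (ones (q - j)))
    (st' := fun j => upd (outs st (zeros (S j))) RRem (ones (q - j))) (n := q) (t := clen * 2 + 1).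
  - rewrite Nat.sub_0_r, <- H2. change (zeros 0) with (@nil bool). rewrite outs_nil. now rewrite upd_same.
  - now rewrite Nat.sub_diag.
  - lia.
  - intros j Hj. split; [|split].
    + rewrite upd_eq by auto. apply ones_nonnil. lia.
    + eapply Ex_conv; [apply Ex_emit| |lia].
      rewrite zeros_S, <- outs_app. unfold outs. st_eq.
    + rewrite upd_upd, upd_eq by auto. rewrite tl_ones. now replace (q - j - 1) with (q - S j) by lia.
  - rewrite upd_eq by auto. now rewrite Nat.sub_diag.
Qed.

Definition csample : nat := 12 * clen + 100.

Lemma Ex_emit_sample g d N p gg st : is_gap g -> p + gg + 4 <= N ->
  st RP = ones p -> st g = ones gg -> st RN = ones N -> st RT1 = nil -> st RRem = nil ->
  Ex (emit_sample g d) st (emits N st [(p, gg, d)]) (csample * (N + 1)).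
Proof.
  intros Hg Hle HP HG HN HT HR. unfold emit_sample.
  pose proof (length_ecode (blk d 0)) as L0. pose proof (length_ecode (blk d 1)) as L1.
  pose proof (length_ecode (blk d 2)) as L2. pose proof (length_ecode (blk d 3)) as L3.
  assert (Lb : length (ebit (has_false d)) <= 20) by apply length_ebit.
  (* Normal form of the intermediate stores: [l] has been printed and [m] cells remain. *)
  set (A := fun l m => upd (outs st l) RRem (ones m)).
  assert (AP : forall l m, A l m RP = ones p) by (intros; exact HP).
  assert (AG : forall l m, A l m g = ones gg) by (destruct Hg as [-> | ->]; intros; exact HG).
  assert (AT : forall l m, A l m RT1 = nil) by (intros; exact HT).
  assert (AO : forall l m l', outs (A l m) l' = A (l ++ l') m).
  { intros l m l'. unfold A. rewrite <- outs_app. unfold outs. st_eq. }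
  assert (AE : forall l m v, upd (A l m) RRem v = upd (outs st l) RRem v).
  { intros. unfold A. now rewrite upd_upd. }
  assert (G1 : rn g <> rn RT1 /\ rn g <> rn ROut /\ rn g <> rn RRem)
    by (destruct Hg as [-> | ->]; repeat split; discriminate).
  destruct G1 as (G1 & G2 & G3).
  assert (AZ : forall r q l m, rn r <> rn RT1 -> rn r <> rn ROut -> rn r <> rn RRem ->
     A l m r = ones q ->
     Ex (emit_zeros r) (A l m) (A (l ++ zeros q) (m - q)) (q * (clen * 2 + 10) + 3)).
  { intros r q l m R1 R2 R3 Hr. eapply Ex_conv; [apply (Ex_emit_zeros r q m)| |apply le_n]; auto.
    rewrite AO. unfold A. now rewrite upd_upd. }
  eapply Ex_conv.
  - eapply Ex_seq.
    { eapply Ex_conv; [apply (Ex_add _ _ _ _ N); auto; discriminate| |apply le_n].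
      rewrite HR, app_nil_r. instantiate (1 := A nil N). unfold A. now rewrite outs_nil. }
    eapply Ex_seq; [apply Ex_emit|]. rewrite AO.
    eapply Ex_seq; [apply (AZ RP p); auto; discriminate|].
    eapply Ex_seq; [apply Ex_emit|]. rewrite AO.
    eapply Ex_seq.
    { eapply Ex_conv; [apply Ex_pops| |apply le_n]. rewrite AE.
      unfold A at 1. rewrite upd_eq by auto. rewrite skipn_ones. fold (A (( [] ++ true :: ebit (has_false d)) ++ zeros p) 0). reflexivity. }
    fold (A ((([] ++ true :: ebit (has_false d)) ++ zeros p) ++ ecode (blk d 0) ++ ecode (blk d 1) ++ ecode (blk d 2)) (N - p - 3)).
    eapply Ex_seq; [apply (AZ g gg); auto|].
    eapply Ex_seq; [apply Ex_emit|]. rewrite AO.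
    eapply Ex_seq.
    { eapply Ex_conv; [apply Ex_pop| |apply le_n]. rewrite AE.
      unfold A at 1. rewrite upd_eq by auto. rewrite tl_ones. reflexivity. }
    eapply Ex_seq.
    { apply (Ex_loop_zeros (N - p - 3 - gg - 1)). now rewrite upd_eq. }
    eapply Ex_seq; [apply Ex_emit|]. apply Ex_push.
  - unfold emits. cbn [flat_map map rev app fst snd]. rewrite app_nil_r, esample_eq by auto.
    replace (N - p - 3 - gg - 1) with (N - p - gg - 4) by lia.
    set (z := zeros (N - p - gg - 4)).
    assert (AOO : forall s1 s2 v l, outs (upd (outs (upd s1 RRem v) s2) RRem nil) l =
       upd (outs (outs s1 s2) l) RRem nil).
    { intros. unfold outs. st_eq. }
    rewrite AOO, !outs_app. rewrite <- !app_assoc. cbn [app].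
    rewrite <- !app_assoc. unfold outs. st_eq.
  - rewrite !length_app. cbn [length].
    unfold csample.
    replace (N - p - 3 - gg - 1) with (N - p - gg - 4) by lia.
    assert (HZ : p * (clen * 2 + 10) + gg * (clen * 2 + 10) + (N - p - gg - 4) * (clen * 2 + 3)
       <= N * (clen * 2 + 10)).
    { replace N with (p + gg + 4 + (N - p - gg - 4)) at 2 by lia. nia. }
    assert (HM : N * (clen * 2 + 10) + N * 8 + 8 * clen + 100 <= (12 * clen + 100) * (N + 1)) by nia.
    lia.
Qed.

End Emission.

(** * The reduction as a stack program *)

Lemma Ex_start s st0 st1 st' t : st0 = st1 -> Ex s st1 st' t -> Ex s st0 st' t.
Proof. intros ->. auto. Qed.

Lemma Ex_sub r t d st n m : rn r <> rn t -> rn r <> rn d -> rn t <> rn d ->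
  st r = ones n -> st t = nil -> st d = ones m ->
  Ex (For r t (Pop d)) st (upd st d (ones (m - n))) (n * 8 + 3).
Proof.
  intros H1 H2 H3 Hr Ht Hd.
  apply (Ex_for_from r t _ (fun j => upd st d (ones (m - j))) n 1); auto.
  - rewrite Nat.sub_0_r, <- Hd. now rewrite upd_same.
  - intros j Hj. rewrite !upd_neq by auto. auto.
  - intros j Hj. eapply Ex_conv; [apply Ex_pop| |apply le_n].
    rewrite !(upd_neq _ _ _ d) by auto. rewrite upd_eq by auto.
    rewrite tl_ones. replace (m - j - 1) with (m - (j + 1)) by lia. upd_cases.
Qed.

Lemma Ex_add_width_body d t m st g : rn RD <> rn t -> rn RD <> rn d -> rn t <> rn d ->
  st RD = ones g -> st t = nil -> st d = ones m ->
  Ex (Seq (For RD t (Push d true)) (ntimes 2 (Push d true))) st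
     (upd st d (ones (m + (g + 2)))) (g * 8 + 9).
Proof.
  intros H1 H2 H3 HD Ht Hd. eapply Ex_conv.
  - eapply Ex_seq; [apply (Ex_add _ _ _ _ g); auto|]. apply Ex_pushes.
  - rewrite upd_upd, upd_eq by auto. rewrite Hd, !ones_add. do 2 f_equal. lia.
  - lia.
Qed.

(** [ROut] delivers the last input bit first, so [RX] ends up with the first bit on top; the extra
    push makes [RS] the base [n + 1] of the witness bound. *)
Definition p_input : stmt :=
  Seq (Loop ROut (If ROut Skip (Seq (Push RX false) (Push RS true))
                               (Seq (Push RX true) (Push RS true))))
      (Push RS true).

Definition addto (r d : reg) : stmt := For r RT1 (Push d true).

(** [RS] is raised by [wlen] to obtain [pw wlen] from the same power program and lowered again
    afterwards. Then come [nrows], [lpad], four copies of it for [gap0], [nrows] rows of [gap0 + 2]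
    cells for [nwin], and [nwin + gap0 + 3] for [ncells]. *)
Definition p_counts (c k : nat) : stmt :=
  Seq (powc c k) (Seq (Loop RA (Push RM true))
  (Seq (addto RM RS) (Seq (powc c k) (Seq (For RM RT1 (Pop RS))
  (Seq (Loop RA (Push RR true)) (Seq (addto RM RR) (Seq (addto RS RR) (Seq (addto RS RR)
  (Seq (addto RR RK) (Seq (ntimes 3 (Push RK true))
  (Seq (addto RK RD) (Seq (addto RK RD) (Seq (addto RK RD) (Seq (addto RK RD)
  (Seq (For RR RT1 (Seq (For RD RT2 (Push RCnt true)) (ntimes 2 (Push RCnt true))))
  (Seq (addto RCnt RN) (Seq (addto RD RN) (ntimes 3 (Push RN true))))))))))))))))))).

Definition mst (xs : list bool) (s a m rr kk d cnt nn : nat) : store := fun r =>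
  match r with
  | RX => xs | RS => ones s | RA => ones a | RM => ones m | RR => ones rr | RK => ones kk
  | RD => ones d | RCnt => ones cnt | RN => ones nn | _ => nil
  end.

Lemma Ex_input_loop l xs s : Ex (Loop ROut (If ROut Skip (Seq (Push RX false) (Push RS true))
                               (Seq (Push RX true) (Push RS true))))
  (fun r => match r with ROut => l | RX => xs | RS => ones s | _ => nil end)
  (mst (rev l ++ xs) (length l + s) 0 0 0 0 0 0 0) (length l * 6 + 1).
Proof.
  revert xs s. induction l as [|b l IH]; intros xs s.
  - eapply Ex_conv; [apply Ex_loop_nil; auto| |simpl; lia]. st_eq.
  - eapply Ex_conv.
    + eapply Ex_loop_cons; [discriminate| |].
      * eapply (Ex_conv _ _ _ (fun r => match r with
          ROut => b :: l | RX => b :: xs | RS => ones (S s) | _ => nil end) (3 + 1) 4); [|reflexivity|auto].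
        apply Ex_if.
        destruct b; (eapply (Ex_conv _ _ _ _ (1 + 1 + 1));
          [eapply Ex_seq; apply Ex_push|st_eq|apply le_n]).
      * eapply Ex_conv; [|reflexivity|apply le_n].
        match goal with |- Ex _ ?st _ _ => replace st with (fun r => match r with
          ROut => l | RX => b :: xs | RS => ones (S s) | _ => nil end) by st_eq end.
        apply IH.
    + simpl rev. rewrite <- app_assoc. simpl length.
      replace (length l + S s) with (S (length l) + s) by lia. reflexivity.
    + simpl length. lia.
Qed.

Lemma Ex_input x : Ex p_input (init_store x) (mst x (length x + 1) 0 0 0 0 0 0 0) (length x * 6 + 3).
Proof.
  unfold p_input. eapply Ex_conv.
  - eapply Ex_seq; [|apply Ex_push].
    eapply Ex_conv; [|reflexivity|apply le_n].
    match goal with |- Ex _ ?st _ _ => replace st with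
      (fun r => match r with ROut => rev x | RX => @nil bool | RS => ones 0 | _ => nil end) by st_eq end.
    apply Ex_input_loop.
  - rewrite rev_involutive, app_nil_r, length_rev.
    replace (length x + 0) with (length x) by lia. replace (length x + 1) with (S (length x)) by lia.
    st_eq.
  - rewrite length_rev. lia.
Qed.

Section Program.
Variable V : TM.
Variables c k : nat.

Notation cv := (cvs V).

Section Stages.
Variable x : list bool.
Notation n := (length x).
Notation wlenX := (wlen c k x).
Notation pwX := (pw c k x).
Notation nrowsX := (nrows c k x).
Notation lpadX := (lpad c k x).
Notation gap0X := (gap0 c k x).
Notation widthX := (width c k x).
Notation nwinX := (nwin c k x).
Notation ncellsX := (ncells c k x).
Notation gposX := (gpos c k x).
Notation gapX := (gap c k x).
Notation unitsX := (units c k x).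
Notation samplesX := (samples V c k x).

Definition tpow (a s : nat) : nat := c * 2 + k * (a * (s * 11 + 5) + 4) + 3.

Definition tcounts : nat :=
  tpow wlenX (n + 1) + tpow (pwX wlenX) (wlenX + (n + 1)) + 100 * ncellsX
  + nrowsX * (gap0X * 8 + 16) + 200.

Lemma Ex_counts : Ex (p_counts c k) (mst x (n + 1) 0 0 0 0 0 0 0)
  (mst x (n + 1) 0 wlenX nrowsX lpadX gap0X nwinX ncellsX) tcounts.
Proof.
  unfold p_counts, addto. eapply Ex_conv.
  - eapply Ex_seq.
    { eapply (Ex_conv _ _ _ (mst x (n + 1) wlenX 0 0 0 0 0 0)); [apply (Ex_powc c k _ (n + 1)); auto; lia| |apply le_n].
      st_eq. }
    eapply Ex_seq.
    { eapply (Ex_conv _ _ _ (mst x (n + 1) 0 wlenX 0 0 0 0 0)); [apply (Ex_transfer _ _ _ wlenX); auto; discriminate| |apply le_n].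
      rd. simpl. rewrite app_nil_r. st_eq. }
    eapply Ex_seq.
    { eapply (Ex_conv _ _ _ (mst x (wlenX + (n + 1)) 0 wlenX 0 0 0 0 0)); [apply (Ex_add _ _ _ _ wlenX); auto; discriminate| |apply le_n].
      simpl. rewrite ones_add. st_eq. }
    eapply Ex_seq.
    { eapply (Ex_conv _ _ _ (mst x (wlenX + (n + 1)) (pwX wlenX) wlenX 0 0 0 0 0)); [apply (Ex_powc c k _ (wlenX + (n + 1))); auto; lia| |apply le_n].
      replace (c * (wlenX + (n + 1)) ^ k) with (pwX wlenX) by (unfold pw; do 2 f_equal; lia). st_eq. }
    eapply Ex_seq.
    { eapply (Ex_conv _ _ _ (mst x (n + 1) (pwX wlenX) wlenX 0 0 0 0 0)); [apply (Ex_sub _ _ _ _ wlenX (wlenX + (n + 1))); auto; discriminate| |apply le_n].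
      replace (wlenX + (n + 1) - wlenX) with (n + 1) by lia. st_eq. }
    eapply Ex_seq.
    { eapply (Ex_conv _ _ _ (mst x (n + 1) 0 wlenX (pwX wlenX) 0 0 0 0)); [apply (Ex_transfer _ _ _ (pwX wlenX)); auto; discriminate| |apply le_n].
      simpl. rewrite app_nil_r. st_eq. }
    eapply Ex_seq.
    { eapply (Ex_conv _ _ _ (mst x (n + 1) 0 wlenX (wlenX + pwX wlenX) 0 0 0 0)); [apply (Ex_add _ _ _ _ wlenX); auto; discriminate| |apply le_n].
      simpl. rewrite ones_add. st_eq. }
    eapply Ex_seq.
    { eapply (Ex_conv _ _ _ (mst x (n + 1) 0 wlenX (n + 1 + (wlenX + pwX wlenX)) 0 0 0 0)); [apply (Ex_add _ _ _ _ (n + 1)); auto; discriminate| |apply le_n].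
      simpl. rewrite ones_add. st_eq. }
    eapply Ex_seq.
    { eapply (Ex_conv _ _ _ (mst x (n + 1) 0 wlenX nrowsX 0 0 0 0)); [apply (Ex_add _ _ _ _ (n + 1)); auto; discriminate| |apply le_n].
      simpl. rewrite ones_add. replace (n + 1 + (n + 1 + (wlenX + pwX wlenX))) with nrowsX by (unfold nrows; lia). st_eq. }
    eapply Ex_seq.
    { eapply (Ex_conv _ _ _ (mst x (n + 1) 0 wlenX nrowsX nrowsX 0 0 0)); [apply (Ex_add _ _ _ _ nrowsX); auto; discriminate| |apply le_n].
      simpl. rewrite app_nil_r. st_eq. }
    eapply Ex_seq.
    { eapply (Ex_conv _ _ _ (mst x (n + 1) 0 wlenX nrowsX lpadX 0 0 0)); [apply Ex_pushes| |apply le_n].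
      simpl mst. rewrite ones_add. replace (3 + nrowsX) with lpadX by (unfold lpad; lia). st_eq. }
    eapply Ex_seq.
    { eapply (Ex_conv _ _ _ (mst x (n + 1) 0 wlenX nrowsX lpadX lpadX 0 0)); [apply (Ex_add _ _ _ _ lpadX); auto; discriminate| |apply le_n].
      simpl. rewrite app_nil_r. st_eq. }
    eapply Ex_seq.
    { eapply (Ex_conv _ _ _ (mst x (n + 1) 0 wlenX nrowsX lpadX (lpadX + lpadX) 0 0)); [apply (Ex_add _ _ _ _ lpadX); auto; discriminate| |apply le_n].
      simpl. rewrite ones_add. st_eq. }
    eapply Ex_seq.
    { eapply (Ex_conv _ _ _ (mst x (n + 1) 0 wlenX nrowsX lpadX (lpadX + (lpadX + lpadX)) 0 0)); [apply (Ex_add _ _ _ _ lpadX); auto; discriminate| |apply le_n].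
      simpl. rewrite ones_add. st_eq. }
    eapply Ex_seq.
    { eapply (Ex_conv _ _ _ (mst x (n + 1) 0 wlenX nrowsX lpadX gap0X 0 0)); [apply (Ex_add _ _ _ _ lpadX); auto; discriminate| |apply le_n].
      simpl. rewrite ones_add. replace (lpadX + (lpadX + (lpadX + lpadX))) with gap0X by (unfold gap0; lia). st_eq. }
    eapply Ex_seq.
    { apply (Ex_for_from RR RT1 _ (fun j => mst x (n + 1) 0 wlenX nrowsX lpadX gap0X (j * widthX) 0) nrowsX (gap0X * 8 + 9)
        _ (mst x (n + 1) 0 wlenX nrowsX lpadX gap0X nwinX 0) _ ltac:(discriminate)); [reflexivity|reflexivity|apply le_n|auto|].
      intros j Hj. eapply Ex_conv; [apply (Ex_add_width_body RCnt RT2 (j * widthX) _ gap0X); auto; discriminate| |apply le_n].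
      replace (j * widthX + (gap0X + 2)) with ((j + 1) * widthX) by (unfold width; lia). st_eq. }
    eapply Ex_seq.
    { eapply (Ex_conv _ _ _ (mst x (n + 1) 0 wlenX nrowsX lpadX gap0X nwinX nwinX)); [apply (Ex_add _ _ _ _ nwinX); auto; discriminate| |apply le_n].
      simpl. rewrite app_nil_r. st_eq. }
    eapply Ex_seq.
    { eapply (Ex_conv _ _ _ (mst x (n + 1) 0 wlenX nrowsX lpadX gap0X nwinX (gap0X + nwinX))); [apply (Ex_add _ _ _ _ gap0X); auto; discriminate| |apply le_n].
      simpl. rewrite ones_add. st_eq. }
    apply Ex_pushes.
  - simpl mst. rewrite ones_add. replace (3 + (gap0X + nwinX)) with ncellsX by (unfold ncells, width; lia). st_eq.
  - unfold tcounts, tpow.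
    replace (c * (wlenX + (n + 1)) ^ k) with (pwX wlenX) by (unfold pw; do 2 f_equal; lia).
    fold wlenX. change (c * (n + 1) ^ k) with wlenX.
    pose proof (nrows_ge c k x). pose proof (lpad_ge c k x).
    assert (lpadX = nrowsX + 3) by reflexivity. assert (gap0X = 4 * lpadX) by reflexivity.
    assert (ncellsX = nwinX + widthX + 1) by reflexivity. assert (widthX = gap0X + 2) by reflexivity.
    set (u1 := k * (wlenX * ((n + 1) * 11 + 5) + 4)).
    set (u2 := k * (pwX wlenX * ((wlenX + (n + 1)) * 11 + 5) + 4)).
    replace (gap0X * 8 + 9 + 7) with (gap0X * 8 + 16) by lia.
    set (u3 := nrowsX * (gap0X * 8 + 16)). lia.
Qed.

(** The dimension is found by counting vertices in binary: one increment per literal and cell, and a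
    last one for the vertex [None]. *)
Definition p_header : stmt :=
  Seq (For RN RT1 (ntimes (length (lits cv)) inc))
  (Seq inc
  (Seq (Loop RBin (Seq (Push ROut true) (If RBin Skip (Push ROut false) (Push ROut true))))
       (Push ROut false))).

Notation nl := (length (lits cv)).
Notation dim := (ncellsX * nl + 1).

Lemma Ex_incs q m st : st RBin = nbits m -> st RA = nil -> st RT2 = nil ->
  Ex (ntimes q inc) st (upd st RBin (nbits (m + q))) (q * ((m + q) * 12 + 21) + 1).
Proof.
  intros H1 H2 H3. eapply Ex_conv.
  - pose proof (Ex_ntimes inc (fun j => upd st RBin (nbits (m + j))) q ((m + q) * 12 + 20)) as HR.
    cbv beta in HR. rewrite Nat.add_0_r, upd_same in HR by auto. apply HR. intros j Hj.
    eapply Ex_conv.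
    + apply (Ex_inc (nbits (m + j))); auto.
    + rewrite upd_upd, <- nbits_S. do 2 f_equal. lia.
    + pose proof (length_nbits (m + j)). lia.
  - reflexivity.
  - lia.
Qed.

Lemma Ex_emit_bits l st : st RBin = l ->
  Ex (Loop RBin (Seq (Push ROut true) (If RBin Skip (Push ROut false) (Push ROut true)))) st
     (upd (outs st (flat_map (fun b => [true; b]) l)) RBin nil) (length l * 6 + 1).
Proof.
  revert st. induction l as [|b l IH]; intros st H.
  - eapply Ex_conv; [apply Ex_loop_nil; auto| |simpl; lia]. simpl flat_map. rewrite outs_nil.
    now rewrite upd_same.
  - eapply Ex_conv.
    + eapply Ex_loop_cons; [rewrite H; discriminate| |].
      * eapply (Ex_conv _ _ _ (outs st [true; b]) (1 + (1 + 1) + 1)); [|reflexivity|apply le_n].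
        eapply Ex_seq; [apply Ex_push|]. apply Ex_if. rd. rewrite H.
        destruct b; (eapply Ex_conv; [apply Ex_push|unfold outs; st_eq|apply le_n]).
      * apply IH. rd. unfold outs. rd. now rewrite H.
    + cbn [flat_map]. rewrite <- outs_app. unfold outs. st_eq.
    + simpl length. lia.
Qed.

Definition hst (h : list bool) : store := fun r => match r with
  | ROut => rev h | _ => mst x (n + 1) 0 wlenX nrowsX lpadX gap0X nwinX ncellsX r end.

Definition header : list bool := enc_nat dim.

Definition theader : nat := ncellsX * (nl * ((ncellsX * nl + nl) * 12 + 21) + 8) + dim * 20 + 40.

Lemma Ex_header : Ex p_header (mst x (n + 1) 0 wlenX nrowsX lpadX gap0X nwinX ncellsX) (hst header) theader.
Proof.
  unfold p_header. set (s0 := mst x (n + 1) 0 wlenX nrowsX lpadX gap0X nwinX ncellsX).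
  eapply Ex_conv.
  - eapply Ex_seq.
    { apply (Ex_for_from RN RT1 _ (fun j => upd s0 RBin (nbits (j * nl))) ncellsX
        (nl * ((ncellsX * nl + nl) * 12 + 21) + 1) _ (upd s0 RBin (nbits (ncellsX * nl))) _ ltac:(discriminate));
      [st_eq|reflexivity|apply le_n|auto|].
      intros j Hj. eapply Ex_conv; [apply (Ex_incs _ (j * nl)); auto| |].
      - replace (j * nl + nl) with ((j + 1) * nl) by lia. st_eq.
      - apply Nat.add_le_mono_r, Nat.mul_le_mono_l.
        assert (j * nl <= ncellsX * nl) by (apply Nat.mul_le_mono_r; lia). lia. }
    eapply Ex_seq.
    { eapply (Ex_conv _ _ _ (upd s0 RBin (nbits dim))); [apply (Ex_inc (nbits (ncellsX * nl))); auto| |apply le_n].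
      rewrite upd_upd, <- nbits_S. now rewrite Nat.add_1_r. }
    eapply Ex_seq.
    { apply (Ex_emit_bits (nbits dim)). auto. }
    apply Ex_push.
  - unfold header, enc_nat. fold (nbits dim). unfold enc_bits.
    extensionality r; destruct r; try reflexivity. unfold outs. cbn [hst]. rewrite rev_app_distr.
    rd. simpl. now rewrite app_nil_r.
  - pose proof (length_nbits (ncellsX * nl)). pose proof (length_nbits dim).
    unfold theader.
    set (u := nl * ((ncellsX * nl + nl) * 12 + 21)) in *.
    replace (ncellsX * (u + 1 + 7)) with (ncellsX * (u + 8)) by (f_equal; lia). lia.
Qed.

(** * Printing the samples *)

(* The stores of the sampling stage after the emission of [ss]. *)
Definition ms (xs : list bool) (s a m kk cnt p g t2 : nat) (ss : list sample) : store := fun r =>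
  match r with
  | ROut => rev (header ++ flat_map (esample cv ncellsX) ss)
  | RY => rev (map (fun s => label (snd s)) ss)
  | RX => xs | RS => ones s | RA => ones a | RM => ones m | RR => ones nrowsX | RK => ones kk
  | RD => ones gap0X | RCnt => ones cnt | RN => ones ncellsX | RP => ones p | RG => ones g
  | RT2 => ones t2 | _ => nil
  end.

Lemma emits_ms xs s a m kk cnt p g t2 ss ss' :
  emits cv ncellsX (ms xs s a m kk cnt p g t2 ss) ss' = ms xs s a m kk cnt p g t2 (ss ++ ss').
Proof.
  unfold emits, outs. extensionality r; destruct r; try reflexivity; unfold upd; cbn [rn Nat.eqb ms].
  - now rewrite flat_map_app, !rev_app_distr, <- app_assoc.
  - now rewrite map_app, rev_app_distr.
Qed.

Definition ct : nat := csample cv * (ncellsX + 1).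

Lemma Ex_sample xs s a m kk cnt p g t2 ss d : p + 3 + gap0X < ncellsX ->
  Ex (emit_sample cv RD d) (ms xs s a m kk cnt p g t2 ss)
     (ms xs s a m kk cnt p g t2 (ss ++ [(p, gap0X, d)])) ct.
Proof.
  intros H. rewrite <- emits_ms. apply Ex_emit_sample; auto; try lia. now left.
Qed.

Lemma Ex_sample_far xs s a m kk cnt p g t2 ss d : p + 3 + g < ncellsX ->
  Ex (emit_sample cv RG d) (ms xs s a m kk cnt p g t2 ss)
     (ms xs s a m kk cnt p g t2 (ss ++ [(p, g, d)])) ct.
Proof.
  intros H. rewrite <- emits_ms. apply Ex_emit_sample; auto; try lia. now right.
Qed.

Fixpoint emit_list (ds : list desc) : stmt :=
  match ds with nil => Skip | d :: ds' => Seq (emit_sample cv RD d) (emit_list ds') end.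

Lemma Ex_samples xs s a m kk cnt p g t2 ss ds : p + 3 + gap0X < ncellsX ->
  Ex (emit_list ds) (ms xs s a m kk cnt p g t2 ss)
     (ms xs s a m kk cnt p g t2 (ss ++ map (fun d => (p, gap0X, d)) ds)) (length ds * (ct + 1) + 1).
Proof.
  intros H. revert ss. induction ds as [|d ds IH]; intros ss; simpl emit_list.
  - eapply Ex_conv; [apply Ex_skip|simpl; now rewrite app_nil_r|simpl; lia].
  - eapply Ex_conv.
    + eapply Ex_seq; [apply Ex_sample; auto|apply IH].
    + rewrite <- app_assoc. reflexivity.
    + simpl length. lia.
Qed.

Lemma Ex_next xs s a m kk cnt p g t2 ss :
  Ex (Push RP true) (ms xs s a m kk cnt p g t2 ss) (ms xs s a m kk cnt (p + 1) g t2 ss) 1.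
Proof. eapply Ex_conv; [apply Ex_push| |apply le_n]. rewrite Nat.add_1_r. st_eq. Qed.

Lemma units_app p a b : unitsX p (a ++ b) = unitsX p a ++ unitsX (p + length a) b.
Proof.
  revert p; induction a as [|d a IH]; intros p; simpl.
  - now rewrite Nat.add_0_r.
  - rewrite IH. do 3 f_equal. lia.
Qed.

Definition p_blanks : stmt := For RK RT2 (Seq (emit_sample cv RD (unit bl)) (Push RP true)).

Lemma Ex_blanks xs s a m cnt p g ss : p + lpadX + 3 + gap0X <= ncellsX ->
  Ex p_blanks (ms xs s a m lpadX cnt p g 0 ss)
     (ms xs s a m lpadX cnt (p + lpadX) g 0 (ss ++ unitsX p (repeat bl lpadX))) (lpadX * (ct + 9) + 3).
Proof.
  intros H.
  apply (Ex_for_from RK RT2 _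
    (fun j => ms xs s a m lpadX cnt (p + j) g 0 (ss ++ unitsX p (repeat bl j))) lpadX (ct + 2)); auto.
  - discriminate.
  - simpl. now rewrite app_nil_r, Nat.add_0_r.
  - lia.
  - intros j Hj. apply (Ex_start _ _ (ms xs s a m (lpadX - j) cnt (p + j) g j (ss ++ unitsX p (repeat bl j))));
      [st_eq|]. eapply Ex_conv.
    + eapply Ex_seq; [apply Ex_sample; lia|apply Ex_next].
    + rewrite <- app_assoc. rewrite repeat_app, units_app, repeat_length. simpl.
      replace (p + j + 1) with (p + (j + 1)) by lia. st_eq.
    + lia.
Qed.

Definition p_bits : stmt :=
  Loop RX (Seq (emit_sample cv RD (unit (bitcell true))) (Seq (Push RP true)
    (Seq (If RX Skip (emit_sample cv RD (unit (bitcell false))) (emit_sample cv RD (unit (bitcell true))))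
         (Push RP true)))).

Lemma Ex_bits xs s a m kk cnt p g t2 ss : p + 2 * length xs + 3 + gap0X <= ncellsX ->
  Ex p_bits (ms xs s a m kk cnt p g t2 ss)
     (ms nil s a m kk cnt (p + 2 * length xs) g t2
        (ss ++ unitsX p (map bitcell (flat_map (fun b => [true; b]) xs))))
     (length xs * (2 * ct + 9) + 1).
Proof.
  revert p ss. induction xs as [|b xs IH]; intros p ss H.
  - eapply Ex_conv; [apply Ex_loop_nil; auto| |simpl; lia]. simpl.
    now rewrite app_nil_r, Nat.add_0_r.
  - simpl length in H. eapply Ex_conv.
    + eapply Ex_loop_cons; [discriminate| |].
      * eapply Ex_seq; [apply Ex_sample; lia|]. eapply Ex_seq; [apply Ex_next|].
        eapply Ex_seq; [|apply Ex_next].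
        eapply (Ex_conv _ _ _ (ms (b :: xs) s a m kk cnt (p + 1) g t2
          ((ss ++ [(p, gap0X, unit (bitcell true))]) ++ [(p + 1, gap0X, unit (bitcell b))])) (ct + 1));
          [|reflexivity|apply le_n].
        apply Ex_if. destruct b; apply Ex_sample; lia.
      * apply (Ex_start _ _ (ms xs s a m kk cnt (p + 1 + 1) g t2
          ((ss ++ [(p, gap0X, unit (bitcell true))]) ++ [(p + 1, gap0X, unit (bitcell b))]))); [st_eq|].
        apply IH. lia.
    + simpl length. rewrite <- !app_assoc. simpl.
      replace (p + 1 + 1 + (length xs + (length xs + 0))) with (p + S (length xs + S (length xs + 0))) by lia.
      reflexivity.
    + simpl length. lia.
Qed.

(** [p_guess] increments [RS] together with the position, so at guess cell [l] it holds [n + 1 + l]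
    and the power is [pw l]. The gap is then assembled as [pw l] row lengths plus [lpad]. *)
Definition p_deadline : stmt :=
  Seq (powc c k)
  (Seq (Loop RA (Seq (For RD RT1 (Push RG true)) (ntimes 2 (Push RG true))))
  (Seq (For RK RT1 (Push RG true))
  (Seq (emit_sample cv RG trigger)
       (Loop RG Skip)))).

Definition tdeadline : nat :=
  tpow (pwX wlenX) (n + 1 + wlenX) + pwX wlenX * (gap0X * 8 + 11) + lpadX * 8 + ct + ncellsX * 3 + 10.

Lemma Ex_deadline xs l m cnt p t2 ss : l <= wlenX -> p + 3 + gapX l < ncellsX ->
  Ex p_deadline (ms xs (n + 1 + l) 0 m lpadX cnt p 0 t2 ss)
     (ms xs (n + 1 + l) 0 m lpadX cnt p 0 t2 (ss ++ [(p, gapX l, trigger)])) tdeadline.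
Proof.
  intros Hl H. unfold p_deadline. eapply Ex_conv.
  - eapply Ex_seq.
    { eapply (Ex_conv _ _ _ (ms xs (n + 1 + l) (pwX l) m lpadX cnt p 0 t2 ss));
        [apply (Ex_powc c k _ (n + 1 + l)); auto; lia|st_eq|apply le_n]. }
    eapply Ex_seq.
    { apply (Ex_loop_from RA _ (fun j => ms xs (n + 1 + l) (pwX l - j) m lpadX cnt p (j * widthX) t2 ss)
        (fun j => ms xs (n + 1 + l) (pwX l - j) m lpadX cnt p (S j * widthX) t2 ss) (pwX l) (gap0X * 8 + 9)
        _ (ms xs (n + 1 + l) 0 m lpadX cnt p (pwX l * widthX) t2 ss) _).
      - now rewrite Nat.sub_0_r.
      - now rewrite Nat.sub_diag.
      - apply le_n.
      - intros j Hj. split; [|split].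
        + apply ones_nonnil. lia.
        + eapply Ex_conv; [apply (Ex_add_width_body RG RT1 (j * widthX) _ gap0X); auto; discriminate| |apply le_n].
          replace (j * widthX + (gap0X + 2)) with (S j * widthX) by (unfold width; lia). st_eq.
        + cbn [ms]. rewrite tl_ones. replace (pwX l - j - 1) with (pwX l - S j) by lia. st_eq.
      - cbn [ms]. now rewrite Nat.sub_diag. }
    eapply Ex_seq.
    { eapply (Ex_conv _ _ _ (ms xs (n + 1 + l) 0 m lpadX cnt p (gapX l) t2 ss));
        [apply (Ex_add _ _ _ _ lpadX); auto; discriminate| |apply le_n].
      cbn [ms]. rewrite ones_add. replace (lpadX + pwX l * widthX) with (gapX l) by (unfold gap; lia).
      st_eq. }
    eapply Ex_seq; [apply Ex_sample_far; auto|].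
    apply Ex_clear.
  - st_eq.
  - cbn [ms]. unfold ones. rewrite repeat_length. unfold tdeadline, tpow.
    change (c * (n + 1 + l) ^ k) with (pwX l).
    pose proof (pw_le c k x l Hl) as Hp.
    assert (H1 : k * (pwX l * ((n + 1 + l) * 11 + 5) + 4) <= k * (pwX wlenX * ((n + 1 + wlenX) * 11 + 5) + 4)).
    { apply Nat.mul_le_mono_l, Nat.add_le_mono_r, Nat.mul_le_mono; auto. lia. }
    assert (H2 : pwX l * (gap0X * 8 + 11) <= pwX wlenX * (gap0X * 8 + 11)) by (apply Nat.mul_le_mono_r; auto).
    replace (gap0X * 8 + 9 + 2) with (gap0X * 8 + 11) by lia. lia.
Qed.

Definition guess_at (l : nat) : list sample :=
  map (fun d => (gposX l, gap0X, d)) guess ++ [(gposX l, gapX l, trigger)].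

Definition p_guess : stmt :=
  For RM RT2 (Seq (emit_list guess) (Seq p_deadline (Seq (Push RP true) (Push RS true)))).

(** The first-row unit samples, overshoot included, all start before [5 * lpad]; having at least two
    rows leaves room for their fourth block. *)
Lemma near_bound p : p <= 5 * lpadX -> p + 3 + gap0X < ncellsX.
Proof.
  intros H. pose proof (nrows_ge c k x).
  pose proof (mul_width_le c k x 2 nrowsX ltac:(lia)).
  assert (ncellsX = nrowsX * widthX + widthX + 1) by reflexivity.
  assert (widthX = 4 * lpadX + 2) by reflexivity. assert (gap0X = 4 * lpadX) by reflexivity. lia.
Qed.

Lemma far_bound l : l <= wlenX -> gposX l + 3 + gapX l < ncellsX.
Proof.
  intros H. apply (samples_bound V c k x _ _ trigger). apply in_samples. do 6 right; left. eauto.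
Qed.

Lemma gpos_near l : l <= wlenX -> gposX l + 3 <= 2 * lpadX.
Proof. intros H. pose proof (lpad_ge c k x). unfold gpos. lia. Qed.

Lemma Ex_guess cnt ss :
  Ex p_guess (ms nil (n + 1) 0 wlenX lpadX cnt (gposX 0) 0 0 ss)
     (ms nil (n + 1 + wlenX) 0 wlenX lpadX cnt (gposX wlenX) 0 0 (ss ++ flat_map guess_at (seq 0 wlenX)))
     (wlenX * (2 * ct + tdeadline + 20) + 3).
Proof.
  apply (Ex_for_from RM RT2 _ (fun j => ms nil (n + 1 + j) 0 wlenX lpadX cnt (gposX j) 0 0
    (ss ++ flat_map guess_at (seq 0 j))) wlenX (2 * ct + tdeadline + 13)); auto.
  - discriminate.
  - simpl. now rewrite app_nil_r, Nat.add_0_r.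
  - lia.
  - intros j Hj. pose proof (gpos_near j ltac:(lia)).
    apply (Ex_start _ _ (ms nil (n + 1 + j) 0 (wlenX - j) lpadX cnt (gposX j) 0 j
      (ss ++ flat_map guess_at (seq 0 j)))); [st_eq|].
    eapply Ex_conv.
    + eapply Ex_seq; [apply Ex_samples; apply near_bound; lia|].
      eapply Ex_seq; [apply Ex_deadline; [lia|apply far_bound; lia]|].
      eapply Ex_seq; [apply Ex_next|apply Ex_push].
    + rewrite seq_app, flat_map_app. cbn [seq flat_map]. rewrite app_nil_r, Nat.add_0_l.
      unfold guess_at at 3. rewrite <- !app_assoc.
      replace (gposX j + 1) with (gposX (j + 1)) by (unfold gpos; lia).
      replace (n + 1 + (j + 1)) with (S (n + 1 + j)) by lia. st_eq.
    + simpl length. lia.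
Qed.

Definition p_uniform : stmt := Loop RCnt (Seq (emit_list (uniform V)) (Push RP true)).

Lemma Ex_uniform xs s a m kk g t2 ss :
  Ex p_uniform (ms xs s a m kk nwinX 0 g t2 ss)
     (ms xs s a m kk 0 nwinX g t2
        (ss ++ flat_map (fun p => map (fun d => (p, gap0X, d)) (uniform V)) (seq 0 nwinX)))
     (nwinX * (length (uniform V) * (ct + 1) + 5) + 1).
Proof.
  set (F := fun p => map (fun d => (p, gap0X, d)) (uniform V)).
  apply (Ex_loop_from RCnt _ (fun j => ms xs s a m kk (nwinX - j) j g t2 (ss ++ flat_map F (seq 0 j)))
    (fun j => ms xs s a m kk (nwinX - j) (j + 1) g t2 (ss ++ flat_map F (seq 0 (S j)))) nwinX
    (length (uniform V) * (ct + 1) + 3)).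
  - simpl. now rewrite app_nil_r, Nat.sub_0_r.
  - now rewrite Nat.sub_diag.
  - lia.
  - intros j Hj. split; [|split].
    + apply ones_nonnil. lia.
    + eapply Ex_conv.
      * eapply Ex_seq; [apply Ex_samples|apply Ex_next].
        unfold ncells, width. lia.
      * rewrite seq_S, flat_map_app. simpl. rewrite app_nil_r, <- app_assoc. reflexivity.
      * lia.
    + cbn [ms]. rewrite tl_ones, Nat.add_1_r. replace (nwinX - j - 1) with (nwinX - S j) by lia. st_eq.
  - cbn [ms]. now rewrite Nat.sub_diag.
Qed.

(** The order is that of [samples]: three runs of [p_blanks] and two single blanks give the final
    [3 * lpad + 2] blanks, and the position returns to 0 before the uniform part. *)
Definition p_sampling : stmt :=
  Seq (emit_list [DZero; DFalse])
  (Seq p_blanks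
  (Seq (emit_sample cv RD (unit (Some (tm_Q V), None))) (Seq (Push RP true)
  (Seq p_bits
  (Seq (emit_sample cv RD (unit (bitcell false))) (Seq (Push RP true)
  (Seq p_guess
  (Seq p_deadline
  (Seq p_blanks (Seq p_blanks (Seq p_blanks
  (Seq (emit_sample cv RD (unit bl)) (Seq (Push RP true)
  (Seq (emit_sample cv RD (unit bl))
  (Seq (Loop RP Skip)
       p_uniform))))))))))))))).

Definition tsampling : nat :=
  4 * (lpadX * (ct + 9) + 3) + n * (2 * ct + 9) + (wlenX * (2 * ct + tdeadline + 20) + 3) +
  tdeadline + nwinX * (length (uniform V) * (ct + 1) + 5) + 6 * ct + 15 * lpadX + 100.

Lemma Ex_sampling :
  Ex p_sampling (hst header) (ms nil (n + 1 + wlenX) 0 wlenX lpadX 0 nwinX 0 0 samplesX) tsampling.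
Proof.
  pose proof (lpad_ge c k x) as HL. pose proof (gpos_near wlenX (le_n _)) as HG.
  assert (G0 : gposX 0 = lpadX + 1 + 2 * n + 1) by (unfold gpos; lia).
  assert (B : forall p, p <= 5 * lpadX -> p + 3 + gap0X < ncellsX) by apply near_bound.
  apply (Ex_start _ _ (ms x (n + 1) 0 wlenX lpadX nwinX 0 0 0 nil)).
  { extensionality r; destruct r; try reflexivity. simpl. now rewrite app_nil_r. }
  unfold p_sampling. eapply Ex_conv.
  - eapply Ex_seq; [apply Ex_samples; apply B; lia|].
    eapply Ex_seq; [apply Ex_blanks; pose proof (B lpadX ltac:(lia)); lia|].
    eapply Ex_seq; [apply Ex_sample; apply B; lia|].
    eapply Ex_seq; [apply Ex_next|].
    eapply Ex_seq; [apply Ex_bits; pose proof (B (2 * lpadX) ltac:(lia)); lia|].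
    eapply Ex_seq; [apply Ex_sample; apply B; lia|].
    eapply Ex_seq; [apply Ex_next|].
    rewrite Nat.add_0_l, <- G0.
    eapply Ex_seq; [apply Ex_guess|].
    eapply Ex_seq; [apply Ex_deadline; [auto|apply far_bound; auto]|].
    eapply Ex_seq; [apply Ex_blanks; pose proof (B (3 * lpadX) ltac:(lia)); lia|].
    eapply Ex_seq; [apply Ex_blanks; pose proof (B (4 * lpadX) ltac:(lia)); lia|].
    eapply Ex_seq; [apply Ex_blanks; pose proof (B (5 * lpadX) ltac:(lia)); lia|].
    eapply Ex_seq; [apply Ex_sample; apply B; lia|].
    eapply Ex_seq; [apply Ex_next|].
    eapply Ex_seq; [apply Ex_sample; pose proof (B (5 * lpadX) ltac:(lia)); apply B; lia|].
    eapply Ex_seq.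
    { eapply Ex_conv; [apply Ex_clear| |apply le_n].
      instantiate (1 := ms nil (n + 1 + wlenX) 0 wlenX lpadX nwinX 0 0 0 _). st_eq. }
    apply Ex_uniform.
  - f_equal. unfold samples.
    replace (3 * lpadX + 2) with (lpadX + (lpadX + (lpadX + (1 + 1)))) by lia.
    rewrite !repeat_app, !units_app, !repeat_length. unfold enc_bits. rewrite map_app, units_app, length_map.
    assert (HE : length (flat_map (fun b : bool => [true; b]) x) = 2 * n).
    { pose proof (length_enc_bits x) as E. unfold enc_bits in E. rewrite length_app in E. cbn [length] in E. lia. }
    rewrite HE. rewrite <- !app_assoc. reflexivity.
  - cbn [ms]. unfold ones. rewrite repeat_length. unfold tsampling.
    change (length [DZero; DFalse]) with 2. lia.
Qed.

(** Labels follow all samples in the encoding, so they were stacked on [RY] meanwhile; moving them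
    to [RY2] restores their order. The first push closes the list of samples, and the last word
    closes that of the labels and sets both output coefficients to 1. *)
Definition p_labels : stmt :=
  Seq (Push ROut false)
  (Seq (Move RY RY2)
  (Seq (Loop RY2 (If RY2 Skip (emit (ebit false)) (emit (ebit true))))
       (emit [false; true; true]))).

Lemma Ex_emit_labels l st : st RY2 = l ->
  Ex (Loop RY2 (If RY2 Skip (emit (ebit false)) (emit (ebit true)))) st
     (upd (outs st (flat_map ebit l)) RY2 nil) (length l * 50 + 1).
Proof.
  revert st. induction l as [|b l IH]; intros st H.
  - eapply Ex_conv; [apply Ex_loop_nil; auto| |simpl; lia]. simpl flat_map. rewrite outs_nil.
    now rewrite upd_same.
  - eapply Ex_conv.
    + eapply Ex_loop_cons; [rewrite H; discriminate| |].
      * eapply (Ex_conv _ _ _ (outs st (ebit b)) (41 + 1)); [|reflexivity|apply le_n].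
        apply Ex_if. rewrite H. pose proof (length_ebit b).
        destruct b; (eapply Ex_conv; [apply Ex_emit|reflexivity|lia]).
      * apply IH. rd. unfold outs. rd. now rewrite H.
    + cbn [flat_map]. rewrite <- outs_app. unfold outs. st_eq.
    + simpl length. lia.
Qed.

Definition tlabels (ss : list sample) : nat := length ss * 54 + 30.

Lemma Ex_labels ss : exists st,
  Ex p_labels (ms nil (n + 1 + wlenX) 0 wlenX lpadX 0 nwinX 0 0 ss) st (tlabels ss) /\ st ROut = rev (enc_inst (sinst cv ncellsX ss)).
Proof.
  set (st0 := ms nil (n + 1 + wlenX) 0 wlenX lpadX 0 nwinX 0 0 ss).
  set (ls := map (fun s => label (snd s)) ss).
  eexists. split.
  - unfold p_labels. eapply Ex_conv.
    + eapply Ex_seq; [apply Ex_push|].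
      eapply Ex_seq; [apply (Ex_move _ _ (rev ls)); [discriminate|reflexivity]|].
      eapply Ex_seq; [apply (Ex_emit_labels ls)|apply Ex_emit].
      rd. rewrite rev_involutive. simpl. apply app_nil_r.
    + reflexivity.
    + unfold tlabels. rewrite length_rev. unfold ls. rewrite length_map. cbn [length]. unfold sample. lia.
  - unfold outs. rd. unfold st0. cbn [ms]. unfold enc_inst, sinst, hinst.
    cbn [inst_n inst_x inst_y inst_a1 inst_a2]. rewrite !map_map.
    assert (HD : length (verts cv ncellsX) = dim).
    { unfold verts. cbn [length]. rewrite Nat.add_1_r. f_equal.
      generalize 0 as a. generalize ncellsX as q. induction q as [|q IH]; intros a; simpl; auto.
      now rewrite length_app, length_map, IH. }
    rewrite HD. fold header.
    replace (enc_list (enc_list enc_Q) _) with (flat_map (esample cv ncellsX) ss ++ [false]).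
    2: { unfold enc_list at 1. rewrite flat_map_map. reflexivity. }
    replace (enc_list enc_Q _) with (flat_map ebit ls ++ [false]).
    2: { unfold enc_list, ls. rewrite !flat_map_map. reflexivity. }
    rewrite !app_assoc, !rev_app_distr. reflexivity.
Qed.

(** * Number of samples and total running time *)

Lemma length_units p cs : length (unitsX p cs) = length cs.
Proof. revert p; induction cs as [|a cs IH]; intros p; simpl; auto. Qed.

Lemma length_flat_map_const {A B} (f : A -> list B) q l : (forall a, length (f a) = q) ->
  length (flat_map f l) = length l * q.
Proof. intros H. induction l as [|a l IH]; simpl; auto. now rewrite length_app, H, IH. Qed.

Lemma length_samples : length samplesX =
  4 * lpadX + 2 * n + wlenX * 3 + nwinX * length (uniform V) + 7.
Proof.
  unfold samples. rewrite !length_app, !length_units, !repeat_length, length_map, length_enc_bits.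
  rewrite (length_flat_map_const _ 3) by (intros; reflexivity).
  rewrite (length_flat_map_const _ (length (uniform V))) by (intros; apply length_map).
  rewrite !length_seq. cbn [length]. lia.
Qed.

Definition ttotal : nat :=
  n * 6 + 3 + tcounts + theader + tsampling + tlabels samplesX + 4.

End Stages.

Definition reduction_program : stmt :=
  Seq p_input (Seq (p_counts c k) (Seq p_header (Seq p_sampling p_labels))).

Definition reduced (x : list bool) : instance := sinst cv (ncells c k x) (samples V c k x).

Lemma Ex_reduction x : exists st,
  Ex reduction_program (init_store x) st (ttotal x) /\ st ROut = rev (enc_inst (reduced x)).
Proof.
  destruct (Ex_labels x (samples V c k x)) as (st & H & HO). exists st. split; auto.
  unfold reduction_program. eapply Ex_conv.
  - eapply Ex_seq; [apply Ex_input|].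
    eapply Ex_seq; [apply Ex_counts|].
    eapply Ex_seq; [apply Ex_header|].
    eapply Ex_seq; [apply Ex_sampling|]. exact H.
  - reflexivity.
  - unfold ttotal. lia.
Qed.

End Program.

(** * Polynomial time *)

Definition poly_bounded (f : list bool -> nat) : Prop :=
  exists a b, forall x, f x <= a * (length x + 1) ^ b.

Lemma pb_const q : poly_bounded (fun _ => q).
Proof. exists q, 0. intros x. simpl. lia. Qed.

Lemma pb_length : poly_bounded (fun x => length x).
Proof. exists 1, 1. intros x. simpl. lia. Qed.

Lemma pb_add f g : poly_bounded f -> poly_bounded g -> poly_bounded (fun x => f x + g x).
Proof.
  intros (a & b & Hf) (a' & b' & Hg). exists (a + a'), (b + b'). intros x.
  specialize (Hf x). specialize (Hg x).
  assert (H1 : (length x + 1) ^ b <= (length x + 1) ^ (b + b')) by (apply Nat.pow_le_mono_r; lia).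
  assert (H2 : (length x + 1) ^ b' <= (length x + 1) ^ (b + b')) by (apply Nat.pow_le_mono_r; lia).
  rewrite Nat.mul_add_distr_r.
  apply (Nat.mul_le_mono_l _ _ a) in H1. apply (Nat.mul_le_mono_l _ _ a') in H2. lia.
Qed.

Lemma pb_mul f g : poly_bounded f -> poly_bounded g -> poly_bounded (fun x => f x * g x).
Proof.
  intros (a & b & Hf) (a' & b' & Hg). exists (a * a'), (b + b'). intros x.
  rewrite Nat.pow_add_r.
  replace (a * a' * ((length x + 1) ^ b * (length x + 1) ^ b'))
    with (a * (length x + 1) ^ b * (a' * (length x + 1) ^ b')) by lia.
  now apply Nat.mul_le_mono.
Qed.

Lemma pb_pow f q : poly_bounded f -> poly_bounded (fun x => f x ^ q).
Proof.
  intros H. induction q as [|q IH]; simpl.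
  - apply pb_const.
  - now apply pb_mul.
Qed.

Ltac pb := repeat first
  [ assumption | apply pb_const | apply pb_length | apply pb_add | apply pb_mul | apply pb_pow ].

Lemma pb_ttotal V c k : poly_bounded (ttotal V c k).
Proof.
  assert (Hw : poly_bounded (wlen c k)) by (unfold wlen; pb).
  assert (Hp : poly_bounded (fun x => pw c k x (wlen c k x))) by (unfold pw; pb).
  assert (Hr : poly_bounded (nrows c k)) by (unfold nrows; pb).
  assert (Hl : poly_bounded (lpad c k)) by (unfold lpad; pb).
  assert (Hg : poly_bounded (gap0 c k)) by (unfold gap0; pb).
  assert (HW : poly_bounded (width c k)) by (unfold width; pb).
  assert (Hn : poly_bounded (nwin c k)) by (unfold nwin; pb).
  assert (HN : poly_bounded (ncells c k)) by (unfold ncells; pb).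
  assert (Hct : poly_bounded (ct V c k)) by (unfold ct; pb).
  assert (Hd : poly_bounded (tdeadline V c k)) by (unfold tdeadline, tpow; pb).
  assert (H1 : poly_bounded (tcounts c k)) by (unfold tcounts, tpow; pb).
  assert (H2 : poly_bounded (theader V c k)) by (unfold theader; pb).
  assert (H3 : poly_bounded (tsampling V c k)) by (unfold tsampling; pb).
  assert (H4 : poly_bounded (fun x => length (samples V c k x))).
  { replace (fun x => length (samples V c k x)) with (fun x => 4 * lpad c k x + 2 * length x
      + wlen c k x * 3 + nwin c k x * length (uniform V) + 7)
      by (extensionality x; symmetry; apply length_samples). pb. }
  assert (H5 : poly_bounded (fun x => tlabels (samples V c k x)))
    by (unfold tlabels; apply pb_add; [apply pb_mul; [exact H4|]|]; pb).
  unfold ttotal. pb.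
Qed.

Lemma reduction_computable V c k : poly_computable (fun x => enc_inst (reduced V c k x)).
Proof.
  set (T := ttotal V c k).
  assert (H : poly_bounded (fun x => T x * (200 * (length x + T x + 1)))).
  { pose proof (pb_ttotal V c k : poly_bounded T). pb. }
  destruct H as (a & b & H).
  exists (compile (reduction_program V c k)), a, b. intros x.
  destruct (Ex_reduction V c k x) as (st & (t & Ht & HE) & HO).
  destruct (compile_halts _ _ _ _ HE) as (t' & Ht' & HH).
  exists t'. split.
  - eapply Nat.le_trans; [exact Ht'|]. eapply Nat.le_trans; [|apply H].
    fold T in Ht. apply Nat.mul_le_mono; auto. lia.
  - now rewrite HO, rev_involutive in HH.
Qed.

(** * Instances are determined by their encodings *)

(** Stronger than injectivity, and the property that survives concatenation: the components of an
    instance can be split off one after another. *)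
Definition prefix_free {A} (e : A -> list bool) : Prop :=
  forall a a' r r', e a ++ r = e a' ++ r' -> a = a' /\ r = r'.

Lemma enc_bits_pf : prefix_free enc_bits.
Proof.
  unfold enc_bits. intros a. induction a as [|b a IH]; intros [|b' a'] r r' H; simpl in H.
  - now injection H.
  - discriminate.
  - discriminate.
  - injection H as -> H. apply IH in H. destruct H as [-> ->]. auto.
Qed.

Lemma pos_bits_inj p q : pos_bits p = pos_bits q -> p = q.
Proof.
  revert q; induction p as [p IH|p IH|]; intros [q|q|] H; simpl in H; try discriminate; auto;
    injection H as H; try (f_equal; auto);
    try (destruct p; discriminate); try (destruct q; discriminate).
Qed.

Lemma enc_nat_pf : prefix_free enc_nat.
Proof.
  intros a a' r r' H. unfold enc_nat in H. apply enc_bits_pf in H. destruct H as [H ->].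
  split; auto. apply Nat2N.inj.
  destruct (N.of_nat a) as [|p], (N.of_nat a') as [|q]; auto.
  - destruct q; discriminate.
  - destruct p; discriminate.
  - f_equal. now apply pos_bits_inj.
Qed.

Lemma enc_Z_pf : prefix_free enc_Z.
Proof.
  intros [|p|p] [|q|q] r r' H; unfold enc_Z in H; apply enc_bits_pf in H; destruct H as [H ->];
    try discriminate; auto; injection H as H; apply pos_bits_inj in H; subst; auto.
Qed.

Lemma enc_Q_pf : prefix_free enc_Q.
Proof.
  intros [a b] [a' b'] r r' H. unfold enc_Q in H. rewrite <- !app_assoc in H. simpl in H.
  apply enc_Z_pf in H. destruct H as [-> H]. change (enc_Z (Zpos b) ++ r = enc_Z (Zpos b') ++ r') in H.
  apply enc_Z_pf in H. destruct H as [H ->]. injection H as ->. auto.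
Qed.

Lemma enc_list_pf {A} (e : A -> list bool) : prefix_free e -> prefix_free (enc_list e).
Proof.
  intros He l. unfold enc_list. induction l as [|a l IH]; intros [|a' l'] r r' H; simpl in H.
  - now injection H.
  - discriminate.
  - discriminate.
  - injection H as H. rewrite <- !app_assoc in H. apply He in H. destruct H as [-> H].
    rewrite !app_assoc in H. apply IH in H. destruct H as [-> ->]. auto.
Qed.

(** The language speaks of strings, so a string in it might a priori be the code of some other
    instance with a fit; this excludes it. *)
Lemma enc_inst_inj I J : enc_inst I = enc_inst J -> I = J.
Proof.
  destruct I as [n xs ys a b], J as [n' xs' ys' a' b']. unfold enc_inst; simpl. intros H.
  apply enc_nat_pf in H. destruct H as [-> H].
  apply (enc_list_pf _ (enc_list_pf _ enc_Q_pf)) in H. destruct H as [-> H].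
  apply (enc_list_pf _ enc_Q_pf) in H. destruct H as [-> H]. now injection H as -> ->.
Qed.

Theorem theorem8 : NP_hard TwoReLU_fit.
Proof.
  intros L (V & c & k & HL). exists (fun x => enc_inst (reduced V c k x)). split.
  - apply reduction_computable.
  - intros x. rewrite HL. rewrite <- (tableau_yes V c k x). split.
    + intros H. exists (reduced V c k x). split; [apply hinst_wf|]. auto.
    + intros (I & _ & E & H). apply enc_inst_inj in E. unfold reduced in E. now rewrite E.
Qed.
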